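(* If $T$ is a tree embedded in a disk whose interior vertices all have degree $3$, then $\overrightarrow{FG}(T)\cong\overrightarrow{EG}(\widehat Q_T)$ as directed graphs, and this isomorphism commutes with flips and mutations.
   Context: Trees. $T$ is a tree (finite connected acyclic graph) embedded in a closed disk $D^2$ so that a vertex lies on $\partial D^2$ iff it is a leaf; non-leaf vertices are called interior. The faces of $T$ are the 2-dimensional regions into which $T$ divides $D^2$. A corner is a pair $(v,F)$ with $v$ an interior vertex and $F$ a face containing $v$. An acyclic path is a sequence of vertices $(v_0,\dots,v_t)$ with $v_i,v_j$ adjacent iff $|i-j|=1$; it is identified with its reversal and written $[v_0,v_t]$. A segment is an acyclic path with at least two vertices, with non-leaf endpoints, such that any two consecutive edges are incident to a common face. Arcs. An arc is an acyclic path whose endpoints are distinct leaves and such that any two consecutive edges are incident to a common face. An arc $p=(v_0,\dots,v_t)$ contains the corner $(v,F)$ if $v=v_i$ for some $0<i<t$ and $F$ is the face incident to both $(v_{i-1},v_i)$ and $(v_i,v_{i+1})$. An arc $p$ divides $D^2$ into two components and so partitions the faces of $T$ into two sets, the regions defined by $p$; $\mathrm{Reg}(p,F)$ is the region containing $F$. Arcs $p,q$ cross along a segment $s$ if every vertex of $s$ appears in both $p$ and $q$ and, for all regions $R_p$ of $p$ and $R_q$ of $q$, $R_p\not\subset R_q$ and $R_q\not\subset R_p$; they are noncrossing if they cross along no segment. The noncrossing complex $\Delta^{NC}(T)$ is the simplicial complex of sets of pairwise noncrossing arcs. A boundary arc is an arc whose vertices all lie on a common face (it is noncrossing with every arc).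 The reduced noncrossing complex consists of the faces of $\Delta^{NC}(T)$ containing no boundary arc; its facets are those of $\Delta^{NC}(T)$ with boundary arcs removed, and the two kinds of facets are identified. Oriented flip graph. For a face $\mathcal F$ of $\Delta^{NC}(T)$ the arcs of $\mathcal F$ containing a corner $(v,F)$ are linearly ordered by $p\le q$ iff $\mathrm{Reg}(p,F)\subset\mathrm{Reg}(q,F)$; the maximal one is said to be marked at $(v,F)$. In a facet $\mathcal F$ of $\Delta^{NC}(T)$ each nonboundary arc $p$ is marked at exactly two corners, and there is a unique arc $q\notin\mathcal F$ such that $(\mathcal F\setminus\{p\})\cup\{q\}$ is a facet; replacing $p$ by $q$ is the flip of $\mathcal F$ at $p$. $\overrightarrow{FG}(T)$ has the facets as vertices and flips as edges, oriented as follows: if $\mathcal F_2=(\mathcal F_1\setminus\{p\})\cup\{q\}$ with $p$ marked at $(u,F),(v,G)$ in $\mathcal F_1$ and $q$ marked at $(u,F'),(v,G')$ in $\mathcal F_2$, then $\mathcal F_1\to\mathcal F_2$ if $(u,F')$ is immediately clockwise from $(u,F)$ about $u$ and $(v,G')$ is immediately clockwise from $(v,G)$ about $v$ (adjacent across an edge of $T$ at the vertex), and $\mathcal F_2\to\mathcal F_1$ otherwise. Quiver. $Q_T$ is the quiver whose vertices are the edges of $T$ containing no leaf (identified with $[n]$), with an arrow $e_1\to e_2$ whenever $e_1,e_2$ are the two edges at a corner $(v,F)$ and $e_2$ is counterclockwise from $e_1$ (i.e. $e_2$ is the next edge counterclockwise after $e_1$ about $v$, with $F$ between them). Oriented exchange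 graph. An ice quiver is a quiver (no loops or 2-cycles) with vertex set $[m]$, vertices $n+1,\dots,m$ frozen and no arrows between frozen vertices; its exchange matrix is $B=(b_{ij})_{i\in[n],j\in[m]}$, $b_{ij}=\#\{i\to j\}-\#\{j\to i\}$. Mutation $\mu_k$ at $k\in[n]$: $b'_{ij}=-b_{ij}$ if $i=k$ or $j=k$, and $b'_{ij}=b_{ij}+\frac{|b_{ik}|b_{kj}+b_{ik}|b_{kj}|}{2}$ otherwise. The framed quiver $\widehat Q$ of a quiver $Q$ with vertices $[n]$ has additional frozen vertices $n+1,\dots,2n$ and additional arrows $i\to n+i$. The exchange graph $EG(\widehat Q)$ has as vertices the ice quivers obtained from $\widehat Q$ by finitely many mutations, up to isomorphism fixing the frozen vertices; two are joined by an edge if they differ by a single mutation. For such an ice quiver $R$ the $\mathbf c$-matrix $C_R$ is formed by the last $n$ columns of $B_R$; its rows $\mathbf c_k$ are nonzero and lie in $\mathbb Z^n_{\ge0}$ (positive) or $\mathbb Z^n_{\le0}$ (negative). The oriented exchange graph $\overrightarrow{EG}(\widehat Q)$ is $EG(\widehat Q)$ with edges oriented $R\to\mu_kR$ iff $\mathbf c_k$ is positive in $C_R$. ''Commutes with flips and mutations'' means: whenever a facet $\mathcal F$ corresponds to $R$, there is a correspondence between the nonboundary arcs of $\mathcal F$ and the nonfrozen vertices of $R$ under which the flip of $\mathcal F$ at an arc corresponds to the mutation of $R$ at the associated vertex. *)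

(* Defs.v *)
From mathcomp Require Import all_boot all_order all_fingroup all_algebra.

Set Implicit Arguments.
Unset Strict Implicit.
Unset Printing Implicit Defensive.

Import GRing.Theory Num.Theory.

Record digraph := Digraph {
  dvertex :> Type;
  darrow : dvertex -> dvertex -> Prop }.

Definition digraph_iso (G H : digraph) (f : G -> H) : Prop :=
  bijective f /\ forall x y : G, darrow x y <-> darrow (f x) (f y).


(* An embedding of a tree in the closed disk with exactly the leaves on the
   boundary is given, up to orientation-preserving homeomorphism, by the
   counterclockwise cyclic order of the neighbours of every vertex:
   [ccw v w] is the neighbour of [v] following [w] counterclockwise. *)
Record planeTree := PlaneTree {
  vert :> finType;
  adj : rel vert;
  ccw : vert -> vert -> vert;
  adj_sym : symmetric adj;
  adj_irr : irreflexive adj;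
  vert_gt0 : 0 < #|vert|;
  adj_connected : forall u v, connect adj u v;
  adj_acyclic : forall c : seq vert, uniq c -> path.cycle adj c -> size c <= 2;
  ccw_adj : forall v w, adj v w -> adj v (ccw v w);
  ccw_cyclic :
    forall v w w', adj v w -> adj v w' -> fconnect (ccw v) w w' }.

Section TreeDefs.
Variable T : planeTree.
Implicit Types (u v w : T) (p q : {set T}).

Definition degree v := #|[set w | adj v w]|.
Definition leaf v := degree v == 1.

(* A face is represented by the set of darts (u, v), i.e. edges directed from
   u to v, that have it on their left. Walking along the face with the face on
   the left, a dart (u, v) into an interior vertex v is followed by the dart
   (v, w) with w the clockwise successor of u about v. The walk stops at leaves,
   which lie on the boundary of the disk. *)
Definition face_step (d d' : T * T) :=
  [&& adj d'.1 d'.2, ~~ leaf d'.1, d.2 == d'.1 & d.1 == ccw d'.1 d'.2].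

Definition face := {set T * T}.
Implicit Types F G : face.

Definition lface (u v : T) : face :=
  [set d | connect [rel d d' | face_step d d' || face_step d' d] (u, v) d].

Definition faces : {set face} := [set lface d.1 d.2 | d : T * T & adj d.1 d.2].

Definition edge_on_face F u v := ((u, v) \in F) || ((v, u) \in F).
Definition vertex_on_face F v := [exists w, edge_on_face F v w].

(* [tnth (in_tuple s) i] is the i-th vertex of s. *)
Definition acyclic_path (s : seq T) : Prop :=
  uniq s /\
  forall i j : 'I_(size s),
    adj (tnth (in_tuple s) i) (tnth (in_tuple s) j)
    = (i == j.+1 :> nat) || (j == i.+1 :> nat).

Definition turns_on_faces (s : seq T) : Prop :=
  forall s1 s2 u v w, s = s1 ++ [:: u, v, w & s2] ->
  exists2 F, F \in faces & edge_on_face F u v && edge_on_face F v w.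

Definition segment_seq (s : seq T) : Prop :=
  [/\ acyclic_path s, 1 < size s, turns_on_faces s
    & forall x s', s = x :: s' -> ~~ leaf x /\ ~~ leaf (last x s')].

Definition arc_seq (s : seq T) : Prop :=
  [/\ acyclic_path s, turns_on_faces s
    & exists x s', [/\ s = x :: s', leaf x, leaf (last x s') & x != last x s']].

(* In a tree an acyclic path is determined up to reversal by its set of
   vertices, so arcs, which are identified with their reversals, are represented
   as sets of vertices. *)
Definition traces_arc (s : seq T) p : Prop := arc_seq s /\ p = [set x in s].
Definition is_arc p : Prop := exists s, traces_arc s p.

Definition boundary_arc p : Prop :=
  is_arc p /\ exists2 F, F \in faces & forall v, v \in p -> vertex_on_face F v.

Definition contains_corner p v F : Prop :=
  exists s s1 s2 u w,
    [/\ traces_arc s p, s = s1 ++ [:: u, v, w & s2], F \in faces,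
        edge_on_face F u v & edge_on_face F v w].

(* Faces of T lie in the same component of the complement of p iff one can pass
   from one to the other across edges of T that are not edges of p. Since p is
   an induced path, an edge of T is an edge of p iff both its ends lie on p. *)
Definition across p F G :=
  [exists u, exists v, [&& adj u v, ~~ ((u \in p) && (v \in p)),
                           F == lface u v & G == lface v u]].
Definition Reg p F : {set face} := [set G in faces | connect (across p) F G].
Definition regions p : {set {set face}} := [set Reg p F | F in faces].

Definition cross_along (s : seq T) p q : Prop :=
  [/\ segment_seq s, (forall x, x \in s -> x \in p /\ x \in q)
    & forall Rp Rq, Rp \in regions p -> Rq \in regions q ->
        ~~ (Rp \subset Rq) /\ ~~ (Rq \subset Rp)].

Definition noncrossing p q : Prop := ~ exists s, cross_along s p q.

Implicit Types S : {set {set T}}.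

Definition nc_face S : Prop :=
  (forall p, p \in S -> is_arc p) /\
  (forall p q, p \in S -> q \in S -> noncrossing p q).

(* Facets are taken with their boundary arcs. *)
Definition facet S : Prop :=
  nc_face S /\ forall S', nc_face S' -> S \subset S' -> S' = S.

Definition nonboundary_in S p : Prop := p \in S /\ ~ boundary_arc p.

(* p is the maximal arc of S containing the corner (v, F). *)
Definition marked S p v F : Prop :=
  [/\ p \in S, contains_corner p v F
    & forall q, q \in S -> contains_corner q v F -> Reg q F \subset Reg p F].

Definition flip S1 p q S2 : Prop :=
  [/\ facet S1, facet S2, nonboundary_in S1 p, q \notin S1
    & S2 = q |: (S1 :\ p)].

(* The corner (u, F') is immediately clockwise from (u, F) about u. The face on
   the counterclockwise side at u of an edge uw is the one to the left of the
   dart (u, w). *)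
Definition next_clockwise u F F' : Prop :=
  exists w, [/\ adj u w, F = lface u w & F' = lface w u].

(* For a flip exchanging p and q between S1 and S2, this condition holds for
   exactly one of (S1, p, S2, q) and (S2, q, S1, p), so every flip is
   oriented in exactly one direction. *)
Definition clockwise_flip S1 p q S2 : Prop :=
  exists u v F G F' G',
    [/\ (u, F) != (v, G),
        marked S1 p u F /\ marked S1 p v G,
        marked S2 q u F' /\ marked S2 q v G',
        next_clockwise u F F' & next_clockwise v G G'].

Definition FG : digraph := @Digraph {S | facet S}
  (fun X Y => exists p q,
     flip (sval X) p q (sval Y) /\ clockwise_flip (sval X) p q (sval Y)).

Definition interior_edge_pred (e : {set T}) :=
  [exists u, exists v, [&& adj u v, ~~ leaf u, ~~ leaf v & e == [set u; v]]].
Definition interior_edge := {e : {set T} | interior_edge_pred e}.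

End TreeDefs.


(* A quiver is given by its numbers of arrows u -> v. *)
Definition quiver (X : Type) := X -> X -> nat.

(* The edges at the corner between vw and its counterclockwise successor. *)
Definition tree_quiver (T : planeTree) : quiver (interior_edge T) :=
  fun e1 e2 => [exists v : T, exists w : T,
    [&& adj v w, val e1 == [set v; w] & val e2 == [set v; ccw v w]]] : nat.

(* In a quiver on N + Fr the vertices in N are nonfrozen, those in Fr frozen. *)
Definition framed (N : finType) (Q : quiver N) : quiver (N + N) :=
  fun u v => match u, v with
    | inl i, inl j => Q i j
    | inl i, inr j => (i == j) : nat
    | inr _, _ => 0
    end.

Section Quivers.
Local Open Scope ring_scope.
Variables (N Fr : finType).
Implicit Types (R : quiver (N + Fr)) (i j k : N).

Definition ice_quiver R : Prop :=
  [/\ forall u, R u u = 0%N,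
      forall u v, R u v = 0%N \/ R v u = 0%N
    & forall x y : Fr, R (inr x) (inr y) = 0%N].

Definition exchange_matrix R : N -> N + Fr -> int :=
  fun i v => (R (inl i) v)%:Z - (R v (inl i))%:Z.

Definition mutate_matrix k (b : N -> N + Fr -> int) : N -> N + Fr -> int :=
  fun i v =>
    if (i == k) || (v == inl k) then - b i v
    else b i v + divz (`|b i (inl k)| * b k v + b i (inl k) * `|b k v|) 2.

(* An ice quiver is determined by its exchange matrix. *)
Definition mutation k R R' : Prop :=
  ice_quiver R' /\
  forall i v, exchange_matrix R' i v = mutate_matrix k (exchange_matrix R) i v.

Inductive mutation_equiv (R0 : quiver (N + Fr)) : quiver (N + Fr) -> Prop :=
| mutation_equiv_refl : mutation_equiv R0 R0
| mutation_equiv_step k R R' :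
    mutation_equiv R0 R -> mutation k R R' -> mutation_equiv R0 R'.

Definition frozen_iso R R' : Prop :=
  exists s : {perm N},
    let f v := match v with inl i => inl (s i) | inr x => inr x end in
    forall u v, R' (f u) (f v) = R u v.

Definition iso_class (R0 R : quiver (N + Fr)) : quiver (N + Fr) -> Prop :=
  fun R' => mutation_equiv R0 R' /\ frozen_iso R R'.

Definition c_matrix R : N -> Fr -> int := fun k x => exchange_matrix R k (inr x).
Definition c_positive R k : Prop := forall x, 0 <= c_matrix R k x.

(* The vertices are the isomorphism classes, as predicates on quivers. *)
Definition EG (R0 : quiver (N + Fr)) : digraph :=
  @Digraph
    {C : quiver (N + Fr) -> Prop |
      exists2 R, mutation_equiv R0 R & C = iso_class R0 R}
  (fun C C' => exists k R R',
     [/\ sval C R, sval C' R', mutation k R R' & c_positive R k]).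

End Quivers.

(* [beta] is the correspondence between nonfrozen vertices and nonboundary
   arcs. *)
Definition commutes_with_flips_and_mutations (T : planeTree)
    (phi : FG T -> EG (framed (@tree_quiver T))) : Prop :=
  forall (S : FG T) R, sval (phi S) R ->
  exists beta : interior_edge T -> {set T},
    [/\ injective beta,
        forall p, nonboundary_in (sval S) p <-> exists k, beta k = p
      & forall k (S' : FG T),
          (exists q, flip (sval S) (beta k) q (sval S')) <->
          (exists2 R', mutation k R R' & sval (phi S') R')].

(* Main.v *)
(** In a trivalent tree every path between two leaves is an arc, and two arcs cross exactly when
    their ends interlace in the counterclockwise order of the leaves (an interlaced quadruple of
    leaves is split two against two by an interior edge).  So facets are triangulations of the
    polygon whose vertices are the leaves, boundary arcs are its sides, and flips are flips of
    diagonals.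

    To a facet S attach an ice quiver on its nonboundary arcs: arrows run counterclockwise inside
    the triangles of S, and the entry of the c-vector of a diagonal ab with quadrilateral acbd at
    an interior edge e is the shear coordinate of the split of the leaves by e: +1 if e separates
    ac from bd, -1 if it separates ad from bc, and 0 otherwise.  A local computation shows that
    flips become mutations.  The arcs that turn right at every vertex form a facet whose quiver is
    the framed quiver, and it is the only facet with this quiver; since flips connect all facets
    (through a fan) and mutation is involutive, a reachable quiver determines its facet.

    An arc ab is marked at the branching vertices of the leaves a, b, c and of a, b, d.  When an
    edge separates ac from bd these are also the branching vertices for the diagonal cd, whose
    marked corners follow clockwise; hence clockwise flips are those with positive c-vector. *)
From Stdlib Require Import FunctionalExtensionality PropExtensionality ClassicalEpsilon.
Require Import Defs.
From mathcomp Require Import all_boot all_order all_fingroup all_algebra zify.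
Set Implicit Arguments.
Unset Strict Implicit.
Unset Printing Implicit Defensive.

Import GRing.Theory Num.Theory.

(** * Triangulations of a polygon *)

(** All plane geometry is turned into arithmetic on the positions 0, ..., m - 1 of the leaves. The
    key number is [fs u v], the position of the leaf reached from the dart (u, v) by turning right
    at every vertex. It labels the face to the right of the dart, so that face k is the one between
    leaves k - 1 and k (modulo m). The leaves beyond v form the cyclic interval [[fs u v],
    [fs v u][, while the faces on one side of the arc from i to j are those with label in ]i, j];
    hence the two kinds of half-open intervals. Crossing, regions, corners and markings become
    statements on [cyc], [arc_oc] and [arc_co], within reach of [lia].

    The vertices of the exchange graph are isomorphism classes, so the nonfrozen vertices of a
    quiver have no names of their own. *)

Definition cyc (i j k : nat) := [|| i < j < k, j < k < i | k < i < j].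

(* The cyclic interval ]i, j]. *)
Definition arc_oc (i j k : nat) := if i < j then i < k <= j else (i < k) || (k <= j).

(* The cyclic interval [i, j[. *)
Definition arc_co (i j k : nat) := if i < j then (i <= k) && (k < j) else (i <= k) || (k < j).

Definition crossed (i j k l : nat) := cyc i k j && cyc j l i || cyc i l j && cyc j k i.

Lemma cyc_rot i j k : cyc i j k = cyc j k i.
Proof. by rewrite /cyc orbC -orbA. Qed.

Lemma arc_oc_in i j k : cyc i k j -> arc_oc i j k.
Proof. by rewrite /cyc /arc_oc; case: ifP; lia. Qed.

Lemma arc_oc_out i j k : cyc j k i -> arc_oc i j k = false.
Proof. by rewrite /cyc /arc_oc; case: ifP; lia. Qed.

Lemma arc_oc_r i j : i != j -> arc_oc i j j.
Proof. by rewrite /arc_oc; case: ifP; lia. Qed.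

Lemma arc_oc_l i j : i != j -> arc_oc i j i = false.
Proof. by rewrite /arc_oc; case: ifP; lia. Qed.

(** The four ends themselves realize the four combinations of sides. With faces as points, this
    shows that no region of one arc contains a region of the other. *)
Lemma crossed_arcs i j k l (b1 b2 : bool) : i != j -> k != l -> crossed i j k l ->
  exists2 a, a \in [:: i; j; k; l] & arc_oc i j a = b1 /\ arc_oc k l a = b2.
Proof.
move=> ij kl; have hi := arc_oc_l ij; have hj := arc_oc_r ij.
have hk := arc_oc_l kl; have hl := arc_oc_r kl.
case/orP=> /andP[c1 c2].
  have h1 := arc_oc_in c1; have h2 := arc_oc_out c2.
  have h3 : arc_oc k l j by apply: arc_oc_in; rewrite /cyc in c1 c2 *; lia.
  have h4 : arc_oc k l i = false by apply: arc_oc_out; rewrite /cyc in c1 c2 *; lia.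
  by case: b1; case: b2; [exists j|exists k|exists l|exists i]; rewrite ?inE ?eqxx ?orbT.
have h1 := arc_oc_in c1; have h2 := arc_oc_out c2.
have h3 : arc_oc k l i by apply: arc_oc_in; rewrite /cyc in c1 c2 *; lia.
have h4 : arc_oc k l j = false by apply: arc_oc_out; rewrite /cyc in c1 c2 *; lia.
by case: b1; case: b2; [exists l|exists j|exists i|exists k]; rewrite ?inE ?eqxx ?orbT.
Qed.

(** The version for intervals closed on the left, which describe the leaves beyond an edge rather
    than the faces beside an arc. *)
Lemma crossed_arcs_co i j k l (b1 b2 : bool) : i != j -> k != l -> crossed i j k l ->
  exists2 a, a \in [:: i; j; k; l] & arc_co i j a = b1 /\ arc_co k l a = b2.
Proof.
have c_l i' j' : i' != j' -> arc_co i' j' i' by rewrite /arc_co; case: ifP; lia.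
have c_r i' j' : i' != j' -> arc_co i' j' j' = false by rewrite /arc_co; case: ifP; lia.
have c_in i' j' k' : cyc i' k' j' -> arc_co i' j' k' by rewrite /cyc /arc_co; case: ifP; lia.
have c_out i' j' k' : cyc j' k' i' -> arc_co i' j' k' = false.
  by rewrite /cyc /arc_co; case: ifP; lia.
move=> ij kl; have hi := c_l _ _ ij; have hj := c_r _ _ ij.
have hk := c_l _ _ kl; have hl := c_r _ _ kl.
case/orP=> /andP[c1 c2].
  have h1 := c_in _ _ _ c1; have h2 := c_out _ _ _ c2.
  have h3 : arc_co k l j by apply: c_in; rewrite /cyc in c1 c2 *; lia.
  have h4 : arc_co k l i = false by apply: c_out; rewrite /cyc in c1 c2 *; lia.
  by case: b1; case: b2; [exists k|exists i|exists j|exists l]; rewrite ?inE ?eqxx ?orbT.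
have h1 := c_in _ _ _ c1; have h2 := c_out _ _ _ c2.
have h3 : arc_co k l i by apply: c_in; rewrite /cyc in c1 c2 *; lia.
have h4 : arc_co k l j = false by apply: c_out; rewrite /cyc in c1 c2 *; lia.
by case: b1; case: b2; [exists i|exists l|exists k|exists j]; rewrite ?inE ?eqxx ?orbT.
Qed.

Definition succ_mod (n i : nat) := if i.+1 == n then 0 else i.+1.

Definition consecutive (n i j : nat) := (j == succ_mod n i) || (i == succ_mod n j).

Section Polygon.
Implicit Types a b c d e f i j k l x y z t : nat.

Definition same i j k l := (i == k) && (j == l) || (i == l) && (j == k).

Lemma sameC i j k l : same i j k l = same j i k l.
Proof. by rewrite /same orbC andbC (andbC (j == l)). Qed.

Lemma sameCr i j k l : same i j k l = same i j l k.
Proof. by rewrite /same orbC. Qed.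

Lemma crossedC i j k l : crossed i j k l = crossed j i k l.
Proof. by rewrite /crossed orbC andbC (andbC (cyc j l i)). Qed.

Lemma crossedCr i j k l : crossed i j k l = crossed i j l k.
Proof. by rewrite /crossed orbC. Qed.

Lemma cyc_split a b c e : cyc a c b -> cyc a e b -> e != c -> cyc a e c || cyc c e b.
Proof. rewrite /cyc; lia. Qed.

Lemma cyc_trans a b c f : cyc a c b -> cyc b f a -> cyc c f a /\ cyc b f c.
Proof. rewrite /cyc; lia. Qed.

Lemma quad_rot a b c d : cyc a c b -> cyc b d a -> cyc c b d /\ cyc d a c.
Proof. rewrite /cyc; lia. Qed.

Lemma crossed_swap i j k l : crossed i j k l = crossed k l i j.
Proof.
suff W i' j' k' l' : crossed i' j' k' l' -> crossed k' l' i' j' by apply/idP/idP; exact: W.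
by case/orP=> /andP[h1 h2]; have [h3 h4] := quad_rot h1 h2; rewrite /crossed h3 h4 ?orbT.
Qed.

Lemma cyc_neq i j k : cyc i j k -> [/\ i != j, j != k & i != k].
Proof. rewrite /cyc => h; split; lia. Qed.

Lemma crossed_self i j : crossed i j i j = false.
Proof. rewrite /crossed /cyc; lia. Qed.

(** A chord zt that crosses cb but neither ab nor ac can leave the triangle only through its vertex
    a. *)
Lemma crossed_fan a b c z t : cyc a c b -> cyc c z b -> cyc b t c ->
  ~~ crossed a b z t -> ~~ crossed a c z t -> t = a.
Proof.
move=> acb czb btc n1 n2; have bac : cyc b a c by rewrite cyc_rot.
have [azb cza] := cyc_trans bac czb.
apply/eqP; apply: contraT => ta; case/orP: (cyc_split bac btc ta) => h.
  by case/negP: n1; rewrite /crossed azb h.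
by case/negP: n2; rewrite /crossed cza h orbT.
Qed.

(** An end of ef lying beyond ab and different from c is cut off from the other end by ac or cb;
    likewise for d with bd and da. *)
Lemma crossed_quad a b c d e f : cyc a c b -> cyc b d a -> crossed a b e f ->
  ~~ crossed a c e f -> ~~ crossed c b e f -> ~~ crossed b d e f -> ~~ crossed d a e f ->
  same e f c d.
Proof.
wlog /andP[aeb bfa] : e f / cyc a e b && cyc b f a.
  move=> W acb bda abef; case/orP: (abef) => h; first exact: W.
  rewrite sameC !(crossedCr _ _ e); apply: W => //; by rewrite 1?crossedCr.
move=> acb bda _ n1 n2 n3 n4.
have ec : e = c.
  apply/eqP; apply: contraT => ec; case/orP: (cyc_split acb aeb ec) => h.
    have [h1 h2] := cyc_trans acb bfa.
    by case/negP: n1; rewrite /crossed h h1.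
  have [h1 h2] := cyc_trans acb bfa.
  by case/negP: n2; rewrite /crossed h h2.
have fd : f = d.
  apply/eqP; apply: contraT => fd; case/orP: (cyc_split bda bfa fd) => h.
    have [h1 h2] := cyc_trans bda aeb.
    by case/negP: n3; rewrite /crossed h h1 orbT.
  have [h1 h2] := cyc_trans bda aeb.
  by case/negP: n4; rewrite /crossed h h2 orbT.
by rewrite /same ec fd !eqxx.
Qed.

(** Triangulations are defined by maximality, as facets are. The sides of the polygon cross nothing,
    so they belong to every triangulation, like boundary arcs to every facet. *)
Record triangulation (m : nat) (E : rel nat) : Prop := Triangulation {
  tri_sym : forall i j, E i j = E j i;
  tri_dom : forall i j, E i j -> [/\ i < m, j < m & i != j];
  tri_nc : forall i j k l, E i j -> E k l -> ~~ crossed i j k l;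
  tri_max : forall i j, i < m -> j < m -> i != j ->
    (forall k l, E k l -> ~~ crossed i j k l) -> E i j }.

(** The vertices a, c, b, d run counterclockwise and ab is the diagonal. In a triangulation a
    diagonal has two presentations, acbd and bdac; a flip rotates acbd to cbda. *)
Record quad (E : rel nat) a c b d : Prop := Quad {
  quad_acb : cyc a c b; quad_bda : cyc b d a; quad_ab : E a b;
  quad_ac : E a c; quad_cb : E c b; quad_bd : E b d; quad_da : E d a }.

Definition flip_rel (E : rel nat) a c b d : rel nat :=
  fun i j => same i j c d || E i j && ~~ same i j a b.

Variable m : nat.

Section Triangulation.
Variable E : rel nat.
Hypothesis tE : triangulation m E.

Lemma tri_maxN i j : i < m -> j < m -> i != j -> ~~ E i j ->
  exists k l, E k l /\ crossed i j k l.
Proof.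
move=> im jm ij nE.
case: (boolP [exists k : 'I_m, exists l : 'I_m, E k l && crossed i j k l]) => [|no].
  by case/existsP=> k /existsP[l /andP[h1 h2]]; exists k, l.
case/negP: nE; apply: (tri_max tE) => // k l Ekl; apply: contraNN no => cr.
have [km lm _] := tri_dom tE Ekl.
by apply/existsP; exists (Ordinal km); apply/existsP; exists (Ordinal lm); rewrite /= Ekl.
Qed.

Lemma tri_succ i : 1 < m -> i < m -> E i (succ_mod m i).
Proof.
move=> m1 im; apply: (tri_max tE) => //; rewrite /succ_mod.
- by case: ifP; lia.
- by case: ifP; lia.
move=> k l /(tri_dom tE)[km lm _]; apply/negP; rewrite /crossed /cyc; case: ifP; lia.
Qed.

(** The apex is found by walking from the successor of a towards b, along neighbours c of a. If cb
    is not a chord, some chord crosses it, and [crossed_fan] makes it a chord from a to a point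
    nearer to b. *)
Lemma tri_triangle a b k : E a b -> k < m -> cyc a k b ->
  exists c, [/\ c < m, cyc a c b, E a c & E c b].
Proof.
move=> Eab km akb; have [am bm ab] := tri_dom tE Eab.
have m1 : 1 < m by move: akb; clear -am bm km; rewrite /cyc; lia.
have c0 : cyc a (succ_mod m a) b.
  by move: akb; clear -am bm km; rewrite /cyc /succ_mod; case: ifP; lia.
have cm0 : succ_mod m a < m by clear -m1 am; rewrite /succ_mod; case: ifP; lia.
have := tri_succ m1 am; move: (succ_mod m a) cm0 c0 => c.
pose dist c := if c <= b then b - c else b + m - c.
have [N] := ubnP (dist c); elim: N c => // N IH c lt cm acb Eac.
case: (boolP (E c b)) => Ecb; first by exists c.
have cb : c != b by move: acb; clear; rewrite /cyc; lia.
have [k' [l' [Ezt cr]]] := tri_maxN cm bm cb Ecb.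
have [z [t [{}Ezt czb btc]]] : exists z t, [/\ E z t, cyc c z b & cyc b t c].
  by case/orP: cr => /andP[h1 h2]; [exists k', l'|exists l', k'; rewrite (tri_sym tE)].
have et := crossed_fan acb czb btc (tri_nc tE Eab Ezt) (tri_nc tE Eac Ezt).
have [zm _ _] := tri_dom tE Ezt.
rewrite et in Ezt; apply: (IH z) => //; last by rewrite (tri_sym tE).
  by move: lt acb czb; clear -cm zm bm; rewrite /dist /cyc; do 2 case: ifP; lia.
by move: acb czb; clear; rewrite /cyc; lia.
Qed.

Lemma tri_quad a b k l : E a b -> k < m -> l < m -> cyc a k b -> cyc b l a ->
  exists c d, quad E a c b d.
Proof.
move=> Eab km lm akb bla.
have [c [_ acb Eac Ecb]] := tri_triangle Eab km akb.
have Eba : E b a by rewrite (tri_sym tE).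
have [d [_ bda Ebd Eda]] := tri_triangle Eba lm bla.
by exists c, d.
Qed.

Lemma quad_swap a c b d : quad E a c b d -> quad E b d a c.
Proof. by case=> *; split; rewrite // (tri_sym tE). Qed.

Lemma quad_diag_new a c b d : quad E a c b d -> ~~ E c d.
Proof.
case=> acb bda Eab _ _ _ _; apply/negP => Ecd.
by have := tri_nc tE Eab Ecd; rewrite /crossed acb bda.
Qed.

(** By [crossed_quad] in the rotated quadrilateral, ab is the only chord crossing cd. For
    maximality, a pair crossing nothing after the flip is cd if it crosses ab, and was already a
    chord otherwise. *)
Lemma flip_triangulation a c b d : quad E a c b d -> triangulation m (flip_rel E a c b d).
Proof.
move=> Q; have nEcd := quad_diag_new Q; case: Q => acb bda Eab Eac Ecb Ebd Eda.
have [cbd dac] := quad_rot acb bda.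
have [ac cb ab] := cyc_neq acb; have [bd da _] := cyc_neq bda; have [_ _ cd] := cyc_neq cbd.
have [am bm _] := tri_dom tE Eab; have [cm _ _] := tri_dom tE Ecb.
have [dm _ _] := tri_dom tE Eda.
have onlyab k l : E k l -> crossed c d k l -> same k l a b.
  move=> Ekl cr; rewrite sameCr.
  apply: (@crossed_quad c d b a k l) => //.
  - exact: (tri_nc tE Ecb Ekl).
  - exact: (tri_nc tE Ebd Ekl).
  - exact: (tri_nc tE Eda Ekl).
  - exact: (tri_nc tE Eac Ekl).
have noself i j k l : same i j k l -> ~~ crossed i j k l.
  by clear; rewrite /same /crossed /cyc; lia.
have same_cr i j k l e f : same i j k l -> crossed i j e f = crossed k l e f.
  by case/orP=> /andP[/eqP-> /eqP->] //; rewrite crossedC.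
split.
- by move=> i j; rewrite /flip_rel sameC (tri_sym tE) (sameC _ _ a).
- by move=> i j /orP[/orP[]/andP[/eqP-> /eqP->]|/andP[/(tri_dom tE)]] //; split; rewrite // eq_sym.
- move=> i j k l /orP[s|/andP[Eij nab]] /orP[s'|/andP[Ekl nab']].
  + rewrite (same_cr _ _ _ _ _ _ s); apply: noself; rewrite /same in s s' *.
    by move: s'; clear; rewrite /same; lia.
  + by rewrite (same_cr _ _ _ _ _ _ s); apply: contraNN nab' => /onlyab; apply.
  + rewrite crossed_swap (same_cr _ _ _ _ _ _ s'); apply: contraNN nab => /onlyab; exact.
  + exact: (tri_nc tE).
move=> i j im jm ij h; rewrite /flip_rel.
have side k l : E k l -> ~~ same k l a b -> ~~ crossed k l i j.
  by move=> Ekl nab; rewrite crossed_swap; apply: h; rewrite /flip_rel Ekl nab orbT.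
have nab k l : k != a -> k != b -> ~~ same k l a b.
  by rewrite /same => /negbTE-> /negbTE->.
have nab' k l : l != a -> l != b -> ~~ same k l a b.
  by move=> h1 h2; rewrite sameC nab.
case: (boolP (crossed a b i j)) => cr.
  apply/orP; left; apply: (crossed_quad acb bda cr); apply: side => //.
  - by apply: nab'; rewrite // eq_sym.
  - by apply: nab; rewrite // eq_sym.
  - by apply: nab'; rewrite // eq_sym.
  - by apply: nab; rewrite // eq_sym.
have Eij : E i j.
  apply: (tri_max tE) => // k l Ekl; case: (boolP (same k l a b)) => s.
    by rewrite crossed_swap (same_cr _ _ _ _ _ _ s).
  by rewrite crossed_swap; exact: side.
rewrite Eij /=; case: (boolP (same i j c d)) => //= ncd; apply/negP => s.
have := h c d; rewrite /flip_rel /same !eqxx /= => /(_ isT).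
by rewrite (same_cr _ _ _ _ _ _ s) /crossed acb bda.
Qed.

Lemma flip_quad a c b d : quad E a c b d -> quad (flip_rel E a c b d) c b d a.
Proof.
case=> acb bda Eab Eac Ecb Ebd Eda.
have [cbd dac] := quad_rot acb bda.
have [ac cb ab] := cyc_neq acb; have [bd da _] := cyc_neq bda.
have hE k l : E k l -> ~~ same k l a b -> flip_rel E a c b d k l.
  by rewrite /flip_rel => -> ->; rewrite orbT.
split=> //.
- by rewrite /flip_rel /same !eqxx.
- by apply: hE => //; clear -ac cb ab; rewrite /same; lia.
- by apply: hE => //; clear -bd da; rewrite /same; lia.
- by apply: hE => //; clear -bd da ab; rewrite /same; lia.
- by apply: hE => //; clear -ac cb; rewrite /same; lia.
Qed.

(** By maximality the new chord ef crosses a chord of [E], which can only be the removed ab. It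
    crosses no side of the quadrilateral, so [crossed_quad] applies. *)
Lemma flip_unique E' a c b d e f : triangulation m E' -> quad E a c b d ->
  (forall i j, E' i j = same i j e f || E i j && ~~ same i j a b) ->
  ~~ E e f -> same e f c d.
Proof.
move=> tE' [acb bda Eab Eac Ecb Ebd Eda] eE' nE.
have [ac cb ab] := cyc_neq acb; have [bd da _] := cyc_neq bda.
have Eef : E' e f by rewrite eE' /same !eqxx.
have [em fm ef] := tri_dom tE' Eef.
have [k [l [Ekl cr]]] := tri_maxN em fm ef nE.
have kab : same k l a b.
  apply: contraTT cr => nab; apply: (tri_nc tE' Eef); by rewrite eE' Ekl nab orbT.
have side x y : E x y -> ~~ same x y a b -> ~~ crossed x y e f.
  move=> Exy nab; rewrite crossed_swap; apply: (tri_nc tE' Eef); by rewrite eE' Exy nab orbT.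
apply: (crossed_quad acb bda).
- rewrite crossed_swap; move: cr; case/orP: kab => /andP[/eqP-> /eqP->] //.
  by rewrite crossedCr.
- by apply: side => //; clear -ac cb ab; rewrite /same; lia.
- by apply: side => //; clear -ac cb ab; rewrite /same; lia.
- by apply: side => //; clear -bd da ab; rewrite /same; lia.
- by apply: side => //; clear -bd da ab; rewrite /same; lia.
Qed.

(** In the second alternative the flip of cb is a new chord from 0 to d, so the number of chords at
    0 grows. A missing chord from 0 to x provides, by maximality, a chord passing over x. *)
Lemma fan_step : 1 < m -> (forall x, 0 < x < m -> E 0 x) \/
  exists c d b, quad E c d b 0.
Proof.
move=> m1; case: (boolP [forall x : 'I_m, (0 < x) ==> E 0 x]) => [/forallP h|].
  by left=> x /andP[x0 xm]; have := h (Ordinal xm); rewrite x0.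
case/forallPn=> x; rewrite negb_imply => /andP[x0 nE]; right.
have xm := ltn_ord x; move: (nat_of_ord x) xm x0 nE => {}x xm x0 nE.
have m0 : 0 < m by exact: ltnW.
have x0' : 0 != x by rewrite neq_ltn x0.
have [k [l [Ekl cr]]] := tri_maxN m0 xm x0' nE.
have {k l Ekl cr} [c [b [Ecb cx xb bm]]] : exists c b, [/\ E c b, 0 < c < x, x < b & b < m].
  have [km lm _] := tri_dom tE Ekl.
  move: cr; rewrite /crossed /cyc => cr.
  case: (ltnP k x) => kx; [exists k, l|exists l, k; rewrite (tri_sym tE)]; split=> //; move: cr kx; clear -km lm; lia.
(* A widest chord over x spans a triangle with apex 0. *)
have [N] := ubnP (m - (b - c)); elim: N c b Ecb cx xb bm => // N IH c b Ecb cx xb bm lt.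
have cm : c < m by case/andP: cx => _ /ltn_trans; apply.
have cxb : cyc c x b by move: cx xb; clear; rewrite /cyc; lia.
have b0c : cyc b 0 c by move: cx xb; clear; rewrite /cyc; lia.
have Ebc : E b c by rewrite (tri_sym tE).
have [e [em bec Ebe Eec]] := tri_triangle Ebc m0 b0c.
case: (posnP e) => [e0|e0].
  subst e; have [d [dm cdb Ecd Edb]] := tri_triangle Ecb xm cxb.
  by exists c, d, b; split.
case: (ltnP b e) => be.
  by apply: (IH c e); rewrite // 1?(tri_sym tE) //; move: bec lt cx be xb em bm; rewrite /cyc; clear; lia.
by apply: (IH e b); rewrite // 1?(tri_sym tE) //; move: bec lt cx be xb em bm e0; rewrite /cyc; clear; lia.
Qed.

End Triangulation.

(** Away from 0, a chord from i to some j beyond i + 1 would cross the chord from 0 to i + 1; only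
    sides of the polygon remain. *)
Lemma fan_unique E E' : triangulation m E -> triangulation m E' ->
  (forall x, 0 < x < m -> E 0 x) -> (forall x, 0 < x < m -> E' 0 x) ->
  forall i j, E i j -> E' i j.
Proof.
move=> tE tE' h h' i j Eij; have [im jm ij] := tri_dom tE Eij.
have m1 : 1 < m by move: im jm ij; clear; lia.
wlog lt : i j im jm {ij} Eij / i < j.
  move=> W; case: (ltngtP i j) ij => // ltij _; first exact: W.
  by rewrite (tri_sym tE'); apply: W; rewrite // (tri_sym tE).
case: (posnP i) => [->|i0]; first by apply: h'; move: lt jm; clear; lia.
have -> : j = succ_mod m i.
  have : ~~ crossed i j 0 i.+1 \/ m <= i.+1.
    by case: (leqP m i.+1) => hm; [right|left; apply: (tri_nc tE) => //; exact: h].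
  rewrite /succ_mod /crossed /cyc; move: lt jm im i0; clear; case: ifP; lia.
exact: tri_succ.
Qed.

Lemma tri_apex E c d a z : triangulation m E -> E d a -> E a c -> E z c -> E d z ->
  cyc c d a -> cyc c d z -> z = a.
Proof.
move=> tE Eda Eac Ezc Edz cda cdz; apply/eqP; apply: contraT => za.
have dac : cyc d a c by rewrite -cyc_rot.
have dzc : cyc d z c by rewrite -cyc_rot.
case/orP: (cyc_split dac dzc za) => h.
  by have := tri_nc tE Eda Ezc; rewrite /crossed h cyc_rot cda.
by have := tri_nc tE Eac Edz; rewrite crossedCr /crossed h cda.
Qed.

(* Up to the symmetries of a quadrilateral, a diagonal other than the flipped one either keeps
   its quadrilateral or is a side ac or cb of the quadrilateral of the flip. *)
Lemma quad_flip_ind E (G : nat -> nat -> nat -> nat -> nat -> nat -> nat -> nat -> Prop) :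
  triangulation m E ->
  (forall a c b d p x p' y, G a c b d p' y p x -> G a c b d p x p' y) ->
  (forall a c b d p x p' y, G b d a c p x p' y -> G a c b d p x p' y) ->
  (forall a c b d p x p' y, quad E a c b d -> quad E p x p' y ->
     ~~ same p p' a b -> ~~ same p p' c d ->
     [/\ ~~ same p x a b, ~~ same x p' a b, ~~ same p' y a b & ~~ same y p a b] ->
     [/\ ~~ same p x c d, ~~ same x p' c d, ~~ same p' y c d & ~~ same y p c d] ->
     G a c b d p x p' y) ->
  (forall a c b d x, quad E a c b d -> quad E a x c b -> G a c b d a x c d) ->
  (forall a c b d x, quad E a c b d -> quad E c x b a -> G a c b d c x b d) ->
  forall a c b d p x p' y, quad E a c b d -> quad (flip_rel E a c b d) p x p' y ->
    ~~ same p p' c d -> G a c b d p x p' y.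
Proof.
move=> tE symG rotG keep sideac sidecb.
have notnew i j a c b d : flip_rel E a c b d i j -> ~~ same i j c d -> E i j.
  by rewrite /flip_rel => + n; rewrite (negbTE n) => /andP[].
have nsame i j c d : i != d -> j != d -> ~~ same i j c d.
  by rewrite /same => /negbTE-> /negbTE->; rewrite andbF.
have rotQ a c b d p x p' y : quad (flip_rel E a c b d) p x p' y -> quad (flip_rel E b d a c) p x p' y.
  have e i j : flip_rel E a c b d i j = flip_rel E b d a c i j.
    by rewrite /flip_rel (sameCr i j c) (sameCr i j a).
  by case; rewrite !e.
(* The chord cd is a side of the new quadrilateral, and its triangle on the side of a is already
   known to be cda; hence p = a. *)
have mainac a c b d p x : quad E a c b d -> quad (flip_rel E a c b d) p x c d -> G a c b d p x c d.
  move=> Q [pxc cdp Epc E1 E2 _ E4].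
  have tE' := flip_triangulation tE Q.
  have [cbd dac Ecd' Ecb' _ Eda' Eac'] := flip_quad Q.
  have cda : cyc c d a by rewrite cyc_rot.
  have ep := tri_apex tE' Eda' Eac' Epc E4 cda cdp; subst p.
  apply: sideac => //; case: (Q) => acb bda Eab Eac Ecb Ebd Eda.
  have [ax xc _] := cyc_neq pxc.
  have [cd da _] := cyc_neq cda.
  have xd : x != d by apply: contraTneq pxc => ->; move: cda; clear; rewrite /cyc; lia.
  have ad : a != d by rewrite eq_sym.
  split=> //.
  - by rewrite 2!cyc_rot.
  - by apply: notnew E1 _; exact: nsame.
  - by apply: notnew E2 _; exact: nsame.
  - by rewrite (tri_sym tE).
have maincb a c b d p' x : quad E a c b d -> quad (flip_rel E a c b d) c x p' d -> G a c b d c x p' d.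
  move=> Q [cxp pdc Ecp E1 E2 Epd _].
  have tE' := flip_triangulation tE Q.
  have [cbd dac _ Ecb' Ebd' _ _] := flip_quad Q.
  have dcb : cyc d c b by rewrite cyc_rot.
  have dcp : cyc d c p' by rewrite 2!cyc_rot.
  have ep := tri_apex tE' Ecb' Ebd' Epd Ecp dcb dcp.
  subst p'; apply: sidecb => //; case: (Q) => acb bda Eab Eac Ecb Ebd Eda.
  have [cx xb _] := cyc_neq cxp.
  have [dc cb db] := cyc_neq dcb.
  have xd : x != d by apply: contraTneq cxp => ->; move: dcb; clear; rewrite /cyc; lia.
  have cd : c != d by rewrite eq_sym.
  have bd : b != d by rewrite eq_sym.
  split=> //.
  - by rewrite cyc_rot.
  - by apply: notnew E1 _; exact: nsame.
  - by apply: notnew E2 _; exact: nsame.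
  - by rewrite (tri_sym tE).
have main a c b d p x p' y : quad E a c b d -> quad (flip_rel E a c b d) p x p' y ->
    ~~ same p p' c d -> same p' y c d || same y p c d -> G a c b d p x p' y.
  move=> Q Q' npp; have Qr := quad_swap tE Q; have Qr' := rotQ _ _ _ _ _ _ _ _ Q'.
  case/orP=> /orP[] /andP[/eqP e1 /eqP e2]; subst.
  - exact: mainac.
  - by apply: rotG; exact: mainac.
  - by apply: rotG; exact: maincb.
  - exact: maincb.
move=> a c b d p x p' y Q Q' npp.
case: (boolP (same p' y c d || same y p c d)) => [|n1]; first exact: main.
case: (boolP (same p x c d || same x p' c d)) => [s|n2].
  apply: symG; apply: main => //; last by rewrite sameC.
  by apply: (quad_swap (flip_triangulation tE Q)).
case/norP: n1 => n1 n1'; case/norP: n2 => n2 n2'.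
case: Q' => pxp pyp /orP[|/andP[Epp npp']]; first by rewrite (negbTE npp).
move=> /orP[|/andP[E1 m1]]; first by rewrite (negbTE n2).
move=> /orP[|/andP[E2 m2]]; first by rewrite (negbTE n2').
move=> /orP[|/andP[E3 m3]]; first by rewrite (negbTE n1).
move=> /orP[|/andP[E4 m4]]; first by rewrite (negbTE n1').
by apply: keep.
Qed.

End Polygon.

Lemma triangulation_ext m E E' : E =2 E' -> triangulation m E -> triangulation m E'.
Proof.
move=> e [h1 h2 h3 h4]; split.
- by move=> i j; rewrite -!e.
- by move=> i j; rewrite -e; exact: h2.
- by move=> i j k l; rewrite -!e; exact: h3.
- by move=> i j im jm ij h; rewrite -e; apply: h4 => // k l; rewrite e; exact: h.
Qed.

Lemma quad_ext E E' a c b d : E =2 E' -> quad E a c b d -> quad E' a c b d.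
Proof. by move=> e [*]; split; rewrite -?e. Qed.

Lemma quad_neq E a c b d : quad E a c b d ->
  [/\ a != b, a != c, a != d & [/\ b != c, b != d & c != d]].
Proof.
case=> acb bda _ _ _ _ _; move: acb bda; clear; rewrite /cyc => h1 h2.
by split; [..|split]; lia.
Qed.

Lemma quad_uniq n E a c b d c' d' : triangulation n E -> quad E a c b d -> quad E a c' b d' ->
  c = c' /\ d = d'.
Proof.
move=> tE [acb bda Eab Eac Ecb Ebd Eda] [acb' bda' _ Eac' Ecb' Ebd' Eda'].
have bac : cyc b a c by rewrite cyc_rot.
have bac' : cyc b a c' by rewrite cyc_rot.
have abd : cyc a b d by rewrite cyc_rot.
have abd' : cyc a b d' by rewrite cyc_rot.
split; apply/esym.
  exact: tri_apex tE Eac Ecb _ _ bac bac'.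
exact: tri_apex tE Ebd Eda _ _ abd abd'.
Qed.

Lemma arc_ocP i j k : i != j -> arc_oc i j k = (k == j) || cyc i k j.
Proof. by rewrite /arc_oc /cyc; case: ifP; lia. Qed.

Lemma cyc_widen_l x y z l : cyc x y z -> cyc x l z -> ~~ cyc y l z -> (l == y) || cyc x l y.
Proof. rewrite /cyc; lia. Qed.

Lemma cyc_widen_r x l z k : cyc k l z -> cyc x l z -> ~~ cyc z k x -> (k == x) || cyc x k l.
Proof. rewrite /cyc; lia. Qed.

Lemma cyc_between x k l t : cyc x k l -> cyc k t l -> cyc x t l.
Proof. rewrite /cyc; lia. Qed.

Lemma cyc_between_r x l y t : cyc x l y -> cyc x t l -> cyc x t y.
Proof. rewrite /cyc; lia. Qed.

(** A chord kl avoiding the sides xz and yz of a triangle cannot reach past x or y, so x, k, l, y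
    occur in this order with possible equalities at both ends. This is why xy will be the maximal
    arc at the corner it cuts off. *)
Lemma triangle_arcs x y z k l t : cyc x y z -> cyc k l z -> cyc x l z -> cyc k y z ->
  ~~ crossed x z k l -> ~~ crossed y z k l -> arc_oc k l t -> arc_oc x y t.
Proof.
move=> xyz klz xlz kyz n1 n2; have [xy _ _] := cyc_neq xyz; have [kl _ _] := cyc_neq klz.
have zkx : ~~ cyc z k x by apply: contraNN n1 => h; rewrite /crossed xlz h orbT.
have ylz : ~~ cyc y l z.
  by apply: contraNN n2 => h; rewrite /crossed h 2!(cyc_rot z) kyz orbT.
rewrite !arc_ocP //.
have ly := cyc_widen_l xyz xlz ylz; have xk := cyc_widen_r klz xlz zkx.
case/orP=> [/eqP-> //|ktl].
have xtl : cyc x t l by case/orP: xk => [/eqP<- //|h]; exact: cyc_between h ktl.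
by case/orP: ly => [/eqP <-|h]; rewrite ?xtl ?orbT // (cyc_between_r h xtl) orbT.
Qed.

Lemma arc_oc_rev i j k : i != j -> arc_oc j i k = ~~ arc_oc i j k.
Proof. by rewrite /arc_oc; do 2 case: ifP; lia. Qed.

(** * Quiver mutation *)

Section MutationArith.
Local Open Scope ring_scope.

(* Mutation at the diagonal ab of a quadrilateral acbd, in the row of its side ac whose other
   triangle has apex x; a boolean such as bd tells whether the column is that of the side bd. *)
Lemma mut_side_ac (ax ac bd cb da xc : bool) : ~~ (ac && bd) -> ~~ (cb && da) ->
    ~~ (ac && cb) -> ~~ (ac && da) -> ~~ (bd && cb) -> ~~ (bd && da) ->
  let b := ac%:Z + bd%:Z - cb%:Z - da%:Z in
  (ax%:Z + cb%:Z - xc%:Z) + divz (`|(- 1 : int)| * b + (- 1) * `|b|) 2 = ax%:Z - xc%:Z - da%:Z.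
Proof. by case: ac; case: bd; case: cb; case: da => //= *; case: ax; case: xc. Qed.

Lemma mut_side_cb (cx ac bd cb da xb : bool) : ~~ (ac && bd) -> ~~ (cb && da) ->
    ~~ (ac && cb) -> ~~ (ac && da) -> ~~ (bd && cb) -> ~~ (bd && da) ->
  let b := ac%:Z + bd%:Z - cb%:Z - da%:Z in
  (cx%:Z - xb%:Z - ac%:Z) + divz (`|(1 : int)| * b + 1 * `|b|) 2 = cx%:Z + bd%:Z - xb%:Z.
Proof. by case: ac; case: bd; case: cb; case: da => //= *; case: cx; case: xb. Qed.

Lemma mut_none (b c : int) : b + divz (`|(0 : int)| * c + 0 * `|c|) 2 = b.
Proof. by rewrite normr0 !mul0r add0r div0z addr0. Qed.

(* The shear coordinate of a split with sides p, x, p', y at the diagonal pp' of pxp'y. *)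
Definition shear (p x p' y : bool) : int :=
  [&& p == x, p' == y & p != p']%:Z - [&& p == y, p' == x & p != p']%:Z.

(** The pattern forbidden by planarity: for p, x, p', y in cyclic order, no edge of the tree
    separates p and p' from x and y. *)
Definition alternate (p x p' y : bool) := [&& p == p', x == y & p != x].

Lemma shear_side_ac (a x c b d : bool) : ~~ alternate a c b d -> ~~ alternate a x c b ->
    ~~ alternate a x c d -> ~~ alternate a x b d -> ~~ alternate x c b d ->
  shear a x c b + divz (`|(- 1 : int)| * shear a c b d + (- 1) * `|shear a c b d|) 2 = shear a x c d.
Proof. by case: a; case: x; case: c; case: b; case: d. Qed.

Lemma shear_side_cb (a c x b d : bool) : ~~ alternate a c b d -> ~~ alternate a c x b ->
    ~~ alternate a c x d -> ~~ alternate a x b d -> ~~ alternate c x b d ->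
  shear c x b a + divz (`|(1 : int)| * shear a c b d + 1 * `|shear a c b d|) 2 = shear c x b d.
Proof. by case: a; case: x; case: c; case: b; case: d. Qed.

Lemma shear_swap p x p' y : shear p x p' y = shear p' y p x.
Proof. by case: p; case: x; case: p'; case: y. Qed.

Lemma shear_neg p x p' y : shear x p' y p = - shear p x p' y.
Proof. by case: p; case: x; case: p'; case: y. Qed.

Lemma shearC p x p' y : shear (~~ p) (~~ x) (~~ p') (~~ y) = shear p x p' y.
Proof. by case: p; case: x; case: p'; case: y. Qed.

End MutationArith.

Lemma disjoint_orZ (b1 b2 b3 b4 : bool) : ~~ (b1 && b2) -> ~~ (b3 && b4) ->
  ((b1 || b2)%:Z - (b3 || b4)%:Z = b1%:Z + b2%:Z - b3%:Z - b4%:Z)%R.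
Proof. by case: b1; case: b2; case: b3; case: b4. Qed.

Section QuiverMutation.
Local Open Scope ring_scope.
Variables (N Fr : finType).
Implicit Types (R : quiver (N + Fr)) (i j k : N).

(** The sum is 0 or twice a product up to sign. Hence the division in [mutate_matrix] is exact and
    commutes with a change of sign. *)
Lemma mutation_term_even (a b : int) : exists y, `|a| * b + a * `|b| = y * 2.
Proof.
case: (lerP 0 a) => ha; case: (lerP 0 b) => hb;
  rewrite ?(ger0_norm ha) ?(ger0_norm hb) ?(ltr0_norm ha) ?(ltr0_norm hb).
- by exists (a * b); rewrite mulr_natr mulr2n.
- by exists 0; rewrite mulrN subrr mul0r.
- by exists 0; rewrite mulNr addNr mul0r.
- by exists (- (a * b)); rewrite mulr_natr mulr2n mulNr mulrN.
Qed.

Lemma exchange_skew R i j : exchange_matrix R j (inl i) = - exchange_matrix R i (inl j).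
Proof. by rewrite /exchange_matrix opprB. Qed.

Lemma mutate_skew R k i j : mutate_matrix k (exchange_matrix R) j (inl i) =
  - mutate_matrix k (exchange_matrix R) i (inl j).
Proof.
rewrite /mutate_matrix !(inj_eq inl_inj) orbC; case: ifP => _; first by rewrite exchange_skew.
rewrite (exchange_skew R k j) (exchange_skew R i k) (exchange_skew R i j).
set a := exchange_matrix R i (inl k); set b := exchange_matrix R k (inl j).
have [y e] := mutation_term_even a b.
have -> : `|- b| * - a + - b * `|- a| = (- y) * 2 by rewrite !normrN; lia.
by rewrite e !mulzK // [RHS]opprD.
Qed.

Lemma ice_quiver_eq R R' : ice_quiver R -> ice_quiver R' ->
  (forall i v, exchange_matrix R i v = exchange_matrix R' i v) -> R = R'.
Proof.
move=> [_ h2 h3] [_ h2' h3'] e; apply: functional_extensionality => u; apply: functional_extensionality => v.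
case: u => [i|x].
  have := e i v; rewrite /exchange_matrix.
  by case: (h2 (inl i) v) => h; case: (h2' (inl i) v) => h'; rewrite h h'; lia.
case: v => [i|y]; last by rewrite h3 h3'.
have := e i (inr x); rewrite /exchange_matrix.
by case: (h2 (inl i) (inr x)) => h; case: (h2' (inl i) (inr x)) => h'; rewrite h h'; lia.
Qed.

Definition pos_part (z : int) : nat := if 0 <= z then `|z|%N else 0%N.

(** Since the mutated matrix is skew on the nonfrozen part, the positive parts of its entries are
    numbers of arrows of a quiver without loops or 2-cycles. *)
Lemma mutation_exists R k : exists R', mutation k R R'.
Proof.
pose M := mutate_matrix k (exchange_matrix R).
have skew i j : M j (inl i) = - M i (inl j) by exact: mutate_skew.
pose R' : quiver (N + Fr) := fun u v => match u, v with
  | inl i, _ => pos_part (M i v)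
  | inr x, inl i => pos_part (- M i (inr x))
  | inr _, inr _ => 0%N
  end.
have posB z : (pos_part z)%:Z - (pos_part (- z))%:Z = z by rewrite /pos_part; do 2 case: ifP; lia.
have pos0 z : pos_part z = 0%N \/ pos_part (- z) = 0%N by rewrite /pos_part; do 2 case: ifP; lia.
exists R'; split.
  split.
  - by case=> [i|x] //=; have := skew i i; rewrite /pos_part; case: ifP; lia.
  - case=> [i|x] [j|y] /=; auto; first by rewrite (skew i j); exact: pos0.
    by case: (pos0 (M j (inr x))); auto.
  - by [].
move=> i [j|x]; rewrite /exchange_matrix /= ?(skew i j); exact: posB.
Qed.

(** The second mutation sees the row and the column of k negated, so its correction term is the
    opposite of the first one. *)
Lemma mutation_inv R R' k : ice_quiver R -> mutation k R R' -> mutation k R' R.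
Proof.
move=> iR [_ mu]; split=> // i v.
have kk : exchange_matrix R k (inl k) = 0 by rewrite /exchange_matrix subrr.
have mk w : exchange_matrix R' k w = - exchange_matrix R k w.
  by rewrite mu /mutate_matrix eqxx.
have mk' j : exchange_matrix R' j (inl k) = - exchange_matrix R j (inl k).
  by rewrite mu /mutate_matrix eqxx orbT.
rewrite {1}/mutate_matrix; case: ifP => cond; first by rewrite mu /mutate_matrix cond opprK.
rewrite mk mk' mu /mutate_matrix cond.
set a := exchange_matrix R i (inl k); set b := exchange_matrix R k v.
have [y e] := mutation_term_even a b.
have -> : `|- a| * - b + - a * `|- b| = (- y) * 2 by rewrite !normrN; lia.
by rewrite e !mulzK // addrK.
Qed.

Lemma mutation_equiv_ice R0 R : ice_quiver R0 -> mutation_equiv R0 R -> ice_quiver R.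
Proof. by move=> i0; elim=> // k R1 R2 _ _ []. Qed.

End QuiverMutation.

(** * Paths in plane trees *)

Section Trees.
Variable T : planeTree.

Section Sides.
Implicit Types u v w x y z : T.

Lemma adj_neq u v : adj u v -> u != v.
Proof. by apply: contraTneq => ->; rewrite adj_irr. Qed.

Definition off_edge u v : rel T :=
  fun x y => adj x y && ~~ ((x == u) && (y == v) || (x == v) && (y == u)).

Lemma off_edge_sym u v : symmetric (off_edge u v).
Proof.
by move=> x y; rewrite /off_edge adj_sym; congr (_ && ~~ _); rewrite orbC andbC (andbC (x == u)).
Qed.

Lemma off_edgeC u v : off_edge u v =2 off_edge v u.
Proof. by move=> x y; rewrite /off_edge orbC. Qed.

(** The component of v after removal of the edge uv, locked so that rewriting with [inE] does not
    unfold it. *)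
Definition side u v : {set T} := locked [set x | connect (off_edge u v) v x].

Lemma in_side u v x : (x \in side u v) = connect (off_edge u v) v x.
Proof. by rewrite /side -lock inE. Qed.

Lemma side_head u v : v \in side u v.
Proof. by rewrite in_side connect0. Qed.

Lemma side_step u v x y :
  x \in side u v -> adj x y -> (x, y) != (v, u) -> y \in side u v \/ (x, y) = (u, v).
Proof.
rewrite !in_side => vx xy; rewrite xpair_eqE => nvu.
case: (boolP ((x == u) && (y == v))) => [/andP[/eqP-> /eqP->]|nuv]; first by right.
by left; apply: connect_trans vx (connect1 _); rewrite /off_edge xy negb_or nuv nvu.
Qed.

(** A simple path from v to u avoiding the edge uv would close up with this edge to a cycle of at
    least three vertices. *)
Lemma side_disj0 u v : adj u v -> u \notin side u v.
Proof.
move=> uv; rewrite in_side; apply/negP=> /connectP[p pth lastu].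
case/shortenP: pth lastu => p' pth' up' _ lastu.
have neq := adj_neq uv.
have := @adj_acyclic T (v :: p') up'.
have -> : path.cycle (@adj T) (v :: p').
  rewrite /= rcons_path -lastu uv andbT.
  by apply: sub_path pth' => a b /andP[].
move/(_ isT); case: p' pth' lastu {up'} => [|a [|b p']] //=.
  by move=> _ e; rewrite e eqxx in neq.
by rewrite andbT /off_edge => /andP[_ +] e; rewrite -e !eqxx orbT.
Qed.

Lemma side_cover u v x : adj u v -> (x \in side u v) || (x \in side v u).
Proof.
move=> uv; have /connectP[p pth ->] := adj_connected v x.
suff gen b : path.path (@adj T) b p -> (b \in side u v) || (b \in side v u) ->
    (last b p \in side u v) || (last b p \in side v u).
  by apply: gen => //; rewrite side_head.
elim: p b {pth} => //= a p IH b /andP[ba pth] h; apply: IH => //.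
case: (boolP (off_edge u v b a)) => [oba|].
  apply/orP; case/orP: h => h; [left|right]; move: h; rewrite !in_side => h.
    exact: connect_trans h (connect1 oba).
  by apply: connect_trans h (connect1 _); rewrite off_edgeC.
rewrite /off_edge ba /= negbK => /orP[] /andP[_ /eqP->]; rewrite side_head ?orbT //.
Qed.

Lemma off_edge_connect_sym u v : connect_sym (off_edge u v).
Proof. by apply: sym_connect_sym; exact: off_edge_sym. Qed.

Lemma sideC u v x : adj u v -> (x \in side v u) = (x \notin side u v).
Proof.
move=> uv; have := side_cover x uv; case: (boolP (x \in side u v)) => //= xs _.
apply: negbTE.
apply/negP => xs'; have /negP := side_disj0 uv; apply; move: xs xs'; rewrite !in_side.
move=> h1; rewrite (eq_connect (off_edgeC v u)) (off_edge_connect_sym _ _ u) => h2.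
exact: connect_trans h1 h2.
Qed.

Lemma side_next u v x y :
  adj u v -> x \in side u v -> adj x y -> y \notin side u v -> x = v /\ y = u.
Proof.
move=> uv xs xy ys; case: (eqVneq (x, y) (v, u)) => [[-> ->] //|ne].
case: (side_step xs xy ne) => [yy|[exu _]]; first by rewrite yy in ys.
by rewrite exu (negbTE (side_disj0 uv)) in xs.
Qed.

Lemma side_ind u v (P : T -> Prop) :
  P v ->
  (forall x y, x \in side u v -> y \in side u v -> adj x y -> P x -> P y) ->
  forall x, x \in side u v -> P x.
Proof.
move=> Pv step x; rewrite in_side => /connectP[p pth ->].
have : v \in side u v by exact: side_head.
suff gen b : path.path (off_edge u v) b p -> P b -> b \in side u v -> P (last b p).
  exact: gen.
elim: p b {pth} => //= a p IH b /andP[ba pth] Pb bs.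
have as_ : a \in side u v.
  by move: bs; rewrite !in_side => bs; exact: connect_trans bs (connect1 ba).
by apply: IH => //; apply: step bs as_ _ Pb; case/andP: ba.
Qed.

Lemma side_child u v w : adj u v -> adj v w -> w != u -> side v w \proper side u v.
Proof.
move=> uv vw wu; apply/properP; split; last first.
  by exists v; rewrite ?side_head ?side_disj0.
apply/subsetP; apply: side_ind.
  case: (boolP (w \in side u v)) => // ws.
  by have [_ e] := side_next uv (side_head u v) vw ws; rewrite e eqxx in wu.
move=> x y xs ys xy xuv; case: (boolP (y \in side u v)) => // yn.
have [e _] := side_next uv xuv xy yn.
by rewrite e (negbTE (side_disj0 vw)) in xs.
Qed.

Lemma side_uniq v w w' x :
  adj v w -> adj v w' -> x \in side v w -> x \in side v w' -> w = w'.
Proof.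
move=> vw vw' xw xw'; apply/eqP/negPn/negP => ne.
have w'v : adj w' v by rewrite adj_sym.
have /proper_sub/subsetP/(_ _ xw) := side_child w'v vw ne.
by rewrite sideC // xw'.
Qed.

Lemma side_nbr v x : x != v -> exists2 w, adj v w & x \in side v w.
Proof.
move=> xv; have /connectP[p pth e] := adj_connected v x.
suff : x = v \/ exists2 w, adj v w & x \in side v w.
  by case=> // e'; rewrite e' eqxx in xv.
rewrite e {e xv}.
suff gen b : path.path (@adj T) b p -> b = v \/ (exists2 w, adj v w & b \in side v w) ->
    last b p = v \/ exists2 w, adj v w & last b p \in side v w.
  by apply: gen => //; left.
elim: p b {pth} => //= a p IH b /andP[ba pth] h; apply: IH => //.
case: h => [e|[w vw bw]]; first by right; exists a; rewrite ?side_head -?e.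
case: (boolP (a \in side v w)) => aw; first by right; exists w.
by left; have [] := side_next vw bw ba aw.
Qed.

(** The component of u is connected and does not contain the edge xy, so it stays on one side of
    xy. *)
Lemma side_compat u v x y : adj u v -> adj x y -> x \in side u v -> y \in side u v ->
  (side v u \subset side x y) \/ (side v u \subset side y x).
Proof.
move=> uv xy xs ys.
have vu : adj v u by rewrite adj_sym.
have yx : adj y x by rewrite adj_sym.
have gen a b : adj a b -> a \in side u v -> b \in side u v -> u \in side a b ->
    side v u \subset side a b.
  move=> ab sa sb ua; apply/subsetP; apply: side_ind => // c d cs ds cd ca.
  case: (boolP (d \in side a b)) => // da; have [e _] := side_next ab ca cd da.
  by move: cs; rewrite sideC // e sb.
have /orP[h|h] := side_cover u xy; [left|right]; exact: gen.
Qed.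

End Sides.

Section Splits.
Implicit Types u v w x y z : T.

(** Of the four intersections of a side of uv with a side of xy one is empty: by [side_compat] if xy
    lies on one side of uv, and because the two edges coincide otherwise. *)
Lemma splits_compatible u v x y : adj u v -> adj x y ->
  (forall b1 b2, exists z, (z \in side u v) = b1 /\ (z \in side x y) = b2) -> False.
Proof.
move=> uv xy ex; have vu : adj v u by rewrite adj_sym.
have yx : adj y x by rewrite adj_sym.
have key u' v' : adj u' v' -> x \in side u' v' -> y \in side u' v' ->
    (forall b1 b2, exists z, (z \in side u' v') = b1 /\ (z \in side x y) = b2) -> False.
  move=> uv' xs ys ex'; case: (side_compat uv' xy xs ys) => /subsetP sub.
    have [z [z1 z2]] := ex' false false.
    by have := sub z; rewrite (sideC _ uv') z1 z2 => /(_ isT).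
  have [z [z1 z2]] := ex' false true.
  by have := sub z; rewrite (sideC _ uv') (sideC _ xy) z1 z2 => /(_ isT).
case: (boolP (x \in side u v)) => xs; case: (boolP (y \in side u v)) => ys.
- exact: key ex.
- have [e1 e2] := side_next uv xs xy ys; subst.
  have [z [z1]] := ex true true; by rewrite sideC // z1.
- have [e1 e2] := side_next uv ys yx xs; subst.
  by have [z [z1]] := ex true false; rewrite z1.
apply: (key v u); rewrite ?(sideC _ uv) // => b1 b2.
by have [z [z1 z2]] := ex (~~ b1) b2; exists z; rewrite sideC // z1 negbK.
Qed.

Lemma side_in_nbr u x y : adj x y -> u \notin side x y -> exists2 w, adj u w & side x y \subset side u w.
Proof.
move=> xy us; have yu : y != u by apply: contraNneq us => <-; exact: side_head.
have [w uw yw] := side_nbr yu; exists w => //.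
apply/subsetP; apply: side_ind => // a b as_ bs ab aw.
case: (boolP (b \in side u w)) => // bw.
by have [_ e] := side_next uw aw ab bw; rewrite -e bs in us.
Qed.

(** A side of xy not containing u lies in a single branch at u, hence cannot contain both a and c;
    the same holds at v for b and d. So u and v are on opposite sides of xy, and the two edges
    agree. *)
Lemma separating_edge_unique u v w1 w2 z1 z2 x y a b c d :
  adj u v -> adj u w1 -> adj u w2 -> adj v z1 -> adj v z2 -> adj x y ->
  w1 != w2 -> w1 != v -> z1 != z2 ->
  a \in side u w1 -> c \in side u w2 -> b \in side v z1 -> d \in side v z2 ->
  a \in side y x -> c \in side y x -> b \in side x y -> d \in side x y ->
  u = x /\ v = y.
Proof.
move=> uv u1 u2 v1 v2 xy n12 n1v nz aw cw bz dz ay cy bx dx.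
have yx : adj y x by rewrite adj_sym.
case: (boolP (u \in side x y)) => us; case: (boolP (v \in side x y)) => vs.
- have us' : u \notin side y x by rewrite sideC // us.
  have [w uw /subsetP sub] := side_in_nbr yx us'.
  move: n12; rewrite -(side_uniq uw u1 (sub _ ay) aw).
  by rewrite (side_uniq uw u2 (sub _ cy) cw) eqxx.
- have [e1 e2] := side_next xy us uv vs; subst.
  by move: n1v; rewrite (side_uniq u1 uv aw ay) eqxx.
- have us' : u \in side y x by rewrite sideC.
  have vs' : v \notin side y x by rewrite sideC // vs.
  by have [-> ->] := side_next yx us' uv vs'.
have [w vw /subsetP sub] := side_in_nbr xy vs.
move: nz; rewrite -(side_uniq vw v1 (sub _ bx) bz).
by rewrite (side_uniq vw v2 (sub _ dx) dz) eqxx.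
Qed.

End Splits.

(** * The vertices of the path between two vertices *)

Section Paths.
Implicit Types (u v w x y z a b : T) (s p : seq T).

(* The vertices of the path from a to b. *)
Definition pth a b : {set T} :=
  [set v | ~~ [exists w, [&& adj v w, a \in side v w & b \in side v w]]].

Lemma pthP a b v :
  reflect (exists w, [/\ adj v w, a \in side v w & b \in side v w]) (v \notin pth a b).
Proof.
rewrite inE negbK; apply: (iffP existsP) => [[w /and3P[]]|[w [h1 h2 h3]]]; exists w => //.
by rewrite h1 h2.
Qed.

Lemma pthC a b : pth a b = pth b a.
Proof.
by apply/setP=> v; rewrite !inE; congr (~~ _); apply: eq_existsb => w; rewrite (andbC (a \in _)).
Qed.

Lemma pth_l a b : a \in pth a b.
Proof. by apply/negPn/pthP => -[w [aw]]; rewrite (negbTE (side_disj0 aw)). Qed.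

Lemma pth_r a b : b \in pth a b.
Proof. by rewrite pthC pth_l. Qed.

Lemma path_side v w x p : adj v w -> x \in side v w -> path.path (@adj T) x p ->
  v \notin x :: p -> last x p \in side v w.
Proof.
move=> vw; elim: p x => //= y p IH x xs /andP[xy pth]; rewrite !inE !negb_or => /and3P[vx vy vp].
apply: IH => //; last by rewrite inE negb_or vy.
case: (boolP (y \in side v w)) => // yn.
by have [_ e] := side_next vw xs xy yn; rewrite e eqxx in vy.
Qed.

Lemma path_turn a p s1 s2 u v w : path.path (@adj T) a p -> uniq (a :: p) ->
  a :: p = s1 ++ [:: u, v, w & s2] ->
  [/\ adj v u, adj v w, u != w, a \in side v u & last a p \in side v w].
Proof.
move=> pap up e.
have so : sorted (@adj T) (s1 ++ [:: u, v, w & s2]) by rewrite -e.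
have lastE : last a p = last w s2 by rewrite -[last a p]/(last a (a :: p)) e last_cat.
have un : uniq (s1 ++ [:: u, v, w & s2]) by rewrite -e.
have [so1 /= /and3P[uv vw pw]] := cat_sorted2 so.
have vu : adj v u by rewrite adj_sym.
move: un; rewrite cat_uniq => /and3P[us1 hs /= /and3P[uw vs _]].
have [uv' uw'] : u != v /\ u != w by move: uw; rewrite !inE !negb_or => /and3P[-> ->].
have [vw' vs2] : v != w /\ v \notin s2 by move: vs; rewrite !inE !negb_or => /andP[].
have vs1 : v \notin s1.
  by apply: contraNN hs => h; apply/hasP; exists v; rewrite //= !inE eqxx orbT.
have lw : last w s2 \in side v w.
  by apply: (path_side vw) => //; rewrite ?side_head // inE negb_or vw' vs2.
rewrite lastE; split=> //.
case: s1 e so us1 hs vs1 {so1} => [|b s1] /= [-> e]; first by rewrite side_head.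
rewrite cat_path /= => /and3P[ps1 lu _] _ _; rewrite inE negb_or => /andP[vb vs1].
have bv : b != v by rewrite eq_sym.
have [z vz bz] := side_nbr bv.
have uz : u \in side v z.
  have := @path_side v z b (rcons s1 u) vz bz; rewrite last_rcons; apply.
    by rewrite rcons_path ps1.
  by rewrite inE mem_rcons inE !negb_or vb vs1 (eq_sym v u) uv'.
by rewrite (side_uniq vu vz (side_head _ _) uz).
Qed.

Lemma split_inner a p v : v \in a :: p -> v != a -> v != last a p ->
  exists s1 s2 u w, a :: p = s1 ++ [:: u, v, w & s2].
Proof.
move=> + va vb; case/splitPr e: {-}_ / => [s1 s2].
case/lastP: s1 e => [|s1 u] e; first by case: e va => ->; rewrite eqxx.
case: s2 e => [|w s2] e; last by exists s1, s2, u, w; rewrite e cat_rcons.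
by move: vb; rewrite -[last a p]/(last a (a :: p)) e last_cat /= eqxx.
Qed.

(** At an inner vertex of a simple path the two ends lie in different branches, while a path missing
    v stays in one branch at v. *)
Lemma mem_path_pth a p v : path.path (@adj T) a p -> uniq (a :: p) ->
  (v \in a :: p) = (v \in pth a (last a p)).
Proof.
move=> pap up; apply/idP/idP => [vs|]; last first.
  apply: contraTT => vs; apply/pthP.
  have av : a != v by apply: contraNneq vs => ->; rewrite mem_head.
  have [w vw aw] := side_nbr av; exists w; split=> //; exact: path_side.
apply: contraTT isT => /pthP[w [vw aw bw]].
have va : v != a by apply: contraTneq aw => <-; exact: side_disj0.
have vb : v != last a p by apply: contraTneq bw => <-; exact: side_disj0.
have [s1 [s2 [u [w' e]]]] := split_inner vs va vb.
have [vu vw' uw' au bw'] := path_turn pap up e.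
by move: uw'; rewrite (side_uniq vu vw au aw) (side_uniq vw' vw bw' bw) eqxx.
Qed.

(** In a tree every simple path is induced: an additional adjacency would close a cycle of at least
    three vertices. *)
Lemma acyclic_pathP s : acyclic_path s <-> uniq s /\ sorted (@adj T) s.
Proof.
case: s => [|x0 s']; first by split=> // _; split=> // -[].
set s := x0 :: s'; split=> -[us h]; split=> //.
  apply/(sortedP x0) => i lt; have lt' := ltnW lt.
  have := h (Ordinal lt') (Ordinal lt); rewrite !(tnth_nth x0) /= => ->.
  by rewrite eqxx orbT.
have main i j : i < j < size s -> adj (nth x0 s i) (nth x0 s j) = (j == i.+1).
  case/andP=> ij js; apply/idP/eqP => [aij|e]; last by rewrite e; move/(sortedP x0): h; apply; rewrite -e.
  apply/eqP; apply: contraT => ne.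
  pose c := take (j - i).+1 (drop i s).
  have sz : size c = (j - i).+1 by rewrite size_takel // size_drop; lia.
  have uc : uniq c by rewrite take_uniq // drop_uniq.
  have pc : sorted (@adj T) c by rewrite take_sorted // drop_sorted.
  have := adj_acyclic uc; rewrite sz.
  have c0 : nth x0 c 0 = nth x0 s i by rewrite nth_take // nth_drop addn0.
  have cl : last x0 c = nth x0 s j.
    by rewrite -nth_last sz /= nth_take // nth_drop subnKC // ltnW.
  have -> : path.cycle (@adj T) c.
    case: (c) sz pc c0 cl => // y c' _ /= pc c0 cl; rewrite rcons_path pc /=.
    by rewrite cl c0 adj_sym.
  by move/(_ isT); lia.
move=> i j; rewrite !(tnth_nth x0); case: (ltngtP i j) => ij.
- rewrite main ?ij ?ltn_ord //; case: eqP => e; case: eqP => e'; lia.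
- rewrite adj_sym main ?ij ?ltn_ord //; case: eqP => e; case: eqP => e'; lia.
- rewrite -ij adj_irr; lia.
Qed.

End Paths.

(** * Trivalent plane trees *)

Hypothesis deg3 : forall v : T, ~~ leaf v -> degree v = 3.

Section Trivalent.
Implicit Types u v w x y z : T.

Lemma leaf_nbr v w w' : leaf v -> adj v w -> adj v w' -> w = w'.
Proof.
move=> /cards1P[x e] vw vw'.
have h y : adj v y -> y = x by move=> vy; apply/set1P; rewrite -e inE.
by rewrite (h _ vw) (h _ vw').
Qed.

(** The neighbours form one orbit of [ccw v], of size three. If the third iterate were not w again,
    the iteration would be caught in a part of the orbit from which w is never reached. *)
Lemma ccw3 v w : ~~ leaf v -> adj v w ->
  [/\ uniq [:: w; ccw v w; ccw v (ccw v w)], ccw v (ccw v (ccw v w)) = w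
    & forall z, adj v z = (z \in [:: w; ccw v w; ccw v (ccw v w)])].
Proof.
move=> iv vw; have card3 : #|[set z | adj v z]| = 3 by exact: deg3.
have fc z : adj v z = fconnect (ccw v) w z.
  apply/idP/idP => [vz|/iter_findex <-]; first exact: ccw_cyclic.
  by elim: (findex _ _ _) => //= k; exact: ccw_adj.
have ord3 : fingraph.order (ccw v) w = 3.
  by rewrite -card3; apply: eq_card => z; rewrite !inE fc.
have orbE : fingraph.orbit (ccw v) w = [:: w; ccw v w; ccw v (ccw v w)].
  by rewrite /fingraph.orbit ord3.
have un := orbit_uniq (ccw v) w; rewrite orbE in un.
have mem z : adj v z = (z \in [:: w; ccw v w; ccw v (ccw v w)]).
  by rewrite fc fconnect_orbit orbE.
split=> //; set x := ccw v w in un mem *; set y := ccw v x in un mem *.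
have vx : adj v x by exact: ccw_adj.
have vy : adj v y by exact: ccw_adj.
have : adj v (ccw v y) by exact: ccw_adj.
rewrite mem !inE => /or3P[] /eqP // e.
  have : fconnect (ccw v) x w by exact: ccw_cyclic.
  move/iter_findex; set k := findex _ _ _.
  suff : iter k (ccw v) x \in [:: x; y].
    move=> + e2; rewrite e2; case/andP: un => /=.
    by rewrite !inE => /negbTE->.
  elim: k => [|k]; rewrite ?inE ?eqxx //= => /orP[] /eqP->.
    by rewrite eqxx orbT.
  by rewrite e eqxx.
have : fconnect (ccw v) y w by exact: ccw_cyclic.
move/iter_findex; set k := findex _ _ _.
have -> : iter k (ccw v) y = y by elim: k => //= k ->.
by move=> e2; move: un; rewrite e2 /= !inE eqxx orbT.
Qed.

Lemma ccw_third v w : ~~ leaf v -> adj v w -> ccw v (ccw v (ccw v w)) = w.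
Proof. by move=> iv vw; have [] := ccw3 iv vw. Qed.

Lemma ccw_neq v w : ~~ leaf v -> adj v w -> ccw v w != w.
Proof.
by move=> iv vw; have [/= + _ _] := ccw3 iv vw; rewrite !inE negb_or eq_sym => /andP[/andP[]].
Qed.

Lemma ccw2_neq v w : ~~ leaf v -> adj v w -> ccw v (ccw v w) != w.
Proof.
by move=> iv vw; have [/= + _ _] := ccw3 iv vw; rewrite !inE negb_or eq_sym => /andP[/andP[_ +]]; rewrite eq_sym.
Qed.

Lemma nbrE v w z : ~~ leaf v -> adj v w -> adj v z ->
  [\/ z = w, z = ccw v w | z = ccw v (ccw v w)].
Proof.
move=> iv vw; have [_ _ ->] := ccw3 iv vw; rewrite !inE.
by case/or3P=> /eqP; [constructor 1|constructor 2|constructor 3].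
Qed.

Lemma side_leaf u v : adj u v -> leaf v -> side u v = [set v].
Proof.
move=> uv lv; apply/setP=> x; rewrite in_set1; apply/idP/eqP => [xs|->]; last exact: side_head.
apply/eqP; apply: contraT => xv; have [w vw xw] := side_nbr xv.
have vu : adj v u by rewrite adj_sym.
by rewrite (leaf_nbr lv vw vu) sideC // xs in xw.
Qed.

Lemma side_split u v : adj u v -> ~~ leaf v ->
  side u v = v |: (side v (ccw v u) :|: side v (ccw v (ccw v u))).
Proof.
move=> uv iv; have vu : adj v u by rewrite adj_sym.
apply/setP=> x; rewrite in_setU1 in_setU; case: (eqVneq x v) => [->|xv] /=; first exact: side_head.
have [w vw xw] := side_nbr xv.
apply/idP/orP => [xs|].
  case: (nbrE iv vu vw) xw => -> xw; [|by left|by right].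
  by rewrite sideC // xs in xw.
have v1 := ccw_adj vu; have v2 := ccw_adj v1.
have /proper_sub/subsetP s1 := side_child uv v1 (ccw_neq iv vu).
have /proper_sub/subsetP s2 := side_child uv v2 (ccw2_neq iv vu).
by case; [exact: s1|exact: s2].
Qed.

(** The argument [n] is fuel; the number of vertices suffices because [side] shrinks strictly at
    every step. *)
Fixpoint leaves_rec n u v : seq T :=
  if n is n'.+1 then
    if leaf v then [:: v] else leaves_rec n' v (ccw v u) ++ leaves_rec n' v (ccw v (ccw v u))
  else [::].

(* The leaves beyond v seen from u, counterclockwise. *)
Definition leaves_of u v := leaves_rec #|T| u v.

Lemma leaves_recE n u v : adj u v -> #|side u v| <= n -> leaves_rec n u v = leaves_of u v.
Proof.
rewrite /leaves_of; have : #|side u v| <= #|T| by exact: max_card.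
elim: n #|T| u v => [|n IH] [|m] u v //=.
- by move=> _ uv; rewrite leqn0 cards_eq0 => /eqP e; move: (side_head u v); rewrite e inE.
- by rewrite leqn0 cards_eq0 => /eqP e; move: (side_head u v); rewrite e inE.
move=> hm uv hn; case: (boolP (leaf v)) => // iv.
have vu : adj v u by rewrite adj_sym.
have v1 := ccw_adj vu; have v2 := ccw_adj v1.
have /proper_card s1 := side_child uv v1 (ccw_neq iv vu).
have /proper_card s2 := side_child uv v2 (ccw2_neq iv vu).
by congr (_ ++ _); apply: IH => //; rewrite -ltnS; [exact: leq_trans s1 hm|exact: leq_trans s1 hn|exact: leq_trans s2 hm|exact: leq_trans s2 hn].
Qed.

Lemma leaves_ofE u v : adj u v -> leaves_of u v =
  if leaf v then [:: v] else leaves_of v (ccw v u) ++ leaves_of v (ccw v (ccw v u)).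
Proof.
move=> uv; rewrite -(@leaves_recE #|T|.+1) //=; last exact: leqW (max_card _).
Qed.

Lemma side_rect (P : T -> T -> Prop) :
  (forall u v, adj u v -> leaf v -> P u v) ->
  (forall u v, adj u v -> ~~ leaf v -> P v (ccw v u) -> P v (ccw v (ccw v u)) -> P u v) ->
  forall u v, adj u v -> P u v.
Proof.
move=> Pl Pi u v; have [n] := ubnP #|side u v|; elim: n u v => // n IH u v; rewrite ltnS => le uv.
case: (boolP (leaf v)) => iv; first exact: Pl.
have vu : adj v u by rewrite adj_sym.
have v1 := ccw_adj vu; have v2 := ccw_adj v1.
have /proper_card s1 := side_child uv v1 (ccw_neq iv vu).
have /proper_card s2 := side_child uv v2 (ccw2_neq iv vu).
by apply: Pi => //; apply: IH => //; [exact: leq_trans s1 le|exact: leq_trans s2 le].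
Qed.

Lemma mem_leaves_of u v x : adj u v -> (x \in leaves_of u v) = leaf x && (x \in side u v).
Proof.
move: u v; apply: side_rect => [u v uv lv|u v uv iv IH1 IH2].
  rewrite leaves_ofE // lv side_leaf // !inE; case: eqP => [->|]; rewrite ?lv ?andbF //.
rewrite leaves_ofE // (negbTE iv) mem_cat IH1 IH2 (side_split uv iv) in_setU1 in_setU.
case: (eqVneq x v) => [->|] /=; last by rewrite andb_orr.
by rewrite (negbTE iv).
Qed.

Lemma leaves_of_uniq u v : adj u v -> uniq (leaves_of u v).
Proof.
move: u v; apply: side_rect => [u v uv lv|u v uv iv IH1 IH2].
  by rewrite leaves_ofE // lv.
have vu : adj v u by rewrite adj_sym.
have v1 := ccw_adj vu; have v2 := ccw_adj v1.
rewrite leaves_ofE // (negbTE iv) cat_uniq IH1 IH2 andbT /=.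
apply/hasPn => x; rewrite /= !mem_leaves_of // => /andP[_ x2]; apply/nandP; right.
apply/negP => x1; have /eqP := side_uniq v1 v2 x1 x2.
by apply/negP; rewrite eq_sym; exact: ccw_neq.
Qed.

Lemma leaves_of_neq0 u v : adj u v -> 0 < size (leaves_of u v).
Proof.
move: u v; apply: side_rect => [u v uv lv|u v uv iv IH1 IH2].
  by rewrite leaves_ofE // lv.
by rewrite leaves_ofE // (negbTE iv) size_cat ltn_addr.
Qed.

(** The end of the walk through the dart (u, v) that turns right at every vertex. The face to its
    right never changes, which makes this leaf a name for the face. The default value [u] is never
    taken for adjacent vertices. *)
Definition first_leaf u v := head u (leaves_of u v).

Lemma first_leafE u v : adj u v ->
  first_leaf u v = if leaf v then v else first_leaf v (ccw v u).
Proof.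
move=> uv; rewrite {1}/first_leaf leaves_ofE //; case: ifP => // iv.
have vu : adj v u by rewrite adj_sym.
have v1 := ccw_adj vu.
by rewrite /first_leaf; have := leaves_of_neq0 v1; case: leaves_of.
Qed.

Lemma ex_leaf : exists r : T, leaf r.
Proof.
have [v _] := card_gt0P (vert_gt0 T); case: (boolP (leaf v)) => [lv|iv]; first by exists v.
have /card_gt0P[w] : 0 < #|[set w | adj v w]| by rewrite -/(degree v) deg3.
rewrite inE => vw; have := leaves_of_neq0 vw.
case e: leaves_of => [//|x s] _; exists x.
have : x \in leaves_of v w by rewrite e mem_head.
by rewrite mem_leaves_of // => /andP[].
Qed.

End Trivalent.

Section TrivalentPaths.
Implicit Types (u v w x y z a b : T) (s p : seq T).

Lemma two_nbrs v u w : adj v u -> adj v w -> u != w -> ~~ leaf v.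
Proof. by move=> vu vw; apply: contraNN => lv; rewrite (leaf_nbr lv vu vw). Qed.

Lemma turn_cases v u w : adj v u -> adj v w -> u != w -> w = ccw v u \/ u = ccw v w.
Proof.
move=> vu vw uw; have iv := two_nbrs vu vw uw.
case: (nbrE iv vu vw) => e; first by rewrite e eqxx in uw.
  by left.
by right; rewrite e ccw_third.
Qed.

Lemma lface_faces u v : adj u v -> lface u v \in faces T.
Proof. by move=> uv; apply/imsetP; exists (u, v); rewrite ?inE. Qed.

Lemma mem_lface_turn v u : adj v u -> ~~ leaf v -> (ccw v u, v) \in lface v u.
Proof.
move=> vu iv; rewrite inE; apply: connect1; apply/orP; right.
by rewrite /face_step /= vu iv !eqxx.
Qed.

Lemma mem_lface_self u v : (u, v) \in lface u v.
Proof. by rewrite inE. Qed.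

(** Any two of the three edges at an interior vertex are neighbours in the cyclic order, hence bound
    a common face. *)
Lemma path_turns_on_faces a p : path.path (@adj T) a p -> uniq (a :: p) ->
  turns_on_faces (a :: p).
Proof.
move=> pap up s1 s2 u v w e; have [vu vw uw _ _] := path_turn pap up e.
have iv := two_nbrs vu vw uw; rewrite /edge_on_face.
case: (turn_cases vu vw uw) => e'.
  exists (lface v u); first exact: lface_faces.
  by rewrite mem_lface_self orbT e' mem_lface_turn ?orbT.
exists (lface v w); first exact: lface_faces.
by rewrite mem_lface_self e' mem_lface_turn.
Qed.

Lemma arc_path a b : leaf a -> leaf b -> a != b ->
  exists p, [/\ path.path (@adj T) a p, uniq (a :: p), last a p = b &
    traces_arc (a :: p) (pth a b)].
Proof.
move=> la lb ab; have /connectP[p0 pth0 e0] := adj_connected a b.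
case/shortenP: pth0 e0 => p pap up _ e; exists p; split=> //; split; last first.
  by apply/setP=> x; rewrite e -mem_path_pth // in_set.
split; first exact/acyclic_pathP.
  exact: path_turns_on_faces.
by exists a, p; rewrite -e.
Qed.

Lemma traces_arcP s (P : {set T}) : traces_arc s P -> exists a q,
  [/\ s = a :: q, path.path (@adj T) a q, uniq (a :: q) &
   [/\ leaf a, leaf (last a q), a != last a q & P = pth a (last a q)]].
Proof.
case=> -[/acyclic_pathP[us so] _ [a [q [es la lb ab]]]] ->; exists a, q.
rewrite es in us so *; split=> //; split=> //; apply/setP=> x.
by rewrite in_set mem_path_pth.
Qed.

Lemma is_arcP (P : {set T}) :
  is_arc P <-> exists a b, [/\ leaf a, leaf b, a != b & P = pth a b].
Proof.
split=> [[s /traces_arcP[a [q [_ _ _ [la lb ab ->]]]]]|[a [b [la lb ab ->]]]].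
  by exists a, (last a q).
by have [q [_ _ _ tr]] := arc_path la lb ab; exists (a :: q).
Qed.

Lemma leaf_in_pth a b x : leaf x -> (x \in pth a b) = (x == a) || (x == b).
Proof.
move=> lx; apply/idP/idP => [|/orP[] /eqP->]; [|exact: pth_l|exact: pth_r].
apply: contraTT; rewrite negb_or => /andP[xa xb]; apply/pthP.
have ax : a != x by rewrite eq_sym.
have bx : b != x by rewrite eq_sym.
have [w xw aw] := side_nbr ax; have [w' xw' bw] := side_nbr bx.
by exists w; split; rewrite // (leaf_nbr lx xw xw').
Qed.

Lemma pth_inj a b c d : leaf a -> leaf b -> leaf c -> leaf d -> a != b ->
  pth a b = pth c d -> (a = c /\ b = d) \/ (a = d /\ b = c).
Proof.
move=> la lb lc ld ab e.
have := leaf_in_pth a b la; have := leaf_in_pth a b lb.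
rewrite !eqxx orbT e !leaf_in_pth // => /orP[] /eqP eb /orP[] /eqP ea; subst; auto.
  by rewrite eqxx in ab.
by rewrite eqxx in ab.
Qed.

Lemma edge_in_pth u v a b : adj u v ->
  (u \in pth a b) && (v \in pth a b) = ((a \in side u v) != (b \in side u v)).
Proof.
move=> uv; have vu : adj v u by rewrite adj_sym.
apply/andP/idP => [[up vp]|ne].
  apply: contraTT isT => /negPn/eqP e; case: (boolP (a \in side u v)) => sa.
    by suff : u \notin pth a b by [rewrite up]; apply/pthP; exists v; rewrite -e.
  by suff : v \notin pth a b by [rewrite vp]; apply/pthP; exists u; rewrite !(sideC _ uv) -e.
wlog sa : a b {ne} / (a \in side u v) && (b \notin side u v).
  move=> W; case: (boolP (a \in side u v)) ne => sa; case: (boolP (b \in side u v)) => sb // _.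
    by apply: W; rewrite sa sb.
  by rewrite pthC; apply: W; rewrite sa sb.
case/andP: sa => sa sb; split; apply/negPn/pthP => -[w [xw aw bw]].
  by move: sb; rewrite (side_uniq uv xw sa aw) bw.
have sb' : b \in side v u by rewrite sideC.
by move: sa; rewrite -[_ \in _]negbK -sideC // (side_uniq vu xw sb' bw) aw.
Qed.

End TrivalentPaths.

(* The leaves are numbered counterclockwise from the leaf r, whose neighbour is q. *)
Variables (r q : T).
Hypotheses (lr : leaf r) (rq : adj r q).

(** * Positions of leaves and sides of edges as cyclic intervals *)

Section LeafOrder.
Implicit Types u v w x y z : T.

Definition ord : seq T := r :: leaves_of r q.
Definition nleaves := size ord.
Definition pos x := index x ord.
Definition lf i := nth r ord i.
(** Both the start of the interval of leaves beyond v and the label of the face to the right of the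
    dart (u, v). *)
Definition fs u v := pos (first_leaf u v).

Lemma leaf_mem x : (x \in ord) = leaf x.
Proof.
rewrite inE mem_leaves_of //; case: (eqVneq x r) => [->|xr] //=.
have qr : adj q r by rewrite adj_sym.
by rewrite -[_ \in _]negbK -(sideC x rq) (side_leaf qr lr) in_set1 xr andbT.
Qed.

Lemma ord_uniq : uniq ord.
Proof. by rewrite /= leaves_of_uniq // mem_leaves_of // (negbTE (side_disj0 rq)) andbF. Qed.

Lemma ltn_pos x : leaf x -> pos x < nleaves.
Proof. by rewrite index_mem leaf_mem. Qed.

Lemma lfK i : i < nleaves -> pos (lf i) = i.
Proof. by move=> lt; rewrite /pos /lf index_uniq // ord_uniq. Qed.

Lemma posK x : leaf x -> lf (pos x) = x.
Proof. by move=> lx; rewrite /lf nth_index // leaf_mem. Qed.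

Lemma lf_leaf i : i < nleaves -> leaf (lf i).
Proof. by move=> lt; rewrite -leaf_mem mem_nth. Qed.

Lemma first_leaf_leaf u v : adj u v -> leaf (first_leaf u v) && (first_leaf u v \in side u v).
Proof.
move=> uv; rewrite -mem_leaves_of // /first_leaf.
by have := leaves_of_neq0 uv; case: leaves_of => //= x s; rewrite mem_head.
Qed.

Lemma fs_lt u v : adj u v -> fs u v < nleaves.
Proof. by move=> uv; have /andP[l _] := first_leaf_leaf uv; exact: ltn_pos. Qed.

Lemma fs_leaf u v : adj u v -> leaf v -> fs u v = pos v.
Proof. by move=> uv lv; rewrite /fs first_leafE // lv. Qed.

Lemma fs_int u v : adj u v -> ~~ leaf v -> fs u v = fs v (ccw v u).
Proof. by move=> uv iv; rewrite /fs first_leafE // (negbTE iv). Qed.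

Lemma fs_neq u v : adj u v -> fs u v <> fs v u.
Proof.
move=> uv e; have vu : adj v u by rewrite adj_sym.
have /andP[l1 s1] := first_leaf_leaf uv; have /andP[l2 s2] := first_leaf_leaf vu.
move: s2; rewrite -(posK l2) -/(fs v u) -e posK // sideC // s1 //.
Qed.

(** Induction on the side containing [r]: the leaves beyond a dart pointing away from [r] are one of
    the two halves of the list for the preceding dart. The opposite dart starts with the leaf just
    after this infix; the modulus takes it back to [r] when the infix ends the list. *)
Lemma away_infix u v : adj u v -> r \in side v u ->
  exists s1 s2, ord = s1 ++ leaves_of u v ++ s2 /\
    fs v u = (size s1 + size (leaves_of u v)) %% nleaves.
Proof.
have [n] := ubnP #|side v u|; elim: n u v => // n IH v w; rewrite ltnS => le vw rs.
have wv : adj w v by rewrite adj_sym.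
case: (boolP (leaf v)) => lv.
  have e : r = v by move: rs; rewrite side_leaf // inE => /eqP.
  subst v; have eq := leaf_nbr lr vw rq; subst w.
  exists [:: r], [::]; rewrite cats0; split=> //.
  by rewrite fs_leaf // /pos /= eqxx add1n modnn.
have rv : r != v by apply: contraNneq lv => <-.
have [u vu ru] := side_nbr rv.
have uv : adj u v by rewrite adj_sym.
have uw : u != w.
  by apply/eqP=> e; move: ru; rewrite e sideC // rs.
have lt : #|side v u| < n.
  by apply: leq_trans le; apply: proper_card; exact: side_child.
have [s1 [s2 [eo ef]]] := IH _ _ lt uv ru.
have v1 := ccw_adj vu.
have v2 := ccw_adj v1.
have wu : w != u by rewrite eq_sym.
case: (nbrE lv vu vw) => e; first by rewrite e eqxx in wu.
  exists s1, (leaves_of v (ccw v w) ++ s2); split.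
    by rewrite eo leaves_ofE // (negbTE lv) e -!catA.
  rewrite fs_int // /fs /first_leaf.
  move: eo (leaves_of_neq0 (ccw_adj vw)).
  rewrite leaves_ofE // (negbTE lv) e.
  set A := leaves_of v _; set B := leaves_of v _ => eo B0.
  have lt' : size s1 + size A < nleaves.
    by rewrite /nleaves eo !size_cat; move: B0; clear; lia.
  rewrite modn_small //.
  have -> : head v B = lf (size s1 + size A).
    rewrite /lf eo nth_cat ltnNge leq_addr addKn -catA nth_cat ltnn subnn nth_cat B0 /=.
    by case: (B) B0.
  exact: lfK.
exists (s1 ++ leaves_of v (ccw v u)), s2; split.
  by rewrite eo leaves_ofE // (negbTE lv) -!catA e.
rewrite fs_int // e ccw_third // -/(fs v u) ef leaves_ofE // (negbTE lv).
by rewrite !size_cat addnA.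
Qed.

Definition sd u v i := lf i \in side u v.

Lemma pos_cat s1 s2 s3 x : ord = s1 ++ s2 ++ s3 -> leaf x ->
  (x \in s2) = (size s1 <= pos x < size s1 + size s2).
Proof.
move=> e lx; have := ord_uniq; have : x \in ord by rewrite leaf_mem.
rewrite /pos e !cat_uniq !mem_cat !index_cat.
case: (boolP (x \in s1)) => [x1 _ /and3P[_ /hasPn h _]|x1 /= _ /and3P[_ _ /and3P[_ /hasPn h _]]].
  have := h x; rewrite mem_cat x1 /= => h'.
  rewrite leqNgt index_mem x1 /=.
  by apply/negbTE/negP => x2; move: h'; rewrite x2 => /(_ isT).
case: (boolP (x \in s2)) => x2; first by rewrite leq_addr ltn_add2l index_mem.
by apply/esym/negbTE; lia.
Qed.

Lemma sdC u v i : adj u v -> sd v u i = ~~ sd u v i.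
Proof. by move=> uv; rewrite /sd sideC. Qed.

(** When [r] lies beyond v the infix belongs to the opposite dart, and the complement of its cyclic
    interval is taken. *)
Lemma sdE u v i : adj u v -> i < nleaves -> sd u v i = arc_co (fs u v) (fs v u) i.
Proof.
have away a b : adj a b -> r \in side b a -> i < nleaves ->
    sd a b i = arc_co (fs a b) (fs b a) i.
  move=> ab rs lt; have [s1 [s2 [eo ef]]] := away_infix ab rs.
  have := pos_cat eo (lf_leaf lt); rewrite lfK // mem_leaves_of // lf_leaf //= -/(sd _ _ _) => ->.
  have n0 := leaves_of_neq0 ab.
  have -> : fs a b = size s1.
    rewrite /fs /first_leaf.
    have -> : head a (leaves_of a b) = lf (size s1).
      by rewrite /lf eo nth_cat ltnn subnn nth_cat n0; case: leaves_of n0.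
    by apply: lfK; rewrite /nleaves eo !size_cat; move: n0; clear; lia.
  have le : size s1 + size (leaves_of a b) <= nleaves.
    by rewrite /nleaves eo !size_cat; clear; lia.
  rewrite ef /arc_co; move: le; rewrite leq_eqVlt => /orP[/eqP e|lt'].
    by rewrite e modnn ltn0 lt andbT orbF.
  have -> : size s1 < (size s1 + size (leaves_of a b)) %% nleaves by rewrite modn_small //; lia.
  by rewrite modn_small.
move=> uv lt; have vu : adj v u by rewrite adj_sym.
have := side_cover r uv; case/orP=> rs; last exact: away.
have := away _ _ vu rs lt; rewrite sdC // => /(canRL negbK) ->.
have := fs_neq uv; rewrite /arc_co; do 2 case: ifP; lia.
Qed.

End LeafOrder.

Local Notation m := nleaves.
Local Notation succ_leaf := (succ_mod m).
Local Notation N := (interior_edge T).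
Local Notation R0 := (framed (@tree_quiver T)).

(** * Faces and regions *)

Section Faces.
Implicit Types u v w x y z : T.

Definition face_adj := [rel d d' : T * T | face_step d d' || face_step d' d].

Lemma face_adj_sym : connect_sym face_adj.
Proof. by apply: sym_connect_sym => d d'; rewrite /= orbC. Qed.

Lemma face_step_first (d d' : T * T) : face_step d d' ->
  [/\ adj d.1 d.2, adj d'.1 d'.2 & first_leaf d.2 d.1 = first_leaf d'.2 d'.1].
Proof.
case: d d' => [u v] [v' w] /and4P[/= vw iv /eqP e1 /eqP e2]; subst.
have vu := ccw_adj vw; have uv : adj (ccw v' w) v' by rewrite adj_sym.
have wv : adj w v' by rewrite adj_sym.
by split=> //; rewrite (first_leafE wv) (negbTE iv).
Qed.

Lemma lface_first u v d : adj u v -> d \in lface u v ->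
  adj d.1 d.2 /\ first_leaf d.2 d.1 = first_leaf v u.
Proof.
move=> uv; rewrite inE => /connectP[p pp ->].
suff gen d0 : adj d0.1 d0.2 -> path.path face_adj d0 p ->
    adj (last d0 p).1 (last d0 p).2 /\ first_leaf (last d0 p).2 (last d0 p).1 = first_leaf d0.2 d0.1.
  exact: (gen (u, v)).
elim: p d0 {pp} => //= d1 p IH d0 a0 /andP[st pp].
have [a1 <-] : adj d1.1 d1.2 /\ first_leaf d1.2 d1.1 = first_leaf d0.2 d0.1.
  by case/orP: st => /face_step_first[].
exact: IH.
Qed.

(** Walking backwards along the face ends at the dart that leaves its naming leaf. *)
Lemma face_from_leaf u v : adj u v -> exists w,
  adj (first_leaf v u) w /\ connect face_adj (first_leaf v u, w) (u, v).
Proof.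
rewrite adj_sym; move: v u; apply: side_rect => // [v u vu lu|v u vu iu IH _].
  by rewrite first_leafE // lu; exists v; rewrite adj_sym.
rewrite first_leafE // (negbTE iu); case: IH => w [aw cw]; exists w; split=> //.
apply: connect_trans cw (connect1 _) => /=.
by rewrite /face_step /= adj_sym vu iu !eqxx.
Qed.

(** The label is invariant along a face. Conversely two darts with the same label are both connected
    to the only dart leaving the leaf of that label. *)
Lemma lfaceE u v u' v' : adj u v -> adj u' v' ->
  (lface u v == lface u' v') = (fs v u == fs v' u').
Proof.
move=> uv u'v'; have vu : adj v u by rewrite adj_sym.
have v'u' : adj v' u' by rewrite adj_sym.
apply/eqP/eqP => [e|e].
  have := mem_lface_self u v; rewrite e => /(lface_first u'v')[_ /= e'].
  by rewrite /fs e'.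
have {}e : first_leaf v u = first_leaf v' u'.
  have /andP[l1 _] := first_leaf_leaf vu.
  have /andP[l2 _] := first_leaf_leaf v'u'.
  by rewrite -(posK l1) -(posK l2) -!/(fs _ _) e.
have /andP[l1 _] := first_leaf_leaf vu.
have [w [aw cw]] := face_from_leaf uv; have [w' [aw' cw']] := face_from_leaf u'v'.
rewrite -e in aw' cw'; have ew := leaf_nbr l1 aw aw'; rewrite -ew in cw'.
have c : connect face_adj (u, v) (u', v').
  by apply: connect_trans cw'; rewrite face_adj_sym.
by apply/setP=> d; rewrite !inE; exact: same_connect face_adj_sym _ _ c d.
Qed.

Lemma mem_lface u v d : adj u v ->
  (d \in lface u v) = adj d.1 d.2 && (fs d.2 d.1 == fs v u).
Proof.
move=> uv; apply/idP/andP => [/(lface_first uv)[a e]|[a e]]; first by rewrite /fs e.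
move: e; rewrite -lfaceE // => /eqP <-; case: d a => a b _; exact: mem_lface_self.
Qed.

Lemma facesP F : reflect (exists u v, adj u v /\ F = lface u v) (F \in faces T).
Proof.
apply: (iffP imsetP) => [[[u v]]|[u [v [uv ->]]]].
  by rewrite inE /= => uv ->; exists u, v.
by exists (u, v); rewrite ?inE.
Qed.

Definition arc_of i j : {set T} := pth (lf i) (lf j).

Lemma nleaves_gt1 : 1 < m.
Proof. by rewrite /nleaves /ord /= ltnS leaves_of_neq0. Qed.

Lemma succ_leaf_lt i : i < m -> succ_leaf i < m.
Proof. by rewrite /succ_mod => lt; have := nleaves_gt1; case: ifP => //; lia. Qed.

Lemma lf_inj i j : i < m -> j < m -> lf i = lf j -> i = j.
Proof. by move=> li lj e; rewrite -(lfK li) e lfK. Qed.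

Lemma lf_nbr i : i < m -> exists n, adj (lf i) n.
Proof.
move=> lt; have /card_gt0P[n] : 0 < #|[set w | adj (lf i) w]|.
  by rewrite -/(degree (lf i)) (eqP (lf_leaf lt)).
by rewrite inE; exists n.
Qed.

Lemma fs_to_leaf i n : i < m -> adj (lf i) n -> fs n (lf i) = i.
Proof. by move=> lt a; rewrite fs_leaf ?lfK ?lf_leaf // adj_sym. Qed.

(** The interval of leaves beyond the leaf i starts at i and has i as its only element, which
    determines its end. *)
Lemma fs_from_leaf i n : i < m -> adj (lf i) n -> fs (lf i) n = succ_leaf i.
Proof.
move=> lt a; have na : adj n (lf i) by rewrite adj_sym.
have st k : k < m -> sd n (lf i) k = (k == i).
  move=> km; rewrite /sd side_leaf ?lf_leaf // in_set1.
  by apply/eqP/eqP => [/lf_inj|->] //; apply.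
have := fs_lt a; have := fs_neq a.
have h k : k < m -> arc_co i (fs (lf i) n) k = (k == i).
  by move=> km; rewrite -st // sdE // fs_to_leaf.
rewrite fs_to_leaf //; set f := fs _ _ in h * => ne flt.
rewrite /succ_mod; have m1 := nleaves_gt1.
case: ifP => e.
  case: (posnP f) => // f0; have := h 0 (ltnW m1); rewrite /arc_co; case: ifP; lia.
have := h i.+1; rewrite /arc_co; case: ifP; lia.
Qed.

(** Going from the label [fs u v] to [fs v u] passes the leaves beyond v. Passing leaf i enters ]i,
    j] and passing leaf j leaves it; for an edge off the arc, both or neither are passed. *)
Lemma across_same_arc i j F G : i < m -> j < m -> i != j ->
  across (arc_of i j) F G -> exists u v,
  [/\ adj u v, F = lface u v, G = lface v u & arc_oc i j (fs v u) = arc_oc i j (fs u v)].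
Proof.
move=> im jm ij /existsP[u /existsP[v /and4P[uv np /eqP-> /eqP->]]]; exists u, v; split=> //.
have vu : adj v u by rewrite adj_sym.
move: np; rewrite /arc_of edge_in_pth // negbK -!/(sd _ _ _) !sdE //.
have := fs_lt uv; have := fs_lt vu; have := fs_neq uv.
rewrite /arc_co /arc_oc; do 2 case: ifP; lia.
Qed.

Lemma across_sym i j : symmetric (across (arc_of i j)).
Proof.
move=> F G; apply/existsP/existsP => -[u /existsP[v /and4P[uv np e1 e2]]];
  exists v; apply/existsP; exists u; by apply/and4P; split=> //; [rewrite adj_sym | rewrite andbC].
Qed.

Lemma across_connect i j F G u v : i < m -> j < m -> i != j -> adj u v -> F = lface u v ->
  connect (across (arc_of i j)) F G -> exists u' v',
  [/\ adj u' v', G = lface u' v' & arc_oc i j (fs v u) = arc_oc i j (fs v' u')].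
Proof.
move=> im jm ij uv eF /connectP[p pp ->] {G}.
elim: p F u v uv eF pp => [|G p IH] F u v uv eF /=; first by exists u, v.
case/andP=> ac pp; have [a [b [ab eF' eG h]]] := across_same_arc im jm ij ac.
have ba : adj b a by rewrite adj_sym.
have [u' [v' [uv' e' h']]] := IH G b a ba eG pp; exists u', v'; split=> //.
rewrite -h' -h; congr arc_oc; apply/eqP; rewrite -lfaceE //; by rewrite -eF -eF'.
Qed.

(** From face k one crosses the edge at leaf k into face k + 1 (modulo m). This edge is not on the
    arc as long as k differs from i and j, so the walk can proceed up to face j. *)
Lemma connect_to_end i j u v : i < m -> j < m -> i != j -> adj u v -> arc_oc i j (fs v u) ->
  exists n, adj (lf j) n /\ connect (across (arc_of i j)) (lface u v) (lface (lf j) n).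
Proof.
move=> im jm ij; pose d k := if k <= j then j - k else j + m - k.
have [N] := ubnP (d (fs v u)); elim: N u v => // N IH u v; have [k ek] : exists k, k = fs v u by exists (fs v u).
rewrite -ek => dlt uv hk; have vu : adj v u by rewrite adj_sym.
have km : k < m by rewrite ek; exact: fs_lt.
have [n kn] := lf_nbr km; have nk : adj n (lf k) by rewrite adj_sym.
have e1 : lface u v = lface (lf k) n by apply/eqP; rewrite lfaceE // -ek fs_to_leaf.
case: (eqVneq k j) => [e|kj]; first by exists n; rewrite -e e1 connect0.
have ki : k != i by apply: contraTneq hk => ->; rewrite /arc_oc; case: ifP; lia.
have ac : across (arc_of i j) (lface (lf k) n) (lface n (lf k)).
  apply/existsP; exists (lf k); apply/existsP; exists n; rewrite kn !eqxx /= !andbT.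
  apply/negP=> /andP[]; rewrite /arc_of leaf_in_pth ?lf_leaf //.
  by case/orP=> /eqP/lf_inj e; [move: ki|move: kj]; rewrite e ?eqxx.
case: (IH n (lf k)) => //; rewrite ?fs_from_leaf //.
- by move: dlt hk; rewrite /d /arc_oc /succ_mod; case: (k.+1 =P m) => ?; rewrite ?leq0n ?subn0; do !case: ifP; lia.
- by move: hk; rewrite /arc_oc /succ_mod; case: (k.+1 =P m) => ?; do !case: ifP; lia.
move=> n' [jn' c]; exists n'; split=> //; rewrite e1.
exact: connect_trans (connect1 ac) c.
Qed.

Lemma arc_ofC i j : arc_of i j = arc_of j i.
Proof. exact: pthC. Qed.

(** Two faces with labels in ]i, j] are both connected to face j. Those with other labels are in ]j,
    i], so they are connected to face i by the same walk for the reversed arc. *)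
Lemma mem_Reg i j u v u' v' : i < m -> j < m -> i != j -> adj u v -> adj u' v' ->
  (lface u' v' \in Reg (arc_of i j) (lface u v)) = (arc_oc i j (fs v u) == arc_oc i j (fs v' u')).
Proof.
move=> im jm ij uv uv'; rewrite inE lface_faces //=; apply/idP/eqP => [c|h].
  have [a [b [ab e ->]]] := across_connect im jm ij uv erefl c.
  by congr arc_oc; apply/eqP; rewrite eq_sym -lfaceE // e.
have halfC k : arc_oc j i k = ~~ arc_oc i j k by rewrite /arc_oc; do 2 case: ifP; lia.
have csym : connect_sym (across (arc_of i j)) by apply: sym_connect_sym; exact: across_sym.
case: (boolP (arc_oc i j (fs v u))) => hv.
  have [n [an c]] := connect_to_end im jm ij uv hv.
  have hv' : arc_oc i j (fs v' u') by rewrite -h.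
  have [n' [an' c']] := connect_to_end im jm ij uv' hv'.
  apply: connect_trans c _; rewrite csym.
  by rewrite (leaf_nbr (lf_leaf jm) an an').
have ji : j != i by rewrite eq_sym.
rewrite -halfC in hv; have [n [an c]] := connect_to_end jm im ji uv hv.
have hv' : arc_oc j i (fs v' u') by move: hv; rewrite !halfC h.
have [n' [an' c']] := connect_to_end jm im ji uv' hv'.
rewrite arc_ofC in c c'.
apply: connect_trans c _; rewrite csym.
by rewrite (leaf_nbr (lf_leaf im) an an').
Qed.

Lemma Reg_faces p F G : G \in Reg p F -> G \in faces T.
Proof. by rewrite inE => /andP[]. Qed.

Lemma face_at k : k < m -> exists u v, adj u v /\ fs v u = k.
Proof. by move=> km; have [n a] := lf_nbr km; exists (lf k), n; rewrite fs_to_leaf. Qed.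

Lemma Reg_subset i j k l u v u' v' : i < m -> j < m -> i != j -> k < m -> l < m -> k != l ->
  adj u v -> adj u' v' ->
  Reg (arc_of i j) (lface u v) \subset Reg (arc_of k l) (lface u' v') <->
  (forall a, a < m -> arc_oc i j (fs v u) = arc_oc i j a -> arc_oc k l (fs v' u') = arc_oc k l a).
Proof.
move=> im jm ij km lm kl uv uv'; split=> [/subsetP h a am e|h].
  have [x [y [xy ea]]] := face_at am.
  have := h (lface x y); rewrite !mem_Reg // ea e eqxx => /(_ isT)/eqP //.
apply/subsetP => F FR; have /facesP[x [y [xy eF]]] := Reg_faces FR.
have yx : adj y x by rewrite adj_sym.
move: FR; rewrite eF !mem_Reg // => /eqP e; rewrite (h _ (fs_lt yx) e) //.
Qed.

End Faces.

(** * Crossing arcs *)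

Section Arcs.
Implicit Types u v w x y z : T.

Lemma sd_noncross u v a b c d : adj u v -> a < m -> b < m -> c < m -> d < m ->
  cyc a c b -> cyc b d a -> ~ (sd u v a = sd u v b /\ sd u v c = sd u v d /\ sd u v a <> sd u v c).
Proof.
move=> uv am bm cm dm; rewrite !sdE //.
have := fs_neq uv; rewrite /cyc /arc_co; case: ifP; lia.
Qed.

(** The vertex u is where the paths from x to a and to c part; it is found by descending as long as
    both leaves are in the same branch. *)
Lemma median x y a c : adj x y -> leaf a -> leaf c -> a != c ->
  a \in side x y -> c \in side x y -> exists u w1 w2 w3,
  [/\ adj u w1, adj u w2, adj u w3, [/\ w1 != w2, w1 != w3 & w2 != w3] &
   [/\ a \in side u w1, c \in side u w2 & side y x \subset side u w3]].
Proof.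
move=> xy la lc ac; move: x y xy; apply: side_rect => // [x y xy ly|x y xy iy IH1 IH2].
  by rewrite side_leaf // !in_set1 => /eqP ea /eqP ec; rewrite ea ec eqxx in ac.
have yx : adj y x by rewrite adj_sym.
have y1 := ccw_adj yx; have y2 := ccw_adj y1.
have ay : a != y by apply: contraNneq iy => <-.
have cy : c != y by apply: contraNneq iy => <-.
have n1 := ccw_neq iy yx; have n2 := ccw2_neq iy yx; have n3 := ccw_neq iy y1.
have sub w : adj y w -> w != x -> side y x \subset side w y.
  move=> yw wx; apply: proper_sub; apply: side_child; rewrite // 1?adj_sym // eq_sym //.
have lift w : adj y w -> w != x -> (exists u w1 w2 w3,
    [/\ adj u w1, adj u w2, adj u w3, [/\ w1 != w2, w1 != w3 & w2 != w3] &
     [/\ a \in side u w1, c \in side u w2 & side w y \subset side u w3]]) ->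
  exists u w1 w2 w3, [/\ adj u w1, adj u w2, adj u w3, [/\ w1 != w2, w1 != w3 & w2 != w3] &
     [/\ a \in side u w1, c \in side u w2 & side y x \subset side u w3]].
  move=> yw wx [u [w1 [w2 [w3 [h1 h2 h3 h4 [h5 h6 h7]]]]]].
  exists u, w1, w2, w3; split=> //; split=> //.
  by apply: subset_trans h7; apply: sub.
rewrite !(side_split xy iy) !in_setU !in_set1 (negbTE ay) (negbTE cy) /=.
case: (boolP (a \in side y (ccw y x))) => a1; case: (boolP (c \in side y (ccw y x))) => c1 //=.
- by move=> _ _; apply: (lift _ y1 n1); exact: IH1.
- move=> _ c2; exists y, (ccw y x), (ccw y (ccw y x)), x; split=> //.
  by rewrite eq_sym n3 n1.
- move=> a2 _; exists y, (ccw y (ccw y x)), (ccw y x), x; split=> //.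
- by move=> a2 c2; apply: (lift _ y2 n2); exact: IH2.
Qed.

Lemma two_leaves_int v w i j : adj v w -> i < m -> j < m -> i != j -> sd v w i -> sd v w j -> ~~ leaf w.
Proof.
move=> vw im jm ij; rewrite /sd => si sj; apply: contraNN ij => lw.
move: si sj; rewrite side_leaf // !in_set1 => /eqP ei /eqP ej.
by apply/eqP; apply: lf_inj; rewrite // ei ej.
Qed.

Lemma lf_neq i j : i < m -> j < m -> i != j -> lf i != lf j.
Proof. by move=> im jm; apply: contraNneq => /lf_inj ->. Qed.

Lemma sd_side_uniq v w w' i : adj v w -> adj v w' -> sd v w i -> sd v w' i -> w = w'.
Proof. exact: side_uniq. Qed.

Lemma sd_nbr v i : ~~ leaf v -> i < m -> exists2 w, adj v w & sd v w i.
Proof.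
move=> iv im; apply: side_nbr; apply: contraNneq iv => <-; exact: lf_leaf.
Qed.

(** At the branching vertex u of a, b, c, the leaf d shares a branch with one of them. Sharing it
    with c would contradict the cyclic order; otherwise the edge from u to the shared branch works,
    and it is interior because two leaves lie beyond it. *)
Lemma quartet a b c d : a < m -> b < m -> c < m -> d < m -> cyc a c b -> cyc b d a ->
  exists u v, [/\ adj u v, ~~ leaf u, ~~ leaf v & sd u v a != sd u v b /\ sd u v c != sd u v d].
Proof.
move=> am bm cm dm acb bda.
have [n bn] := lf_nbr bm.
have nb : adj n (lf b) by rewrite adj_sym.
have notb k : k < m -> k != b -> lf k \in side (lf b) n.
  by move=> km kb; rewrite (sideC _ nb) side_leaf ?in_set1 ?lf_neq ?lf_leaf.
have ab : a != b by move: acb bda; rewrite /cyc; lia.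
have cb : c != b by move: acb bda; rewrite /cyc; lia.
have ac : a != c by move: acb bda; rewrite /cyc; lia.
have ad : a != d by move: acb bda; rewrite /cyc; lia.
have bd : b != d by move: acb bda; rewrite /cyc; lia.
have [u [w1 [w2 [w3 [u1 u2 u3 [n12 n13 n23] [s1 s2 s3]]]]]] :=
  median bn (lf_leaf am) (lf_leaf cm) (lf_neq am cm ac) (notb _ am ab) (notb _ cm cb).
have {}s3 : sd u w3 b by apply: (subsetP s3); rewrite side_leaf ?in_set1 ?lf_leaf.
rewrite -/(sd u w1 a) in s1; rewrite -/(sd u w2 c) in s2.
have iu : ~~ leaf u by exact: two_nbrs u1 u2 n12.
have no w w' i : adj u w -> adj u w' -> w != w' -> sd u w i -> sd u w' i = false.
  by move=> uw uw' ne si; apply: contraNF ne => si'; apply/eqP; exact: sd_side_uniq si si'.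
have [w uw sw] := sd_nbr iu dm.
have [e|e|e] : [\/ w = w1, w = w2 | w = w3].
  have [_ _ mem] := ccw3 iu u1.
  move: uw u2 u3; rewrite !mem !inE !(eq_sym _ w1) (negbTE n12) (negbTE n13) /=.
  move=> /or3P[] /eqP e /orP[] /eqP e2 /orP[] /eqP e3; subst;
    by [constructor 1|constructor 2|constructor 3|rewrite eqxx in n23].
- subst w; exists u, w1; split=> //.
    exact: two_leaves_int u1 am dm ad s1 sw.
  rewrite s1 sw (no w3 w1 b) 1?eq_sym // (no w2 w1 c) 1?eq_sym //.
- subst w; case: (@sd_noncross u w2 a b c d) => //.
  rewrite s2 sw (no w3 w2 b) 1?eq_sym // (no w1 w2 a) //.
subst w; exists u, w3; split=> //.
  exact: two_leaves_int u3 bm dm bd s3 sw.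
by rewrite s3 sw (no w1 w3 a) // (no w2 w3 c).
Qed.

Lemma nested_arcs i j k l : i != j -> k != l -> ~~ crossed i j k l ->
  exists i' j' k' l', [/\ (i' = i /\ j' = j) \/ (i' = j /\ j' = i),
    (k' = k /\ l' = l) \/ (k' = l /\ l' = k) & forall a, arc_oc k' l' a -> arc_oc i' j' a].
Proof.
move=> ij kl nc.
have sub i' j' k' l' : i' != j' -> k' != l' -> ~~ arc_oc k' l' i' && arc_oc i' j' l' ->
    forall a, arc_oc k' l' a -> arc_oc i' j' a.
  by rewrite /arc_oc; do 2 case: ifP; lia.
have ji : j != i by rewrite eq_sym.
have lk : l != k by rewrite eq_sym.
have : [|| ~~ arc_oc k l i && arc_oc i j l, ~~ arc_oc l k i && arc_oc i j k,
  ~~ arc_oc k l j && arc_oc j i l | ~~ arc_oc l k j && arc_oc j i k].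
  move: ij kl nc; rewrite /crossed /cyc /arc_oc; do !case: ifP; lia.
case/or4P=> /sub h.
- by exists i, j, k, l; split; auto.
- by exists i, j, l, k; split; auto.
- by exists j, i, k, l; split; auto.
- by exists j, i, l, k; split; auto.
Qed.

(** The condition on regions does not involve the segment, so for a crossing a single interior edge
    common to both arcs suffices, and [quartet] gives one. Noncrossing chords have nested sides,
    hence nested regions. *)
Lemma noncrossingE i j k l : i < m -> j < m -> i != j -> k < m -> l < m -> k != l ->
  noncrossing (arc_of i j) (arc_of k l) <-> ~~ crossed i j k l.
Proof.
move=> im jm ij km lm kl; split=> [nc|nc]; last first.
  have [i' [j' [k' [l' [ei ek sub]]]]] := nested_arcs ij kl nc.
  case=> s [_ _ h].
  have [ei' im' jm' ij'] : [/\ arc_of i j = arc_of i' j', i' < m, j' < m & i' != j'].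
    by case: ei => -[-> ->]; split; rewrite // 1?arc_ofC // eq_sym.
  have [ek' km' lm' kl'] : [/\ arc_of k l = arc_of k' l', k' < m, l' < m & k' != l'].
    by case: ek => -[-> ->]; split; rewrite // 1?arc_ofC // eq_sym.
  have [u [v [uv fj]]] := face_at jm'.
  have [u' [v' [uv' fl]]] := face_at lm'.
  have := h (Reg (arc_of i j) (lface u v)) (Reg (arc_of k l) (lface u' v')).
  case; [exact/imset_f/lface_faces|exact/imset_f/lface_faces|].
  move=> _ /negP; apply; rewrite ei' ek'; apply/Reg_subset => // a am.
  have tj : arc_oc i' j' j' by move: ij'; rewrite /arc_oc; case: ifP; lia.
  have tl : arc_oc k' l' l' by move: kl'; clear; rewrite /arc_oc; case: ifP; lia.
  by rewrite fj fl tj tl => /esym/sub ->.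
apply/negP => cr; apply: nc.
have [u [v [uv iu iv [s1 s2]]]] : exists u v,
    [/\ adj u v, ~~ leaf u, ~~ leaf v & sd u v i != sd u v j /\ sd u v k != sd u v l].
  case/orP: cr => /andP[c1 c2]; first exact: quartet.
  have [u [v [uv iu iv [h1 h2]]]] := quartet im jm lm km c1 c2.
  by exists u, v; rewrite eq_sym in h2; split.
exists [:: u; v]; split.
- split=> //.
  + by apply/acyclic_pathP; rewrite /= inE uv adj_neq.
  + by move=> s1' s2' x y z /(congr1 size); rewrite size_cat /= !addnS.
  + by move=> x s' [<- <-].
- have /andP[up vp] : (u \in arc_of i j) && (v \in arc_of i j) by rewrite edge_in_pth.
  have /andP[uq vq] : (u \in arc_of k l) && (v \in arc_of k l) by rewrite edge_in_pth.
  by move=> x; rewrite in_cons mem_seq1 => /orP[] /eqP ->.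
have ex (b1 b2 : bool) : exists2 a, a < m & arc_oc i j a = b1 /\ arc_oc k l a = b2.
  have [a ain h] := crossed_arcs b1 b2 ij kl cr; exists a => //.
  by move: ain; rewrite !inE => /or4P[] /eqP ->.
move=> Rp Rq /imsetP[F /facesP[x [y [xy ->]]] ->] /imsetP[G /facesP[x' [y' [xy' ->]]] ->].
split; apply/negP => h.
  have /(Reg_subset im jm ij km lm kl xy xy') {}h := h.
  have [a am [h1 h2]] := ex (arc_oc i j (fs y x)) (~~ arc_oc k l (fs y' x')).
  by have := h a am; rewrite h1 h2 => /(_ erefl); case: arc_oc.
have /(Reg_subset km lm kl im jm ij xy' xy) {}h := h.
have [a am [h1 h2]] := ex (~~ arc_oc i j (fs y x)) (arc_oc k l (fs y' x')).
by have := h a am; rewrite h1 h2 => /(_ erefl); case: arc_oc.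
Qed.

End Arcs.

(** * Boundary arcs and corners in terms of positions *)

Section Corners.
Implicit Types u v w x y z : T.

Lemma sd_fs u v : adj u v -> sd u v (fs u v).
Proof.
move=> uv; rewrite sdE ?fs_lt //.
by have := fs_neq uv; rewrite /arc_co; case: ifP; lia.
Qed.

Lemma arc_of_inj i j k l : i < m -> j < m -> k < m -> l < m -> i != j ->
  arc_of i j = arc_of k l -> (i = k /\ j = l) \/ (i = l /\ j = k).
Proof.
move=> im jm km lm ij; rewrite /arc_of => /pth_inj.
case; rewrite ?lf_leaf ?lf_neq // => -[e1 e2]; [left|right];
  by split; apply: lf_inj.
Qed.

Lemma is_arc_pos p : is_arc p <-> exists i j, [/\ i < m, j < m, i != j & p = arc_of i j].
Proof.
split=> [/is_arcP[a [b [la lb ab ->]]]|[i [j [im jm ij ->]]]].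
  exists (pos a), (pos b); rewrite !ltn_pos //; split=> //.
    by apply: contraNneq ab => e; rewrite -(posK la) e posK.
  by rewrite /arc_of !posK.
apply/is_arcP; exists (lf i), (lf j).
by rewrite !lf_leaf // lf_neq.
Qed.

Lemma succ_leaf_inj i j : i < m -> j < m -> succ_leaf i = succ_leaf j -> i = j.
Proof. by rewrite /succ_mod; do 2 case: ifP; lia. Qed.

Lemma leaf_on_face i u v : i < m -> adj u v -> vertex_on_face (lface u v) (lf i) ->
  fs v u = i \/ fs v u = succ_leaf i.
Proof.
move=> im uv /existsP[w]; rewrite /edge_on_face !mem_lface //=.
case/orP=> /andP[a /eqP e]; [left|right]; rewrite -e.
  exact: fs_to_leaf.
by apply: fs_from_leaf; rewrite // adj_sym.
Qed.

(** The common face is the one labelled j. At an inner vertex v of the arc, the leaves beyond the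
    neighbour w towards j include j but not its predecessor i, so their interval starts at j and
    [fs v w] is j. *)
Lemma consecutive_boundary i j : i < m -> j < m -> i != j -> j = succ_leaf i ->
  boundary_arc (arc_of i j).
Proof.
move=> im jm ij e; split; first by apply/is_arc_pos; exists i, j.
have [n jn] := lf_nbr jm; have nj : adj n (lf j) by rewrite adj_sym.
exists (lface (lf j) n); first exact: lface_faces.
have memF a b : adj a b -> fs b a = j -> (a, b) \in lface (lf j) n.
  by move=> ab f; rewrite mem_lface //= ab f fs_to_leaf /=.
move=> v vp; apply/existsP.
case: (boolP (leaf v)) => lv.
  move: vp; rewrite /arc_of leaf_in_pth // => /orP[] /eqP ev; subst v.
    have [n' in'] := lf_nbr im; exists n'; apply/orP; right.
    by apply: memF; rewrite 1?adj_sym // fs_from_leaf.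
  by exists n; apply/orP; left; rewrite mem_lface_self.
have [w' vw' si] := sd_nbr lv im; have [w vw sj] := sd_nbr lv jm.
have ne : w' != w.
  by apply: contraTneq vp => e'; apply/pthP; exists w; split=> //; rewrite -e'.
have wv : adj w v by rewrite adj_sym.
exists w; apply/orP; right; apply: memF => //.
have nsi : sd v w i = false.
  by apply: contraNF ne => s; apply/eqP; exact: sd_side_uniq si s.
move: nsi sj; rewrite !sdE // e /succ_mod.
have := fs_neq vw; have := fs_lt vw; have := fs_lt wv.
by move: im; clear; rewrite /arc_co; case: ifP; case: ifP; lia.
Qed.

Lemma boundary_arcE i j : i < m -> j < m -> i != j ->
  boundary_arc (arc_of i j) <-> consecutive m i j.
Proof.
move=> im jm ij; split=> [[_ [F /facesP[u [v [uv ->]]] h]]|].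
  have := leaf_on_face im uv (h _ (pth_l _ _)); have := leaf_on_face jm uv (h _ (pth_r _ _)).
  rewrite /consecutive => -[->|->] [] e; rewrite ?e ?eqxx ?orbT //.
    by rewrite e eqxx in ij.
  by case/negP: ij; rewrite (succ_leaf_inj jm im e).
case/orP=> /eqP e; first exact: consecutive_boundary.
have ji : j != i by rewrite eq_sym.
by rewrite /arc_of pthC; exact: (consecutive_boundary jm im ji e).
Qed.

Lemma ccw_inj v w w' : ~~ leaf v -> adj v w -> adj v w' -> ccw v w = ccw v w' -> w = w'.
Proof. by move=> iv vw vw' e; rewrite -(ccw_third iv vw) e ccw_third. Qed.

(* The corner between w and its counterclockwise successor at v lies to the left of the
   dart (v, w). *)
Definition at_corner v w i j := sd v w i && sd v (ccw v w) j || sd v w j && sd v (ccw v w) i.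

Lemma face_of_turn u v w F : adj v u -> adj v w -> u != w -> F \in faces T ->
  edge_on_face F u v -> edge_on_face F v w ->
  (w = ccw v u /\ F = lface v u) \/ (u = ccw v w /\ F = lface v w).
Proof.
move=> vu vw uw /facesP[x [y [xy ->]]].
have iv : ~~ leaf v by exact: two_nbrs vu vw uw.
have uv : adj u v by rewrite adj_sym.
have wv : adj w v by rewrite adj_sym.
rewrite /edge_on_face !mem_lface //= uv vu vw wv /=.
rewrite (fs_int uv iv) (fs_int wv iv).
have un z z' : adj v z -> adj v z' -> fs v z = fs v z' -> z = z'.
  move=> vz vz' e; have s := sd_fs vz; have s' := sd_fs vz'; rewrite -e in s'.
  exact: sd_side_uniq s s'.
have vu1 := ccw_adj vu; have vw1 := ccw_adj vw.
case/orP=> /eqP e1 /orP[] /eqP e2.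
- have := un _ _ vu vw1; rewrite e1 e2 => /(_ erefl) e; right; split=> //.
  by apply/eqP; rewrite lfaceE // (fs_int wv iv) e2.
- by have := un _ _ vu vw; rewrite e1 e2 => /(_ erefl) e; rewrite e eqxx in uw.
- have := un _ _ vu1 vw1; rewrite e1 e2 => /(_ erefl)/(ccw_inj iv vu vw) e.
  by rewrite e eqxx in uw.
- have := un _ _ vu1 vw; rewrite e1 e2 => /(_ erefl) e; left; split=> //.
  by apply/eqP; rewrite lfaceE // (fs_int uv iv) e1.
Qed.

Lemma contains_cornerE i j v F : i < m -> j < m -> i != j ->
  contains_corner (arc_of i j) v F <->
  exists w, [/\ adj v w, ~~ leaf v, F = lface v w & at_corner v w i j].
Proof.
move=> im jm ij; split.
  case=> s [s1 [s2 [u [w [tr es FF e1 e2]]]]].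
  have [a [p [esp pap up [la lb ab ea]]]] := traces_arcP tr.
  rewrite esp in es; have [vu vw uw sa sb] := path_turn pap up es.
  have iv : ~~ leaf v by exact: two_nbrs vu vw uw.
  have ends : sd v u i && sd v w j || sd v u j && sd v w i.
    have := pth_inj (lf_leaf im) (lf_leaf jm) la lb (lf_neq im jm ij) ea.
    by case=> -[e e']; rewrite /sd e e' sa sb ?orbT.
  case: (face_of_turn vu vw uw FF e1 e2) => -[e eF].
    by exists u; split=> //; rewrite /at_corner -e.
  by exists w; split=> //; rewrite /at_corner -e orbC andbC [X in _ || X]andbC.
case=> w [vw iv eF ac].
wlog /andP[si sj] : i j im jm ij ac / sd v w i && sd v (ccw v w) j.
  move=> W; case/orP: (ac) => h; first exact: W.
  by rewrite /arc_of pthC; apply: W; rewrite // 1?eq_sym // /at_corner orbC.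
have [p [pap up ep tr]] := arc_path (lf_leaf im) (lf_leaf jm) (lf_neq im jm ij).
have vi : v != lf i by apply: contraNneq iv => ->; exact: lf_leaf.
have vj : v != lf j by apply: contraNneq iv => ->; exact: lf_leaf.
have v1 := ccw_adj vw.
have vp : v \in lf i :: p.
  rewrite mem_path_pth // ep; apply/negPn/pthP => -[z [vz zi zj]].
  have e : z = w by exact: side_uniq vz vw zi si.
  have e' : z = ccw v w by exact: side_uniq vz v1 zj sj.
  by have := ccw_neq iv vw; rewrite -e' e eqxx.
rewrite -ep in vj; have [s1 [s2 [a [b es]]]] := split_inner vp vi vj.
have [va vb ab sa sb] := path_turn pap up es.
rewrite ep in sb.
have ea : a = w by exact: side_uniq va vw sa si.
have eb : b = ccw v w by exact: side_uniq vb v1 sb sj.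
exists (lf i :: p), s1, s2, a, b; split=> //.
- by rewrite eF lface_faces.
- by rewrite eF ea /edge_on_face mem_lface_self orbT.
- by rewrite eF eb /edge_on_face mem_lface_turn ?orbT.
Qed.

End Corners.

(** * Facets as triangulations *)

Section Bridge.
Implicit Types u v w x y z : T.
Implicit Types S : {set {set T}}.

Definition chord S : rel nat := fun i j => [&& i < m, j < m, i != j & arc_of i j \in S].

Lemma chordP S i j : reflect [/\ i < m, j < m, i != j & arc_of i j \in S] (chord S i j).
Proof. exact: and4P. Qed.

Lemma arc_of_eq i j k l : i < m -> j < m -> k < m -> l < m -> i != j ->
  (arc_of i j == arc_of k l) = same i j k l.
Proof.
move=> im jm km lm ij; apply/eqP/idP.
  by move=> /(arc_of_inj im jm km lm ij)[] [-> ->]; rewrite /same !eqxx ?orbT.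
by case/orP=> /andP[/eqP-> /eqP->] //; exact: arc_ofC.
Qed.

Lemma arcs_chord S S' : (forall p, p \in S -> is_arc p) ->
  (forall i j, chord S i j -> chord S' i j) -> S \subset S'.
Proof.
move=> h sub; apply/subsetP => p pS.
have [i [j [im jm ij ep]]] := (is_arc_pos p).1 (h _ pS).
have : chord S i j by apply/chordP; rewrite -ep.
by move/sub/chordP => [_ _ _]; rewrite -ep.
Qed.

Lemma facetP S : facet S <-> (forall p, p \in S -> is_arc p) /\ triangulation m (chord S).
Proof.
split.
  case=> -[arcS nc] mx; split=> //; split.
  - by move=> i j; apply/chordP/chordP => -[h1 h2 h3 h4]; split; rewrite // 1?eq_sym // arc_ofC.
  - by move=> i j /chordP[].
  - move=> i j k l /chordP[im jm ij ijS] /chordP[km lm kl klS].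
    by apply/noncrossingE => //; exact: nc.
  move=> i j im jm ij h; apply/chordP; split=> //.
  suff <- : arc_of i j |: S = S by rewrite setU11.
  have arcij : is_arc (arc_of i j) by apply/is_arc_pos; exists i, j.
  have ncS p : p \in S -> noncrossing (arc_of i j) p /\ noncrossing p (arc_of i j).
    move=> pS; have [k [l [km lm kl ep]]] := (is_arc_pos p).1 (arcS _ pS).
    have /h cr : chord S k l by apply/chordP; rewrite -ep.
    by rewrite ep; split; apply/noncrossingE; rewrite // crossed_swap.
  apply: mx; last exact: subsetUr.
  split=> [p|p p'].
    by rewrite in_setU1 => /orP[/eqP->|/arcS].
  rewrite !in_setU1 => /orP[/eqP->|pS] /orP[/eqP->|pS']; last exact: nc.
  - apply/noncrossingE => //; by rewrite crossed_self.
  - by have [] := ncS _ pS'.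
  - by have [] := ncS _ pS.
case=> arcS tE; split.
  split=> // p p' pS pS'.
  have [i [j [im jm ij ep]]] := (is_arc_pos p).1 (arcS _ pS).
  have [k [l [km lm kl ep']]] := (is_arc_pos p').1 (arcS _ pS').
  rewrite ep ep'; apply/noncrossingE => //; apply: (tri_nc tE); apply/chordP.
    by rewrite -ep.
  by rewrite -ep'.
move=> S' [arcS' nc'] sub; apply/eqP; rewrite eqEsubset sub andbT.
apply: arcs_chord => // i j /chordP[im jm ij ijS]; apply: (tri_max tE) => // k l /chordP[km lm kl klS].
by apply/noncrossingE => //; apply: nc' => //; exact: (subsetP sub).
Qed.

Lemma facet_eq S S' : facet S -> facet S' -> chord S =2 chord S' -> S = S'.
Proof.
move=> /facetP[aS _] /facetP[aS' _] e; apply/eqP; rewrite eqEsubset.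
by rewrite !arcs_chord // => i j; rewrite e.
Qed.

Lemma facet_quad S p : facet S -> nonboundary_in S p ->
  exists a c b d, p = arc_of a b /\ quad (chord S) a c b d.
Proof.
move=> /facetP[aS tE] [pS nb].
have [i [j [im jm ij ep]]] := (is_arc_pos p).1 (aS _ pS).
have Eij : chord S i j by apply/chordP; rewrite -ep.
have nc : ~ consecutive m i j by move=> h; apply: nb; rewrite ep; apply/(boundary_arcE im jm ij).
have [c [d Q]] : exists c d, quad (chord S) i c j d.
  apply: (tri_quad tE Eij (succ_leaf_lt im) (succ_leaf_lt jm)).
    by move: nc; rewrite /consecutive /succ_mod /cyc; move: im jm ij; clear; do 2 case: ifP; lia.
  by move: nc; rewrite /consecutive /succ_mod /cyc; move: im jm ij; clear; do 2 case: ifP; lia.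
by exists i, c, j, d.
Qed.

Lemma quad_lt S a c b d : quad (chord S) a c b d -> [/\ a < m, b < m, c < m & d < m].
Proof. by case=> _ _ /chordP[? ? _ _] /chordP[_ ? _ _] _ _ /chordP[? _ _ _]. Qed.

Lemma quad_nonboundary S a c b d : quad (chord S) a c b d -> nonboundary_in S (arc_of a b).
Proof.
move=> Q; have [am bm cm dm] := quad_lt Q; case: (Q) => acb bda /chordP[_ _ ab abS] _ _ _ _.
split=> // /(boundary_arcE am bm ab).
move: acb bda am bm cm dm; clear; rewrite /consecutive /succ_mod /cyc; do 2 case: ifP; lia.
Qed.

Definition flip_at S a c b d := arc_of c d |: (S :\ arc_of a b).

Lemma chord_exchange S a b e f i j : a < m -> b < m -> e < m -> f < m -> e != f ->
  chord (arc_of e f |: (S :\ arc_of a b)) i j = same i j e f || chord S i j && ~~ same i j a b.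
Proof.
move=> am bm em fm ef; rewrite /chord in_setU1 in_setD1.
case: (boolP (i < m)) => im /=; last first.
  rewrite orbF; apply/esym/negbTE; apply: contraNN im.
  by case/orP=> /andP[/eqP->].
case: (boolP (j < m)) => jm /=; last first.
  rewrite orbF; apply/esym/negbTE; apply: contraNN jm.
  by case/orP=> /andP[_ /eqP->].
case: (boolP (i == j)) => ij /=.
  rewrite orbF; apply/esym/negbTE; apply: contraTN ij.
  by case/orP=> /andP[/eqP-> /eqP->]; rewrite // eq_sym.
by rewrite !arc_of_eq // andbC.
Qed.

Lemma chord_flip S a c b d : quad (chord S) a c b d ->
  chord (flip_at S a c b d) =2 flip_rel (chord S) a c b d.
Proof.
move=> Q i j; have [am bm cm dm] := quad_lt Q; have [ab _ _ [_ _ cd]] := quad_neq Q.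
exact: chord_exchange.
Qed.

Lemma flip_at_facet S a c b d : facet S -> quad (chord S) a c b d ->
  facet (flip_at S a c b d).
Proof.
move=> /facetP[aS tE] Q; apply/facetP; split.
  move=> p; rewrite in_setU1 in_setD1 => /orP[/eqP->|/andP[_]]; last exact: aS.
  have [am bm cm dm] := quad_lt Q; have [ab _ _ [_ _ cd]] := quad_neq Q.
  by apply/is_arc_pos; exists c, d.
apply: triangulation_ext (flip_triangulation tE Q) => i j; by rewrite chord_flip.
Qed.

Lemma flip_at_new S a c b d : facet S -> quad (chord S) a c b d -> arc_of c d \notin S.
Proof.
move=> /facetP[aS tE] Q; have := quad_diag_new tE Q.
have [am bm cm dm] := quad_lt Q; have [ab _ _ [_ _ cd]] := quad_neq Q.
by rewrite /chord cm dm cd.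
Qed.

Lemma flip_at_quad S a c b d : quad (chord S) a c b d ->
  quad (chord (flip_at S a c b d)) c b d a.
Proof.
move=> Q; apply: quad_ext (flip_quad Q) => i j; by rewrite chord_flip.
Qed.

Lemma flip_atP S a c b d : facet S -> quad (chord S) a c b d ->
  flip S (arc_of a b) (arc_of c d) (flip_at S a c b d).
Proof.
move=> fS Q; split=> //.
- exact: flip_at_facet.
- exact: quad_nonboundary Q.
- exact: flip_at_new Q.
Qed.

Lemma flip_arc_unique S a c b d p S' : quad (chord S) a c b d -> flip S (arc_of a b) p S' ->
  p = arc_of c d /\ S' = flip_at S a c b d.
Proof.
move=> Q [fS fS' nb pS eS'].
suff e : p = arc_of c d by rewrite eS' e.
have [am bm cm dm] := quad_lt Q; have [ab _ _ [_ _ cd]] := quad_neq Q.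
move/facetP: fS => [aS tE]; move/facetP: fS' => [aS' tE'].
have pS' : p \in S' by rewrite eS' setU11.
have [e [f [em fm ef ep]]] := (is_arc_pos p).1 (aS' _ pS').
rewrite ep; apply/eqP; rewrite arc_of_eq //; apply: (flip_unique tE tE' Q); last first.
  by rewrite /chord em fm ef -ep.
by move=> i j; rewrite eS' ep chord_exchange.
Qed.

Lemma flip_at_back S a c b d : facet S -> quad (chord S) a c b d ->
  flip_at (flip_at S a c b d) c b d a = S.
Proof.
move=> fS Q; have nS := flip_at_new fS Q.
have [_ _ /chordP[_ _ _ abS] _ _ _ _] := Q.
apply/setP=> p; rewrite !(in_setU1, in_setD1) (arc_ofC b a).
case: (eqVneq p (arc_of a b)) => [->|n1] /=; first by rewrite abS.
by case: (eqVneq p (arc_of c d)) => [->|n2] //=; rewrite (negbTE nS).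
Qed.

(* Flips towards the fan at leaf 0 connect all facets. *)
Lemma facets_connected (P : {set {set T}} -> Prop) S0 S :
  (forall S a c b d, facet S -> quad (chord S) a c b d -> P S -> P (flip_at S a c b d)) ->
  facet S0 -> facet S -> P S0 -> P S.
Proof.
move=> step f0 fS P0.
(* The number of chords at leaf 0: the flip given by [fan_step] adds the chord from 0 to d and
   removes a chord not ending at 0. *)
pose deg S := \sum_(x < m) (chord S 0 x : nat).
have degm S' : deg S' <= m.
  rewrite -[X in _ <= X]card_ord -sum1_card; apply: leq_sum => x _; exact: leq_b1.
have deg_flip S' c d b : facet S' -> quad (chord S') c d b 0 -> deg S' < deg (flip_at S' c d b 0).
  move=> /facetP[_ tE] Q; have [cm bm dm m0] := quad_lt Q.
  have [cb cd c0 [bd b0 d0]] := quad_neq Q.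
  rewrite /deg (bigD1 (Ordinal dm)) //= [X in _ < X](bigD1 (Ordinal dm)) //=.
  rewrite !chord_flip // [X in X + _ < _](_ : _ = 0); last first.
    by rewrite (tri_sym tE) (negbTE (quad_diag_new tE Q)).
  rewrite [X in _ < X + _](_ : _ = 1); last by rewrite /flip_rel /same !eqxx orbT.
  rewrite add0n add1n ltnS; apply: leq_sum => x xd; rewrite chord_flip // /flip_rel.
  have /negbTE -> : ~~ same 0 x c b.
    by rewrite /same ![0 == _]eq_sym (negbTE c0) (negbTE b0).
  by case: (chord S' 0 x); rewrite ?orbT.
(* Flips can be undone, so [P] passes in both directions along the way to the fan; the ways from
   [S0] and from [S] are joined there. *)
have toF S' : facet S' ->
    exists F, [/\ facet F, forall k, 0 < k < m -> chord F 0 k & P F <-> P S'].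
  have [N] := ubnP (m - deg S'); elim: N S' => // N IH S' lt fS'.
  have [aS tE] := (facetP S').1 fS'.
  have [full|[c [d [b Q]]]] := fan_step tE nleaves_gt1; first by exists S'.
  have Q' := flip_at_quad Q; have fS'' := flip_at_facet fS' Q.
  have lt' : m - deg (flip_at S' c d b 0) < N.
    by have := deg_flip _ _ _ _ fS' Q; have := degm (flip_at S' c d b 0); move: lt; clear; lia.
  have [F [fF full PF]] := IH _ lt' fS''; exists F; split=> //; rewrite PF; split; last exact: step.
  by rewrite -{2}(flip_at_back fS' Q); exact: step.
have [F0 [fF0 full0 PF0]] := toF _ f0; have [F [fF full PF]] := toF _ fS.
have e : F0 = F.
  have [[_ tF0] [_ tF]] := ((facetP F0).1 fF0, (facetP F).1 fF).
  apply: facet_eq => // i j; apply/idP/idP.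
    exact: (fan_unique tF0 tF full0 full).
  exact: (fan_unique tF tF0 full full0).
by apply/PF; rewrite -e; apply/PF0.
Qed.

End Bridge.

(** * Seeds of facets *)

Section Seeds.
Local Open Scope ring_scope.
Implicit Types S : {set {set T}}.

(* In row ab of the exchange matrix, where acbd is the quadrilateral with diagonal ab; arrows
   run counterclockwise around the triangles acb and bda. *)
Definition brow (a c b d : nat) (A : {set T}) : int :=
  (A == arc_of a c)%:Z + (A == arc_of b d)%:Z - (A == arc_of c b)%:Z - (A == arc_of d a)%:Z.

Lemma edge_ends (u v : T) : adj u v -> forall u' v', [set u; v] = [set u'; v'] ->
  (u' = u /\ v' = v) \/ (u' = v /\ v' = u).
Proof.
move=> uv u' v' e; have ne := adj_neq uv.
have : u' \in [set u; v] by rewrite e !inE eqxx.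
have : v' \in [set u; v] by rewrite e !inE eqxx orbT.
have : u \in [set u'; v'] by rewrite -e !inE eqxx.
have : v \in [set u'; v'] by rewrite -e !inE eqxx orbT.
rewrite !inE => /orP[] /eqP e1 /orP[] /eqP e2 /orP[] /eqP e3 /orP[] /eqP e4; subst; auto;
  by rewrite ?eqxx in ne.
Qed.

(* The leaves on one of the two sides of e; the choice does not matter since [shear] is
   invariant under complementation. *)
Definition eside (e : N) (i : nat) : bool :=
  if [pick d : T * T | adj d.1 d.2 && (val e == [set d.1; d.2])] is Some d
  then sd d.1 d.2 i else false.

Lemma interior_edgeP (e : N) : exists u v : T, [/\ adj u v, ~~ leaf u, ~~ leaf v & val e = [set u; v]].
Proof.
have /existsP[u /existsP[v /and4P[uv lu lv /eqP ee]]] := valP e.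
by exists u, v.
Qed.

Lemma esideP (e : N) : exists u v : T, [/\ adj u v, ~~ leaf u, ~~ leaf v, val e = [set u; v] &
  forall i, eside e i = sd u v i].
Proof.
have [u [v [uv lu lv ee]]] := interior_edgeP e; rewrite /eside.
case: pickP => [[u' v'] /= /andP[uv' /eqP e']|/(_ (u, v))]; last by rewrite /= uv ee eqxx.
exists u', v'; split=> //.
  by case: (edge_ends uv (etrans (esym ee) e')) => -[-> _].
by case: (edge_ends uv (etrans (esym ee) e')) => -[_ ->].
Qed.

Definition crow (a c b d : nat) (e : N) : int :=
  shear (eside e a) (eside e c) (eside e b) (eside e d).

Lemma crowE a c b d (e : N) u v : adj u v -> val e = [set u; v] ->
  crow a c b d e = shear (sd u v a) (sd u v c) (sd u v b) (sd u v d).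
Proof.
move=> uv ee; have [u' [v' [uv' _ _ ee' es]]] := esideP e; rewrite /crow !es.
case: (edge_ends uv (etrans (esym ee) ee')) => -[-> ->] //.
by rewrite !(sdC _ uv) shearC.
Qed.

(** Nonfrozen vertices are indexed by the interior edges merely as a set of the right size; [beta]
    says which arc each one stands for. Rows are required for both presentations of a quadrilateral,
    which agree by [brow_swap] and [crow_swap]. *)
Record seed S (beta : N -> {set T}) (R : quiver (N + N)) : Prop := Seed {
  seed_ice : ice_quiver R;
  seed_inj : injective beta;
  seed_nb : forall p, nonboundary_in S p <-> exists k, beta k = p;
  seed_b : forall k a c b d, quad (chord S) a c b d -> beta k = arc_of a b ->
    forall j, exchange_matrix R k (inl j) = brow a c b d (beta j);
  seed_c : forall k a c b d, quad (chord S) a c b d -> beta k = arc_of a b ->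
    forall e, exchange_matrix R k (inr e) = crow a c b d e }.

Lemma seed_quad S beta R k : facet S -> seed S beta R ->
  exists a c b d, beta k = arc_of a b /\ quad (chord S) a c b d.
Proof.
move=> fS sd; apply: facet_quad => //; apply/(seed_nb sd); by exists k.
Qed.

Lemma brow_swap a c b d A : brow a c b d A = brow b d a c A.
Proof. by rewrite /brow; lia. Qed.

Lemma brow_neg a c b d A : brow c b d a A = - brow a c b d A.
Proof. by rewrite /brow; lia. Qed.

Lemma crow_swap a c b d e : crow a c b d e = crow b d a c e.
Proof. exact: shear_swap. Qed.

Lemma crow_neg a c b d e : crow c b d a e = - crow a c b d e.
Proof. exact: shear_neg. Qed.

Definition exchange_arc (beta : N -> {set T}) k (A : {set T}) : N -> {set T} :=
  fun j => if j == k then A else beta j.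

Lemma brow0 a c b d A : A != arc_of a c -> A != arc_of c b -> A != arc_of b d ->
  A != arc_of d a -> brow a c b d A = 0.
Proof. by rewrite /brow => /negbTE-> /negbTE-> /negbTE-> /negbTE->. Qed.

Lemma eside_noncross (e : N) a c b d : cyc a c b -> cyc b d a ->
  (a < m)%N -> (b < m)%N -> (c < m)%N -> (d < m)%N ->
  ~~ alternate (eside e a) (eside e c) (eside e b) (eside e d).
Proof.
move=> acb bda am bm cm dm; have [u [v [uv _ _ _ es]]] := esideP e; rewrite !es.
apply/negP => /and3P[/eqP h1 /eqP h2 /eqP h3].
exact: (sd_noncross uv am bm cm dm acb bda).
Qed.

Definition mrow (beta : N -> {set T}) (a c b d : nat) (v : N + N) : int :=
  match v with inl j => brow a c b d (beta j) | inr e => crow a c b d e end.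

Lemma seed_row S beta R k a c b d (v : N + N) : seed S beta R -> quad (chord S) a c b d ->
  beta k = arc_of a b -> exchange_matrix R k v = mrow beta a c b d v.
Proof. by case: v => [j|e] sR Q ek; [exact: (seed_b sR)|exact: (seed_c sR)]. Qed.

Lemma mrow_swap beta a c b d (v : N + N) : mrow beta a c b d v = mrow beta b d a c v.
Proof. by case: v => [j|e] /=; [exact: brow_swap|exact: crow_swap]. Qed.

Section Mutation.
Variables (S : {set {set T}}) (beta : N -> {set T}) (R : quiver (N + N)).
Hypotheses (fS : facet S) (sR : seed S beta R).

Lemma seed_mem j : beta j \in S.
Proof. by have [] := (seed_nb sR (beta j)).2 (ex_intro _ j erefl). Qed.

Lemma chord_arc_eq i j k l : chord S i j -> chord S k l ->
  (arc_of i j == arc_of k l) = same i j k l.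
Proof. by case/chordP=> im jm ij _ /chordP[km lm kl _]; exact: arc_of_eq. Qed.

(** In the quadrilateral axcb of the side ac, the flip replaces the apex b by d. The arc ab is its
    side ba, so the entry at k is - 1; the side ba disappears and cd takes part instead. *)
Lemma mutate_side_ac k i a c b d x (v : N + N) : quad (chord S) a c b d -> quad (chord S) a x c b ->
  beta k = arc_of a b -> beta i = arc_of a c -> i != k ->
  mutate_matrix k (exchange_matrix R) i v = mrow (exchange_arc beta k (arc_of c d)) a x c d v.
Proof.
move=> Q Q2 ek ei ik; have newcd := flip_at_new fS Q.
have [am bm cm dm] := quad_lt Q; have [_ _ xm _] := quad_lt Q2.
have [ab ac ad [bc bd cd]] := quad_neq Q.
have [_ ax _ [cx _ xb]] := quad_neq Q2.
have [acb bda Eab Eac Ecb Ebd Eda] := Q; have [axc cba _ Eax Exc _ Eba] := Q2.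
have xd : x != d by move: bda acb axc; clear; rewrite /cyc; lia.
have bik : exchange_matrix R i (inl k) = - 1.
  rewrite (seed_row _ sR Q2 ei) /= /brow ek !chord_arc_eq // /same !eqxx.
  by rewrite (negbTE ab) (negbTE ac) (eq_sym b x) (negbTE xb) (eq_sym b a) (negbTE ab) (negbTE bc) (negbTE ax).
have row := seed_row v sR Q2 ei; have rowk := seed_row v sR Q ek.
rewrite /mutate_matrix (negbTE ik) /=.
case: (eqVneq v (inl k)) => [->|vk].
  rewrite bik opprK /= /exchange_arc eqxx /brow !arc_of_eq // /same !eqxx.
  by rewrite (eq_sym c a) (negbTE ac) (negbTE cx) (negbTE cd) (eq_sym d x) (negbTE xd) (eq_sym d a) (negbTE ad).
rewrite bik row rowk; case: v vk {row rowk} => [j|e] vk /=.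
  have jk : j != k by apply: contraNneq vk => ->.
  have n1 : (beta j == arc_of b a) = false.
    apply: contraNF jk => /eqP e; apply/eqP/(seed_inj sR); rewrite e ek; exact: arc_ofC.
  have n2 : (beta j == arc_of c d) = false.
    by apply: contraNF newcd => /eqP <-; exact: seed_mem.
  have excl X Y : (X == Y) = false -> ~~ ((beta j == X) && (beta j == Y)).
    by move=> XY; apply/negP => /andP[/eqP -> /eqP e]; rewrite e eqxx in XY.
  rewrite /exchange_arc (negbTE jk) /brow n1 n2 subr0 addr0.
  apply: mut_side_ac; apply: excl; rewrite chord_arc_eq // /same;
    move: ab ac ad bc bd cd; clear; lia.
apply: shear_side_ac; apply: eside_noncross => //; move: acb bda axc; clear; rewrite /cyc; lia.
Qed.

Lemma mutate_side_cb k i a c b d x (v : N + N) : quad (chord S) a c b d -> quad (chord S) c x b a ->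
  beta k = arc_of a b -> beta i = arc_of c b -> i != k ->
  mutate_matrix k (exchange_matrix R) i v = mrow (exchange_arc beta k (arc_of c d)) c x b d v.
Proof.
move=> Q Q2 ek ei ik; have newcd := flip_at_new fS Q.
have [am bm cm dm] := quad_lt Q; have [_ _ xm _] := quad_lt Q2.
have [ab ac ad [bc bd cd]] := quad_neq Q.
have [_ cx _ [bx _ xa]] := quad_neq Q2.
have [acb bda Eab Eac Ecb Ebd Eda] := Q; have [cxb bac _ Ecx Exb Eba _] := Q2.
have xd : x != d by move: bda acb cxb; clear; rewrite /cyc; lia.
have bik : exchange_matrix R i (inl k) = 1.
  rewrite (seed_row _ sR Q2 ei) /= /brow ek !chord_arc_eq // /same !eqxx.
  by rewrite (negbTE ab) (negbTE ac) (eq_sym a x) (negbTE xa) (negbTE bc) (negbTE bx) /= ?andbF.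
have row := seed_row v sR Q2 ei; have rowk := seed_row v sR Q ek.
rewrite /mutate_matrix (negbTE ik) /=.
case: (eqVneq v (inl k)) => [->|vk].
  rewrite bik /= /exchange_arc eqxx /brow !arc_of_eq // /same !eqxx.
  by rewrite (eq_sym c b) (negbTE bc) (negbTE cx) (negbTE cd) (eq_sym d x) (negbTE xd) (eq_sym d b) (negbTE bd).
rewrite bik row rowk; case: v vk {row rowk} => [j|e] vk /=.
  have jk : j != k by apply: contraNneq vk => ->.
  have n1 : (beta j == arc_of b a) = false.
    apply: contraNF jk => /eqP e; apply/eqP/(seed_inj sR); rewrite e ek; exact: arc_ofC.
  have n2 : (beta j == arc_of d c) = false.
    apply: contraNF newcd => /eqP e; rewrite (arc_ofC c d) -e; exact: seed_mem.
  have excl X Y : (X == Y) = false -> ~~ ((beta j == X) && (beta j == Y)).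
    by move=> XY; apply/negP => /andP[/eqP -> /eqP e]; rewrite e eqxx in XY.
  rewrite /exchange_arc (negbTE jk) /brow n1 n2 subr0 addr0.
  apply: mut_side_cb; apply: excl; rewrite chord_arc_eq // /same;
    move: ab ac ad bc bd cd; clear; lia.
apply: shear_side_cb; apply: eside_noncross => //; move: acb bda cxb; clear; rewrite /cyc; lia.
Qed.

(** The arc pp' keeps its quadrilateral, and its entry at k is zero, so mutation does not change its
    row. *)
Lemma mutate_far k i a c b d p x p' y (v : N + N) : quad (chord S) a c b d -> quad (chord S) p x p' y ->
  [/\ ~~ same p x a b, ~~ same x p' a b, ~~ same p' y a b & ~~ same y p a b] ->
  [/\ ~~ same p x c d, ~~ same x p' c d, ~~ same p' y c d & ~~ same y p c d] ->
  beta k = arc_of a b -> beta i = arc_of p p' -> i != k ->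
  mutate_matrix k (exchange_matrix R) i v = mrow (exchange_arc beta k (arc_of c d)) p x p' y v.
Proof.
move=> Q Q2 [s1 s2 s3 s4] [t1 t2 t3 t4] ek ei ik.
have [am bm cm dm] := quad_lt Q; have [pm pm' xm ym] := quad_lt Q2.
have [_ _ Eab _ _ _ _] := Q; have [_ _ _ Epx Exp Epy Eyp] := Q2.
have [_ px py [px' py' _]] := quad_neq Q2.
have bik : exchange_matrix R i (inl k) = 0.
  by rewrite (seed_row _ sR Q2 ei) /= ek brow0 // eq_sym chord_arc_eq.
have row := seed_row v sR Q2 ei; have rowk := seed_row v sR Q ek.
rewrite /mutate_matrix (negbTE ik) /=.
case: (eqVneq v (inl k)) => [->|vk].
  rewrite bik oppr0 /= /exchange_arc eqxx brow0 // eq_sym arc_of_eq // eq_sym //.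
rewrite bik mut_none row; case: v vk {row rowk} => [j|e] vk //=.
by rewrite /exchange_arc; case: (eqVneq j k) vk => // ->; rewrite eqxx.
Qed.

(** Row k is negated, as is the row of acbd when it is rotated to cbda. The other rows are reduced
    by [quad_flip_ind] to the two kinds of sides and the unaffected arcs. *)
Lemma seed_mutation k a c b d R' : quad (chord S) a c b d -> beta k = arc_of a b ->
  mutation k R R' -> seed (flip_at S a c b d) (exchange_arc beta k (arc_of c d)) R'.
Proof.
move=> Q ek [ice mu]; have newcd := flip_at_new fS Q.
have [_ tE] := (facetP S).1 fS.
have Q1 := flip_at_quad Q.
have rows i p x p' y (v : N + N) : quad (chord (flip_at S a c b d)) p x p' y ->
    exchange_arc beta k (arc_of c d) i = arc_of p p' ->
    exchange_matrix R' i v = mrow (exchange_arc beta k (arc_of c d)) p x p' y v.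
  move=> Q' ei; rewrite mu; move: ei; rewrite {1}/exchange_arc.
  have fS' := flip_at_facet fS Q.
  have [_ tE'] := (facetP _).1 fS'.
  have Q'' := quad_ext (chord_flip Q) Q'.
  case: (eqVneq i k) => [ik ei|ik ei].
    have neg : mutate_matrix k (exchange_matrix R) i v = mrow (exchange_arc beta k (arc_of c d)) c b d a v.
      rewrite /mutate_matrix ik eqxx /= (seed_row v sR Q ek).
      case: v => [j|e] /=; last by rewrite [RHS]crow_neg.
      rewrite [RHS]brow_neg /exchange_arc; case: (eqVneq j k) => [->|//].
      have [_ _ Eab Eac Ecb Ebd Eda] := Q; have [ab ac ad [bc bd cd]] := quad_neq Q.
      have [am bm cm dm] := quad_lt Q.
      congr (- _); rewrite ek !brow0 //; rewrite arc_of_eq // /same;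
        move: ab ac ad bc bd cd; clear; lia.
    rewrite neg; have [cm dm _ _] := quad_lt Q1; have [cd _ _ _] := quad_neq Q1.
    have [pm pm' _ _] := quad_lt Q'.
    have : same c d p p' by rewrite -arc_of_eq // ei.
    case/orP=> /andP[/eqP ep /eqP ep']; subst p p'.
      by have [-> ->] := quad_uniq tE' Q1 Q'.
    rewrite [RHS]mrow_swap; by have [-> ->] := quad_uniq tE' Q1 (quad_swap tE' Q').
  have npp : ~~ same p p' c d.
    have [pm pm' _ _] := quad_lt Q'; have [am bm cm dm] := quad_lt Q.
    have [pp _ _ _] := quad_neq Q'.
    rewrite -arc_of_eq // -ei; apply: contraNneq newcd => <-; exact: seed_mem.
  move: Q Q'' npp ek ei => {Q' Q1 fS' tE' newcd}.
  pose G a c b d p x p' y := beta k = arc_of a b -> beta i = arc_of p p' ->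
    mutate_matrix k (exchange_matrix R) i v = mrow (exchange_arc beta k (arc_of c d)) p x p' y v.
  move: a c b d p x p' y; apply: (quad_flip_ind (G := G) tE); rewrite /G {G}.
  - move=> a c b d p x p' y h e1 e2; rewrite mrow_swap; apply: h => //; by rewrite e2 arc_ofC.
  - move=> a c b d p x p' y h e1 e2; rewrite (arc_ofC c); apply: h => //; by rewrite e1 arc_ofC.
  - move=> a c b d p x p' y Q Q2 _ _ s t ek ei; exact: (mutate_far _ Q Q2 s t ek ei ik).
  - move=> a c b d x Q Q2 ek ei; exact: (mutate_side_ac _ Q Q2 ek ei ik).
  - move=> a c b d x Q Q2 ek ei; exact: (mutate_side_cb _ Q Q2 ek ei ik).
split=> //.
- move=> i j; rewrite /exchange_arc; case: (eqVneq i k) => [->|ik]; case: (eqVneq j k) => [->|jk] //.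
  + by move=> e; move: newcd; rewrite e seed_mem.
  + by move=> e; move: newcd; rewrite -e seed_mem.
  + exact: (seed_inj sR).
- move=> p; split.
    case; rewrite in_setU1 in_setD1 => /orP[/eqP->|/andP[pab pS]] nb.
      by exists k; rewrite /exchange_arc eqxx.
    have [j ej] := (seed_nb sR p).1 (conj pS nb); exists j; rewrite /exchange_arc -ej.
    by case: (eqVneq j k) => // jk; rewrite -ej jk ek eqxx in pab.
  case=> j <-; rewrite /exchange_arc; case: (eqVneq j k) => jk.
    exact: quad_nonboundary Q1.
  have [jS nb] := (seed_nb sR (beta j)).2 (ex_intro _ j erefl); split=> //.
  rewrite in_setU1 in_setD1 jS andbT -ek; apply/orP; right.
  by apply: contra_neq jk => /(seed_inj sR).
- by move=> i p x p' y Q' ei j; exact: (rows i p x p' y (inl j)).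
- by move=> i p x p' y Q' ei e; exact: (rows i p x p' y (inr e)).
Qed.

End Mutation.

End Seeds.

(** * The initial facet *)

Section Initial.
Implicit Types u v w : T.
Implicit Types S : {set {set T}}.

(* The arc obtained from the edge uv by turning right at every vertex, in both directions. *)
Definition edge_arc u v := arc_of (fs v u) (fs u v).

Lemma edge_arcC u v : edge_arc u v = edge_arc v u.
Proof. exact: arc_ofC. Qed.

Definition initial_facet : {set {set T}} := [set edge_arc d.1 d.2 | d : T * T & adj d.1 d.2].

Lemma initial_facetP p :
  reflect (exists u v, adj u v /\ p = edge_arc u v) (p \in initial_facet).
Proof.
apply: (iffP imsetP) => [[[u v]]|[u [v [uv ->]]]].
  by rewrite inE => uv ->; exists u, v.
by exists (u, v); rewrite ?inE.
Qed.

Lemma fs_neqm u v : adj u v -> fs u v != fs v u.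
Proof. by move=> uv; apply/eqP; exact: fs_neq. Qed.

Lemma chord_edge u v : adj u v -> chord initial_facet (fs v u) (fs u v).
Proof.
move=> uv; have vu : adj v u by rewrite adj_sym.
apply/chordP; rewrite !fs_lt // fs_neqm //; split=> //.
by apply/initial_facetP; exists u, v.
Qed.

Lemma chord_initialP i j : chord initial_facet i j ->
  exists u v, [/\ adj u v, i = fs v u & j = fs u v].
Proof.
case/chordP=> im jm ij /initial_facetP[u [v [uv]]]; have vu : adj v u by rewrite adj_sym.
case/(arc_of_inj im jm (fs_lt vu) (fs_lt uv) ij) => -[-> ->].
  by exists u, v.
by exists v, u.
Qed.

(** The arcs of the three edges at v bound a triangle whose vertices are the labels of the three
    faces around v. *)
Lemma initial_triangle u v : adj u v -> ~~ leaf v ->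
  let c := fs v (ccw v (ccw v u)) in
  [/\ cyc (fs u v) c (fs v u), chord initial_facet (fs u v) c & chord initial_facet c (fs v u)].
Proof.
move=> uv iv; have vu : adj v u by rewrite adj_sym.
have v1 := ccw_adj vu; have v2 := ccw_adj v1.
have w1 : adj (ccw v u) v by rewrite adj_sym.
have w2 : adj (ccw v (ccw v u)) v by rewrite adj_sym.
have e1 : fs u v = fs v (ccw v u) by exact: fs_int.
have e2 : fs (ccw v u) v = fs v (ccw v (ccw v u)) by exact: fs_int.
have e3 : fs (ccw v (ccw v u)) v = fs v u by rewrite fs_int // ccw_third.
rewrite /=; split; last first.
- by rewrite -e3; exact: chord_edge w2.
- by rewrite e1 -e2; exact: chord_edge w1.
have ne1 := fs_neqm v1; have ne2 := fs_neqm v2; rewrite e2 in ne1; rewrite e3 in ne2.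
have ne3 := fs_neqm vu; rewrite e1 in ne3.
have n : fs v (ccw v u) != fs v (ccw v (ccw v u)) by [].
have h : ~~ sd v (ccw v u) (fs v u).
  apply/negP => s; have := sd_fs vu => s'.
  by have := ccw_neq iv vu; rewrite (sd_side_uniq v1 vu s s') eqxx.
move: h; rewrite sdE ?fs_lt // e2 e1.
by move: ne1 ne2 ne3; clear; rewrite /arc_co /cyc; case: ifP; lia.
Qed.

(** Crossing arcs of two edges would give incompatible splits. For maximality, follow face i from
    leaf i towards j, turning left at every vertex: if j lay in the right branch beyond its first
    leaf or in neither position allowed by the walk, the chord ij would cross the arc of the edge to
    that branch. *)
Lemma initial_facet_facet : facet initial_facet.
Proof.
apply/facetP; split.
  move=> p /initial_facetP[u [v [uv ->]]]; have vu : adj v u by rewrite adj_sym.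
  by apply/is_arc_pos; exists (fs v u), (fs u v); rewrite !fs_lt // fs_neqm.
split.
- by move=> i j; apply/chordP/chordP => -[h1 h2 h3 h4]; split; rewrite // 1?eq_sym // arc_ofC.
- by move=> i j /chordP[].
- move=> i j k l /chord_initialP[u [v [uv -> ->]]] /chord_initialP[x [y [xy -> ->]]].
  apply/negP => cr; apply: (splits_compatible uv xy) => b1 b2.
  have vu : adj v u by rewrite adj_sym.
  have yx : adj y x by rewrite adj_sym.
  have neuv := fs_neqm uv; have nexy := fs_neqm xy.
  have [a am [h1 h2]] : exists2 a, a < m & arc_co (fs u v) (fs v u) a = b1 /\ arc_co (fs x y) (fs y x) a = b2.
    rewrite crossedC crossedCr in cr; have [a ain h] := crossed_arcs_co b1 b2 neuv nexy cr.
    by exists a => //; move: ain; rewrite !inE => /or4P[] /eqP->; exact: fs_lt.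
  by exists (lf a); rewrite -!/(sd _ _ _) !sdE.
move=> i j im jm ij nc.
have [n ln] := lf_nbr im.
have nl : adj n (lf i) by rewrite adj_sym.
suff main u v : adj u v -> sd u v j -> fs v u = i -> chord initial_facet i j.
  apply: (main (lf i) n) => //; last exact: fs_to_leaf.
  by rewrite (sdC j nl) /sd (side_leaf nl) ?lf_leaf // in_set1 lf_neq // eq_sym.
move: u v; apply: side_rect => // [u v uv lv sj <-|u v uv iv IH1 IH2 sj ei].
  have -> : j = fs u v.
    rewrite fs_leaf //; move: sj; rewrite /sd side_leaf // in_set1 => /eqP <-.
    by rewrite lfK.
  exact: chord_edge.
have vu : adj v u by rewrite adj_sym.
have v1 := ccw_adj vu; have v2 := ccw_adj v1.
have w1 : adj (ccw v u) v by rewrite adj_sym.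
have e1 : fs u v = fs v (ccw v u) by exact: fs_int.
case: (eqVneq j (fs u v)) => [->|jf]; first by rewrite -ei; exact: chord_edge.
have [cyc3 _ _] := initial_triangle uv iv.
have : lf j \in side u v by [].
have jv : lf j != v by apply: contraNneq iv => <-; exact: lf_leaf.
rewrite (side_split uv iv) in_setU1 in_setU (negbTE jv) /= => /orP[s1|s2]; last first.
  by apply: IH2 => //; rewrite fs_int ?ccw_third // adj_sym.
have := nc _ _ (chord_edge v1); have := s1; rewrite -/(sd _ _ _) sdE //.
rewrite (fs_int w1 iv) -e1 ei in cyc3 *.
move: cyc3 jf; clear; rewrite /crossed /arc_co /cyc; case: ifP; lia.
Qed.

(** The four leaves lie in the four different branches around the edge uv, in the order a, c at u
    and b, d at v for which the shear coordinate at uv is +1. *)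
Definition branches u v a c b d :=
  [/\ sd u (ccw u v) a, sd u (ccw u (ccw u v)) c, sd v (ccw v u) b & sd v (ccw v (ccw v u)) d].

Lemma sd_child u v w i : adj u v -> adj v w -> w != u -> sd v w i -> sd u v i.
Proof. by move=> uv vw wu; apply: (subsetP (proper_sub (side_child uv vw wu))). Qed.

Lemma branches_sides u v a c b d : adj u v -> ~~ leaf u -> ~~ leaf v -> branches u v a c b d ->
  [/\ sd u v a = false, sd u v c = false, sd u v b & sd u v d].
Proof.
move=> uv iu iv [sa sc sb sd_]; have vu : adj v u by rewrite adj_sym.
have u1 := ccw_adj uv; have u2 := ccw_adj u1; have v1 := ccw_adj vu; have v2 := ccw_adj v1.
have na := sd_child vu u1 (ccw_neq iu uv) sa; have nc := sd_child vu u2 (ccw2_neq iu uv) sc.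
have nb := sd_child uv v1 (ccw_neq iv vu) sb; have nd := sd_child uv v2 (ccw2_neq iv vu) sd_.
rewrite !(sdC _ uv) in na nc; split=> //; exact: negbTE.
Qed.

(** This is the sign coherence of c-vectors: if some edge separates ac from bd, then by
    compatibility of splits none separates ad from bc. *)
Lemma no_crossing_split u v x y a b c d : adj u v -> adj x y ->
  sd u v a = false -> sd u v c = false -> sd u v b -> sd u v d ->
  ~ [/\ sd x y a = sd x y d, sd x y b = sd x y c & sd x y a != sd x y b].
Proof.
move=> uv xy sa sc sb sd_ [ead ebc nab]; apply: (splits_compatible uv xy) => b1 b2.
case: b1; case: (eqVneq b2 (sd x y a)) => e2.
- by exists (lf d); rewrite -!/(sd _ _ _) sd_ -ead.
- exists (lf b); rewrite -!/(sd _ _ _) sb; split=> //.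
  by move: e2 nab; case: b2; do 2 case: sd.
- by exists (lf a); rewrite -!/(sd _ _ _) sa.
- exists (lf c); rewrite -!/(sd _ _ _) sc -ebc; split=> //.
  by move: e2 nab; case: b2; do 2 case: sd.
Qed.

(** Negative entries are excluded by [no_crossing_split], and uv is the only edge separating ac from
    bd, so the c-vector is a unit vector. *)
Lemma crow_branches u v a c b d (e : N) : adj u v -> ~~ leaf u -> ~~ leaf v ->
  branches u v a c b d -> crow a c b d e = (val e == [set u; v])%:Z%R.
Proof.
move=> uv iu iv br; have [sa sc sb sd_] := branches_sides uv iu iv br.
have vu : adj v u by rewrite adj_sym.
have u1 := ccw_adj uv; have u2 := ccw_adj u1; have v1 := ccw_adj vu; have v2 := ccw_adj v1.
have nu : ccw u v != ccw u (ccw u v) by rewrite eq_sym; exact: ccw_neq.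
have nv : ccw v u != ccw v (ccw v u) by rewrite eq_sym; exact: ccw_neq.
case: (eqVneq (val e) [set u; v]) => [ee|ne].
  by rewrite (crowE _ _ _ _ uv ee) sa sc sb sd_.
have [x [y [xy _ _ ee es]]] := esideP e.
have yx : adj y x by rewrite adj_sym.
rewrite /crow !es; have [ba bc bb bd] := br.
have uniq := separating_edge_unique uv u1 u2 v1 v2 _ nu (ccw_neq iu uv) nv ba bc bb bd.
have comp := no_crossing_split uv xy sa sc sb sd_.
have no1 : ~ [/\ sd x y a = false, sd x y c = false, sd x y b & sd x y d].
  case=> h1 h2 h3 h4; have := uniq x y xy; rewrite -!/(sd _ _ _) !(sdC _ xy) h1 h2 h3 h4.
  by move=> /(_ isT isT isT isT)[e1 e2]; rewrite ee e1 e2 eqxx in ne.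
have no2 : ~ [/\ sd x y a, sd x y c, sd x y b = false & sd x y d = false].
  case=> h1 h2 h3 h4; have := uniq y x yx; rewrite -!/(sd _ _ _) !(sdC _ xy) h1 h2 h3 h4.
  by move=> /(_ isT isT isT isT)[e1 e2]; rewrite ee e1 e2 setUC eqxx in ne.
move: comp no1 no2; case: (sd x y a); case: (sd x y b); case: (sd x y c); case: (sd x y d) => //= h1 h2 h3;
  by [case: h1|case: h2|case: h3].
Qed.

Lemma edge_branches u v : adj u v -> ~~ leaf u -> ~~ leaf v ->
  branches u v (fs v u) (fs u (ccw u (ccw u v))) (fs u v) (fs v (ccw v (ccw v u))).
Proof.
move=> uv iu iv; have vu : adj v u by rewrite adj_sym.
have u1 := ccw_adj uv; have u2 := ccw_adj u1; have v1 := ccw_adj vu; have v2 := ccw_adj v1.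
by split; [rewrite (fs_int vu iu)| |rewrite (fs_int uv iv)|]; exact: sd_fs.
Qed.

Lemma edge_quad u v : adj u v -> ~~ leaf u -> ~~ leaf v ->
  quad (chord initial_facet) (fs v u) (fs u (ccw u (ccw u v))) (fs u v) (fs v (ccw v (ccw v u))).
Proof.
move=> uv iu iv; have vu : adj v u by rewrite adj_sym.
have [h1 h2 h3] := initial_triangle uv iv; have [k1 k2 k3] := initial_triangle vu iu.
by split=> //; exact: chord_edge.
Qed.

(** The two ends of the arc determine the split of the leaves by the edge, and uv is the only edge
    with this split. *)
Lemma edge_arc_inj u v x y : adj u v -> ~~ leaf u -> ~~ leaf v -> adj x y ->
  edge_arc u v = edge_arc x y -> [set u; v] = [set x; y].
Proof.
move=> uv iu iv xy e; have vu : adj v u by rewrite adj_sym.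
have yx : adj y x by rewrite adj_sym.
have u1 := ccw_adj uv; have u2 := ccw_adj u1; have v1 := ccw_adj vu; have v2 := ccw_adj v1.
wlog [ex ey] : x y xy yx {e} / fs x y = fs u v /\ fs y x = fs v u.
  move=> W; move: e; have ne : fs v u != fs u v by rewrite fs_neqm.
  case/(arc_of_inj (fs_lt vu) (fs_lt uv) (fs_lt yx) (fs_lt xy) ne) => -[e1 e2].
    exact: W.
  by rewrite setUC [RHS]setUC; rewrite [LHS]setUC; apply: W.
have nu : ccw u v != ccw u (ccw u v) by rewrite eq_sym; exact: ccw_neq.
have nv : ccw v u != ccw v (ccw v u) by rewrite eq_sym; exact: ccw_neq.
have br := edge_branches uv iu iv; have [sa sc sb sd_] := branches_sides uv iu iv br.
have [ba bc bb bd] := br.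
have same i : i < m -> sd x y i = sd u v i by move=> im; rewrite !sdE // ex ey.
have same' i : i < m -> sd y x i = ~~ sd u v i by move=> im; rewrite (sdC _ xy) same.
have := separating_edge_unique uv u1 u2 v1 v2 xy nu (ccw_neq iu uv) nv ba bc bb bd.
rewrite -!/(sd _ _ _) !same' ?same ?fs_lt // sa sc sb sd_.
by move=> /(_ isT isT isT isT)[-> ->].
Qed.

(** The choice of an orientation is harmless since [edge_arc] is symmetric, and the default [set0]
    never occurs for an interior edge. *)
Definition initial_arc (e : N) : {set T} :=
  if [pick d : T * T | adj d.1 d.2 && (val e == [set d.1; d.2])] is Some d
  then edge_arc d.1 d.2 else set0.

Lemma initial_arcE (e : N) u v : adj u v -> val e = [set u; v] -> initial_arc e = edge_arc u v.
Proof.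
move=> uv ee; rewrite /initial_arc.
case: pickP => [[u' v'] /= /andP[uv' /eqP e']|/(_ (u, v))]; last by rewrite /= uv ee eqxx.
by case: (edge_ends uv (etrans (esym ee) e')) => -[-> ->] //; exact: edge_arcC.
Qed.

Lemma initial_arc_eq (e : N) x y : adj x y ->
  (initial_arc e == edge_arc x y) = (val e == [set x; y]).
Proof.
move=> xy; have [u' [v' [uv' iu iv ee]]] := interior_edgeP e.
apply/eqP/eqP => [|ex]; last exact: initial_arcE.
by rewrite (initial_arcE uv' ee) ee; exact: edge_arc_inj.
Qed.

End Initial.

(** * The framed quiver on the initial facet *)

Section InitialSeed.
Implicit Types u v w : T.
Implicit Types S : {set {set T}}.

Lemma edge_set_eq u v w : adj u v -> [set u; v] = [set u; w] -> v = w.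
Proof.
move=> uv e; have : v \in [set u; w] by rewrite -e !inE eqxx orbT.
by rewrite !inE eq_sym (negbTE (adj_neq uv)) => /eqP.
Qed.

Lemma edge_set_neq u v w w' : adj u v -> v != w -> [set u; w] != [set v; w'].
Proof.
move=> uv vw; apply/eqP => e; have : v \in [set u; w] by rewrite e !inE eqxx.
by rewrite !inE eq_sym (negbTE (adj_neq uv)) (negbTE vw).
Qed.

Lemma tree_quiver_out (e1 e2 : N) u v : adj u v -> val e1 = [set u; v] ->
  tree_quiver e1 e2 = (val e2 == [set u; ccw u v]) || (val e2 == [set v; ccw v u]) :> nat.
Proof.
move=> uv e; congr nat_of_bool; apply/existsP/orP.
  case=> v' /existsP[w' /and3P[_ /eqP e' /eqP->]].
  by case: (edge_ends uv (etrans (esym e) e')) => -[-> ->]; [left|right].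
case=> /eqP ->; [exists u|exists v]; apply/existsP; [exists v|exists u]; rewrite e eqxx ?uv //.
  by rewrite eqxx.
by rewrite adj_sym uv setUC !eqxx.
Qed.

Lemma tree_quiver_in (e1 e2 : N) u v : adj u v -> ~~ leaf u -> ~~ leaf v -> val e1 = [set u; v] ->
  tree_quiver e2 e1 =
    (val e2 == [set u; ccw u (ccw u v)]) || (val e2 == [set v; ccw v (ccw v u)]) :> nat.
Proof.
move=> uv iu iv e; have vu : adj v u by rewrite adj_sym.
congr nat_of_bool; apply/existsP/orP.
  case=> v' /existsP[w' /and3P[vw' /eqP-> /eqP e']].
  case: (edge_ends uv (etrans (esym e) e')) => -[e1' e2']; [left|right]; subst v';
    by rewrite -e2' ccw_third.
case=> /eqP ->; [exists u|exists v]; apply/existsP;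
  [exists (ccw u (ccw u v))|exists (ccw v (ccw v u))].
  by rewrite !ccw_adj // ccw_third // e !eqxx.
by rewrite !ccw_adj // ccw_third // e eqxx setUC eqxx.
Qed.

Lemma edge_arc_turn u v : adj u v -> ~~ leaf v ->
  edge_arc v (ccw v u) = arc_of (fs u v) (fs v (ccw v (ccw v u))) /\
  edge_arc v (ccw v (ccw v u)) = arc_of (fs v (ccw v (ccw v u))) (fs v u).
Proof.
move=> uv iv; have vu : adj v u by rewrite adj_sym.
have v1 := ccw_adj vu; have v2 := ccw_adj v1.
have w1 : adj (ccw v u) v by rewrite adj_sym.
have w2 : adj (ccw v (ccw v u)) v by rewrite adj_sym.
rewrite /edge_arc (fs_int uv iv) (fs_int w1 iv).
by rewrite (fs_int w2 iv) ccw_third //; split; exact: arc_ofC.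
Qed.

Lemma initial_quadP (k : N) u v a c b d : adj u v -> ~~ leaf u -> ~~ leaf v -> val k = [set u; v] ->
  quad (chord initial_facet) a c b d -> initial_arc k = arc_of a b ->
  let c0 := fs u (ccw u (ccw u v)) in let d0 := fs v (ccw v (ccw v u)) in
  [/\ a = fs v u, c = c0, b = fs u v & d = d0] \/ [/\ b = fs v u, d = c0, a = fs u v & c = d0].
Proof.
move=> uv iu iv ek Q; have Q0 := edge_quad uv iu iv.
have [_ tE] := (facetP _).1 initial_facet_facet.
have [am bm _ _] := quad_lt Q; have [ab _ _ _] := quad_neq Q.
have vu : adj v u by rewrite adj_sym.
rewrite (initial_arcE uv ek) /edge_arc => /esym.
case/(arc_of_inj am bm (fs_lt vu) (fs_lt uv) ab) => -[ea eb]; subst a b.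
  by have [-> ->] := quad_uniq tE Q Q0; left.
by have [-> ->] := quad_uniq tE (quad_swap tE Q) Q0; right.
Qed.

(** There are no 2-cycles because [ccw] has order three at an interior vertex, so the next and the
    previous edge differ, and because distinct edges share at most one vertex. *)
Lemma framed_ice : ice_quiver (framed (@tree_quiver T)).
Proof.
have nloop (e : N) : tree_quiver e e = 0.
  have [u [v [uv iu iv ee]]] := interior_edgeP e.
  have vu : adj v u by rewrite adj_sym.
  rewrite (tree_quiver_out _ uv ee) ee [X in _ || (X == _)]setUC.
  case: eqP => [/(edge_set_eq uv) e1|_] /=.
    by have := ccw_neq iu uv; rewrite -e1 eqxx.
  case: eqP => [/(edge_set_eq vu) e1|//].
  by have := ccw_neq iv vu; rewrite -e1 eqxx.
split.
- by case=> [e|e] //=; exact: nloop.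
- case=> [e1|e1] [e2|e2] /=; auto.
  have [u [v [uv iu iv ee]]] := interior_edgeP e1.
  have vu : adj v u by rewrite adj_sym.
  have u1 := ccw_adj uv; have v1 := ccw_adj vu.
  rewrite (tree_quiver_out _ uv ee) (tree_quiver_in _ uv iu iv ee).
  have nu := ccw_neq iu u1; have nv := ccw_neq iv v1.
  case: eqP => [->|_] /=; [right|].
    case: eqP => [/(edge_set_eq u1) e|_] /=; first by rewrite -e eqxx in nu.
    by rewrite (negbTE (edge_set_neq _ uv _)) // eq_sym; exact: ccw_neq.
  case: eqP => [->|_] /=; [right|by left].
  case: eqP => [/esym/eqP|_] /=.
    by rewrite (negbTE (edge_set_neq _ uv _)) // eq_sym; exact: ccw2_neq.
  by case: eqP => [/(edge_set_eq v1) e|_] //; rewrite -e eqxx in nv.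
- by [].
Qed.

Lemma initial_arc_nonboundary u v : adj u v -> nonboundary_in initial_facet (edge_arc u v) ->
  ~~ leaf u /\ ~~ leaf v.
Proof.
have half x y : adj x y -> nonboundary_in initial_facet (edge_arc x y) -> ~~ leaf x.
  move=> xy [_ nb]; apply/negP => lx; have yx : adj y x by rewrite adj_sym.
  apply: nb; apply/boundary_arcE; rewrite ?fs_lt //.
    by rewrite fs_neqm.
  have e := posK lx; have lt := ltn_pos lx.
  rewrite /consecutive -e fs_to_leaf ?fs_from_leaf ?e ?eqxx //.
move=> uv nb; split; first exact: half nb.
by apply: (half v u); rewrite 1?adj_sym // edge_arcC.
Qed.

Lemma initial_seed : seed initial_facet initial_arc (framed (@tree_quiver T)).
Proof.
split.
- exact: framed_ice.
- move=> k j e; have [u [v [uv iu iv ej]]] := interior_edgeP j.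
  apply: val_inj; apply/eqP; rewrite ej -(initial_arc_eq _ uv) e.
  by apply/eqP; exact: initial_arcE.
- move=> p; split.
    move=> nb; have [/initial_facetP[u [v [uv ep]]] _] := nb; subst p.
    have [iu iv] := initial_arc_nonboundary uv nb.
    have ie : interior_edge_pred [set u; v].
      by apply/existsP; exists u; apply/existsP; exists v; rewrite uv iu iv eqxx.
    by exists (Sub [set u; v] ie); apply: initial_arcE; rewrite // SubK.
  case=> k <-; have [u [v [uv iu iv ek]]] := interior_edgeP k.
  rewrite (initial_arcE uv ek).
  exact: (quad_nonboundary (edge_quad uv iu iv)).
- move=> k a c b d Q ek j; have [u [v [uv iu iv vk]]] := interior_edgeP k.
  have vu : adj v u by rewrite adj_sym.
  have u1 := ccw_adj uv; have v1 := ccw_adj vu; have u2 := ccw_adj u1; have v2 := ccw_adj v1.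
  have [t1 t2] := edge_arc_turn uv iv; have [t3 t4] := edge_arc_turn vu iu.
  have key : exchange_matrix (framed (@tree_quiver T)) k (inl j) =
     brow (fs v u) (fs u (ccw u (ccw u v))) (fs u v) (fs v (ccw v (ccw v u))) (initial_arc j).
    rewrite /brow -t1 -t2 -t3 -t4 !initial_arc_eq //.
    rewrite /exchange_matrix /= (tree_quiver_out _ uv vk) (tree_quiver_in _ uv iu iv vk).
    have x1 : [set u; ccw u v] != [set v; ccw v u] by rewrite edge_set_neq // eq_sym ccw_neq.
    have x2 : [set u; ccw u (ccw u v)] != [set v; ccw v (ccw v u)].
      by rewrite edge_set_neq // eq_sym ccw2_neq.
    (* An edge adjacent to uv meets only one of its ends, so the disjunctions in [tree_quiver] count
       as sums. *)
    apply: disjoint_orZ; [apply: contraNN x1|apply: contraNN x2];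
      by case/andP=> /eqP <- /eqP ->.
  case: (initial_quadP uv iu iv vk Q ek) => -[-> -> -> ->] //.
  by rewrite key brow_swap.
move=> k a c b d Q ek e; have [u [v [uv iu iv vk]]] := interior_edgeP k.
have br := edge_branches uv iu iv.
have key := crow_branches e uv iu iv br.
have -> : exchange_matrix (framed (@tree_quiver T)) k (inr e) = (val e == [set u; v])%:Z%R.
  by rewrite /exchange_matrix /= subr0 -vk eq_sym -val_eqE.
case: (initial_quadP uv iu iv vk Q ek) => -[-> -> -> ->] //.
by rewrite crow_swap.
Qed.

End InitialSeed.

(** * Uniqueness of the facet carrying the framed quiver *)

Section InitialUnique.
Implicit Types u v w : T.
Implicit Types S : {set {set T}}.

Lemma first_leaves_cyc v w : adj v w -> ~~ leaf v ->
  cyc (fs v w) (fs v (ccw v w)) (fs v (ccw v (ccw v w))).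
Proof.
move=> vw iv; have wv : adj w v by rewrite adj_sym.
have [h _ _] := initial_triangle wv iv.
by rewrite cyc_rot -(fs_int wv iv).
Qed.

Lemma sd_cyc v w i j k : adj v w -> ~~ leaf v -> i < m -> j < m -> k < m ->
  sd v w i -> sd v (ccw v w) j -> sd v (ccw v (ccw v w)) k -> cyc i j k.
Proof.
move=> vw iv im jm km; have wv : adj w v by rewrite adj_sym.
have v1 := ccw_adj vw; have v2 := ccw_adj v1.
have w1 : adj (ccw v w) v by rewrite adj_sym.
have w2 : adj (ccw v (ccw v w)) v by rewrite adj_sym.
have := first_leaves_cyc vw iv; rewrite !sdE //.
rewrite (fs_int wv iv) (fs_int w1 iv) (fs_int w2 iv) ccw_third //.
clear; rewrite /arc_co /cyc; do 3 case: ifP; lia.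
Qed.

Lemma edge_index u v : adj u v -> ~~ leaf u -> ~~ leaf v -> exists k : N, val k = [set u; v].
Proof.
move=> uv iu iv; have ie : interior_edge_pred [set u; v].
  by apply/existsP; exists u; apply/existsP; exists v; rewrite uv iu iv eqxx.
by exists (Sub [set u; v] ie); rewrite SubK.
Qed.

(** If b and d were in the same branch beyond v, the edge to that branch would also separate ac from
    bd and give a second nonzero entry. The wrong order of the two branches contradicts the cyclic
    order of b, d, a. *)
Lemma branches_half u v a c b d E : adj u v -> ~~ leaf v -> quad E a c b d ->
  a < m -> b < m -> c < m -> d < m ->
  (forall e : N, crow a c b d e = (val e == [set u; v])%:Z%R) ->
  sd u v a = false -> sd u v c = false -> sd u v b -> sd u v d ->
  sd v (ccw v u) b /\ sd v (ccw v (ccw v u)) d.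
Proof.
move=> uv iv Q am bm cm dm one sa sc sb sd_; have vu : adj v u by rewrite adj_sym.
have [ab _ _ [_ bd _]] := quad_neq Q; have [_ bda _ _ _ _ _] := Q.
have v1 := ccw_adj vu; have v2 := ccw_adj v1.
have nv i : i < m -> lf i != v by move=> im; apply: contraNneq iv => <-; exact: lf_leaf.
have cases i : i < m -> sd u v i -> sd v (ccw v u) i \/ sd v (ccw v (ccw v u)) i.
  move=> im; rewrite /sd (side_split uv iv) in_setU1 in_setU (negbTE (nv i im)) /=.
  by move/orP.
have nosame w : adj v w -> w != u -> sd v w b -> sd v w d -> False.
  move=> vw wu wb wd; have iw := two_leaves_int vw bm dm bd wb wd.
  have [e ee] := edge_index vw iv iw.
  have no i : sd u v i = false -> sd v w i = false.
    by apply: contraFF; exact: sd_child.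
  have := one e; rewrite (crowE _ _ _ _ vw ee) wb wd !no // ee.
  case: eqP => // es; have wu' : w = u by move: es; rewrite [RHS]setUC => /(edge_set_eq vw).
  by rewrite wu' eqxx in wu.
have va : sd v u a by rewrite (sdC _ uv) sa.
case: (cases _ bm sb) (cases _ dm sd_) => hb [] hd //.
- by case: (nosame _ v1 (ccw_neq iv vu) hb hd).
- have := sd_cyc vu iv am dm bm va hd hb; move: bda; clear; rewrite /cyc; lia.
by case: (nosame _ v2 (ccw2_neq iv vu) hb hd).
Qed.

Section Unique.
Variables (S : {set {set T}}) (beta : N -> {set T}).
Hypotheses (fS : facet S) (sS : seed S beta (framed (@tree_quiver T))).

(** The entry +1 at uv says that uv separates ac from bd, and b may be taken beyond v by passing to
    bdac. The vanishing of the other entries then spreads the leaves over all four branches. *)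
Lemma seed_branches (k : N) u v : adj u v -> ~~ leaf u -> ~~ leaf v -> val k = [set u; v] ->
  exists a c b d, [/\ quad (chord S) a c b d, beta k = arc_of a b & branches u v a c b d].
Proof.
move=> uv iu iv vk; have vu : adj v u by rewrite adj_sym.
have [_ tE] := (facetP S).1 fS.
have [a [c [b [d [ek Q]]]]] := seed_quad k fS sS.
have one (e : N) : crow a c b d e = (val e == [set u; v])%:Z%R.
  rewrite -(seed_c sS Q ek) /exchange_matrix /= subr0 -vk eq_sym -val_eqE //.
have {one} [a' [c' [b' [d' [Q' ek' one sb]]]]] : exists a' c' b' d',
    [/\ quad (chord S) a' c' b' d', beta k = arc_of a' b',
      (forall e : N, crow a' c' b' d' e = (val e == [set u; v])%:Z%R) & sd u v b'].
  case: (boolP (sd u v b)) => sb; first by exists a, c, b, d.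
  exists b, d, a, c; split=> //.
  - exact: (quad_swap tE Q).
  - by rewrite ek; exact: arc_ofC.
  - by move=> e; rewrite -crow_swap.
  have := one k; rewrite (crowE _ _ _ _ uv vk) vk eqxx (negbTE sb).
  by case: (sd u v a); case: (sd u v c); case: (sd u v d).
have [am bm cm dm] := quad_lt Q'.
have [sa sc sd_] : [/\ sd u v a' = false, sd u v c' = false & sd u v d'].
  have := one k; rewrite (crowE _ _ _ _ uv vk) vk eqxx sb.
  by case: (sd u v a'); case: (sd u v c'); case: (sd u v d').
have [h1 h2] := branches_half uv iv Q' am bm cm dm one sa sc sb sd_.
have one' (e : N) : crow b' d' a' c' e = (val e == [set v; u])%:Z%R.
  by rewrite -crow_swap one setUC.
have sC i : sd v u i = ~~ sd u v i by exact: sdC.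
have [||||h3 h4] := branches_half vu iu (quad_swap tE Q') bm am dm cm one'; rewrite ?sC ?sa ?sb ?sc ?sd_ //.
by exists a', c', b', d'; split.
Qed.

(** By induction the arc a'b' of the next edge, from v to [ccw v u], ends at the first leaf b'
    beyond it, and its other end a' is in the third branch at v. If b were not b', the order a, b',
    b, a' would make ab cross a'b'. *)
Lemma seed_end u v : adj u v -> ~~ leaf u -> ~~ leaf v -> forall (k : N) a c b d,
  val k = [set u; v] -> quad (chord S) a c b d -> beta k = arc_of a b -> branches u v a c b d ->
  b = fs u v.
Proof.
have [_ tE] := (facetP S).1 fS.
move: u v; apply: side_rect => // [u v uv lv _ /negP //|u v uv iv IH _ iu _ k a c b d vk Q ek br].
have vu : adj v u by rewrite adj_sym.
have v1 := ccw_adj vu; have v2 := ccw_adj v1; have u1 := ccw_adj uv.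
have [am bm cm dm] := quad_lt Q.
have [sa _ sb _] := br.
rewrite (fs_int uv iv).
case: (boolP (leaf (ccw v u))) => [lw|iw].
  rewrite fs_leaf //; move: sb; rewrite /sd side_leaf // in_set1 => /eqP <-.
  by rewrite lfK.
have [k' vk'] := edge_index v1 iv iw.
have [a' [c' [b' [d' [Q' ek' br']]]]] := seed_branches v1 iv iw vk'.
have eb' := IH iv iw _ _ _ _ _ vk' Q' ek' br'.
have [am' bm' _ _] := quad_lt Q'; have [sa' _ _ _] := br'.
have va : sd v u a := sd_child vu u1 (ccw_neq iu uv) sa.
have [_ _ Eab _ _ _ _] := Q; have [_ _ Eab' _ _ _ _] := Q'.
have := tri_nc tE Eab Eab'; have := first_leaves_cyc vu iv; rewrite -eb'.
move: va sb sa'; rewrite !sdE // -eb'.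
have w1 : adj (ccw v u) v by rewrite adj_sym.
have w2 : adj (ccw v (ccw v u)) v by rewrite adj_sym.
rewrite (fs_int uv iv) (fs_int w1 iv) (fs_int w2 iv) ccw_third //.
rewrite -eb'; clear; rewrite /crossed /arc_co /cyc; do 3 case: ifP; lia.
Qed.

(** Maximality of the initial facet leaves its inclusion in [S] to prove. Arcs of interior edges are
    values of [beta]; those of edges at leaves are sides of the polygon, present in every
    triangulation. *)
Lemma seed_initial : S = initial_facet /\ beta =1 initial_arc.
Proof.
have eb (k : N) : beta k = initial_arc k.
  have [u [v [uv iu iv vk]]] := interior_edgeP k.
  have vu : adj v u by rewrite adj_sym.
  have [_ tE] := (facetP S).1 fS.
  have [a [c [b [d [Q ek br]]]]] := seed_branches uv iu iv vk.
  have e1 := seed_end uv iu iv vk Q ek br.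
  have e2 : a = fs v u.
    apply: (@seed_end v u vu iv iu k b d a c); rewrite 1?setUC //.
    - exact: (quad_swap tE Q).
    - by rewrite ek; exact: arc_ofC.
    by case: br.
  by rewrite (initial_arcE uv vk) ek e1 e2.
split=> //; have [_ max0] := initial_facet_facet.
apply: max0; first by have [] := fS.
apply/subsetP => p /initial_facetP[u [v [uv ->]]].
have [_ tE] := (facetP S).1 fS.
have m1 := nleaves_gt1.
have leafcase x y : adj x y -> leaf x -> edge_arc x y \in S.
  move=> xy lx; have e := posK lx; have lt := ltn_pos lx.
  have : chord S (fs y x) (fs x y).
    by rewrite -e fs_to_leaf ?fs_from_leaf ?e //; exact: (tri_succ tE m1 lt).
  by case/chordP.
case: (boolP (leaf u)) => iu; first exact: leafcase.
case: (boolP (leaf v)) => iv; first by rewrite edge_arcC leafcase // adj_sym.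
have [k vk] := edge_index uv iu iv.
rewrite -(initial_arcE uv vk) -eb; exact: (seed_mem sS _).
Qed.

End Unique.

End InitialUnique.

(** * Orientation of flips *)

Section Orientation.
Implicit Types u v w : T.
Implicit Types S : {set {set T}}.

(** The label of the face in the corner lies in ]i, j], so for arcs through the same corner
    comparing regions amounts to comparing these intervals. *)
Lemma corner_gap v w i j : adj v w -> ~~ leaf v -> i < m -> j < m ->
  sd v w i -> sd v (ccw v w) j -> arc_oc i j (fs w v).
Proof.
move=> vw iv im jm; have wv : adj w v by rewrite adj_sym.
have v1 := ccw_adj vw.
have w1 : adj (ccw v w) v by rewrite adj_sym.
have := first_leaves_cyc vw iv; rewrite !sdE //.
rewrite (fs_int wv iv) (fs_int w1 iv).
clear; rewrite /arc_co /arc_oc /cyc; do 3 case: ifP; lia.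
Qed.

Lemma lface_inj_l v w w' : ~~ leaf v -> adj v w -> adj v w' -> lface v w = lface v w' -> w = w'.
Proof.
move=> iv vw vw' /eqP; have wv : adj w v by rewrite adj_sym.
have wv' : adj w' v by rewrite adj_sym.
rewrite lfaceE // (fs_int wv iv) (fs_int wv' iv) => /eqP e.
have s := sd_fs (ccw_adj vw); have s' := sd_fs (ccw_adj vw').
rewrite -e in s'; have e' := sd_side_uniq (ccw_adj vw) (ccw_adj vw') s s'.
exact: (ccw_inj iv vw vw' e').
Qed.

Lemma lface_rev v w : adj v w -> ~~ leaf v -> lface (ccw v w) v = lface v w.
Proof.
move=> vw iv; have wv : adj w v by rewrite adj_sym.
have w1 : adj (ccw v w) v by rewrite adj_sym ccw_adj.
by apply/eqP; rewrite lfaceE // (fs_int wv iv).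
Qed.

(** The third vertex z is in the third branch at v. An arc of [S] through the same corner crosses
    neither xz nor yz, so [triangle_arcs] puts its region inside that of xy. *)
Lemma marked_triangle S x y z v w : facet S -> adj v w -> ~~ leaf v ->
  chord S x y -> chord S y z -> chord S x z ->
  sd v w x -> sd v (ccw v w) y -> sd v (ccw v (ccw v w)) z ->
  marked S (arc_of x y) v (lface v w).
Proof.
move=> fS vw iv Exy Eyz Exz sx sy sz.
have [aS tE] := (facetP S).1 fS.
have [xm ym xy xyS] : [/\ x < m, y < m, x != y & arc_of x y \in S] by apply/chordP.
have [_ zm _ _] : [/\ x < m, z < m, x != z & arc_of x z \in S] by apply/chordP.
split=> //.
  by apply/contains_cornerE => //; exists w; split=> //; rewrite /at_corner sx sy.
move=> p pS; have [k [l [km lm kl ep]]] := (is_arc_pos p).1 (aS _ pS).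
rewrite ep; case/(contains_cornerE _ _ km lm kl) => w' [vw' _ ef].
have <- := lface_inj_l iv vw vw' ef; move=> ac {w' vw' ef}.
have {ac ep pS km lm kl} [k' [l' [-> km lm [kl pS] [sk sl]]]] : exists k' l',
    [/\ arc_of k l = arc_of k' l', k' < m, l' < m, k' != l' /\ arc_of k' l' \in S & sd v w k' /\ sd v (ccw v w) l'].
  rewrite ep in pS; case/orP: ac => /andP[h1 h2]; first by exists k, l.
  by exists l, k; split=> //; [exact: arc_ofC|rewrite eq_sym (arc_ofC l k)].
have [xyz klz xlz kyz] : [/\ cyc x y z, cyc k' l' z, cyc x l' z & cyc k' y z].
  by split; apply: (sd_cyc vw iv).
have Ekl : chord S k' l' by apply/chordP.
apply/Reg_subset => // t tm.
rewrite (corner_gap vw iv km lm sk sl) (corner_gap vw iv xm ym sx sy) => /esym kt.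
apply/esym; apply: (triangle_arcs xyz klz xlz kyz _ _ kt).
  exact: (tri_nc tE Exz Ekl).
exact: (tri_nc tE Eyz Ekl).
Qed.

(** If c shared a branch with b or with a, the side ac or cb, respectively, would contain the same
    corner without its region lying in that of ab, against the maximality of ab. *)
Lemma marked_apex S a c b d u w : facet S -> quad (chord S) a c b d -> adj u w -> ~~ leaf u ->
  marked S (arc_of a b) u (lface u w) -> sd u w b -> sd u (ccw u w) a ->
  sd u (ccw u (ccw u w)) c.
Proof.
move=> fS Q uw iu [_ _ mx] sb sa.
have [am bm cm dm] := quad_lt Q; have [ab ac ad [bc bd cd]] := quad_neq Q.
have ba : b != a by rewrite eq_sym.
have [acb _ _ /chordP[_ _ _ acS] /chordP[_ _ _ cbS] _ _] := Q.
have gap := corner_gap uw iu bm am sb sa.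
have gap' : arc_oc a b (fs w u) = false by rewrite arc_oc_rev // gap.
have abc := arc_oc_in acb; have abb := arc_oc_r ab.
have [z uz sz] := sd_nbr iu cm.
case: (nbrE iu uw uz) => e; subst z => //.
  have : Reg (arc_of a c) (lface u w) \subset Reg (arc_of a b) (lface u w).
    apply: mx => //.
    by apply/contains_cornerE => //; exists w; split=> //; rewrite /at_corner sz sa orbT.
  move/(Reg_subset am cm ac am bm ab uw uw)/(_ b bm).
  rewrite gap' abb => h; have ca : c != a by rewrite eq_sym.
  have g := corner_gap uw iu cm am sz sa; have g' : arc_oc a c (fs w u) = false by rewrite arc_oc_rev // g.
  rewrite g' in h; have := h; rewrite arc_oc_out; first by move/(_ erefl).
  by move: acb; clear; rewrite /cyc; lia.
have : Reg (arc_of c b) (lface u w) \subset Reg (arc_of a b) (lface u w).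
  have cb : c != b by rewrite eq_sym.
  apply: mx => //.
  by apply/contains_cornerE => //; exists w; split=> //; rewrite /at_corner sz sb orbT.
have cb : c != b by rewrite eq_sym.
move/(Reg_subset cm bm cb am bm ab uw uw)/(_ c cm).
rewrite gap' abc arc_oc_l // => h.
have g := corner_gap uw iu bm cm sb sz.
by have := h; rewrite arc_oc_rev // g => /(_ erefl).
Qed.

Lemma marked_median S a c b d u F : facet S -> quad (chord S) a c b d ->
  marked S (arc_of a b) u F -> exists w, [/\ adj u w, ~~ leaf u, F = lface u w &
    [/\ sd u w b, sd u (ccw u w) a & sd u (ccw u (ccw u w)) c] \/
    [/\ sd u w a, sd u (ccw u w) b & sd u (ccw u (ccw u w)) d]].
Proof.
move=> fS Q mk; have [am bm cm dm] := quad_lt Q; have [ab _ _ _] := quad_neq Q.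
have [_ tE] := (facetP S).1 fS.
have [_ cc _] := mk.
move/(contains_cornerE _ _ am bm ab): cc => [w [uw iu eF ac]].
exists w; split=> //; rewrite eF in mk.
case/orP: ac => /andP[s1 s2]; [right|left]; split=> //.
  apply: (marked_apex fS (quad_swap tE Q) uw iu _ s1 s2).
  by rewrite (arc_ofC b a).
exact: (marked_apex fS Q uw iu mk s1 s2).
Qed.

Lemma positive_crow u w a c b d : adj u w -> sd u w a = false -> sd u w c = false ->
  sd u w b -> sd u w d -> forall e : N, (0 <= crow a c b d e)%R.
Proof.
move=> uw sa sc sb sd_ e; have [x [y [xy _ _ _ es]]] := esideP e.
rewrite /crow !es.
have := no_crossing_split uw xy sa sc sb sd_.
by case: (sd x y a); case: (sd x y b); case: (sd x y c); case: (sd x y d) => //= h; case: h.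
Qed.

(** One of the two corners suffices. Suppose ab is marked at the branching vertex u of a, b, c. The
    clockwise next corner lies between the branches of c and b; since cd contains it, d is in the
    branch of b. The edge from u to that branch separates ac from bd, so no entry is negative. *)
Lemma clockwise_positive S a c b d : facet S -> quad (chord S) a c b d ->
  clockwise_flip S (arc_of a b) (arc_of c d) (flip_at S a c b d) ->
  forall e : N, (0 <= crow a c b d e)%R.
Proof.
move=> fS Q [u [_ [F [_ [F' [_ [_ [mk _] [mk' _] [w' [uw' eF eF']] _]]]]]]] e.
have [w [uw iu eFw cs]] := marked_median fS Q mk.
have [_ tE] := (facetP S).1 fS.
wlog [sb sa sc] : a c b d Q mk mk' {cs} / [/\ sd u w b, sd u (ccw u w) a & sd u (ccw u (ccw u w)) c].
  move=> W; case: cs => cs; first exact: W cs.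
  have mks : marked S (arc_of b a) u F by rewrite (arc_ofC b a).
  have mks' : marked (flip_at S b d a c) (arc_of d c) u F'.
    by rewrite /flip_at (arc_ofC b a) (arc_ofC d c).
  by rewrite crow_swap; exact: (W b d a c (quad_swap tE Q) mks mks' cs).
have fS' := flip_at_facet fS Q; have Q' := flip_at_quad Q.
have [y [uy _ eFy cs]] := marked_median fS' Q' mk'.
have u1 := ccw_adj uw; have u2 := ccw_adj u1.
have ew : w' = w by apply: (lface_inj_l iu uw' uw); rewrite -eF -eFw.
subst w'; have wu : adj w u by rewrite adj_sym.
have yu : adj y u by rewrite adj_sym.
have ey : ccw u y = w.
  have u1y := ccw_adj uy; have y1 : adj (ccw u y) u by rewrite adj_sym.
  have := eF'; rewrite eFy => /eqP; rewrite lfaceE // (fs_int yu iu) => /eqP e'.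
  have s := sd_fs u1y; have s' := sd_fs uw; rewrite -e' in s'.
  exact: (sd_side_uniq u1y uw s s').
have un w1 w2 i : adj u w1 -> adj u w2 -> w1 != w2 -> sd u w1 i -> sd u w2 i = false.
  by move=> a1 a2 ne s; apply: contraNF ne => s'; apply/eqP; exact: (sd_side_uniq a1 a2 s s').
have n1 := ccw_neq iu uw; have n2 := ccw2_neq iu uw.
rewrite ey in cs; case: cs => -[_ h _].
  by rewrite (un _ w c u2 uw n2 sc) in h.
apply: (positive_crow uw) => //; first exact: (un _ w a u1 uw n1 sa).
exact: (un _ w c u2 uw n2 sc).
Qed.

(** The corners are found as medians on the two sides of an edge separating ac from bd: u for a, c
    and the far side, v for b, d and the far side. *)
Lemma positive_clockwise S a c b d : facet S -> quad (chord S) a c b d ->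
  (forall e : N, (0 <= crow a c b d e)%R) ->
  clockwise_flip S (arc_of a b) (arc_of c d) (flip_at S a c b d).
Proof.
move=> fS Q pos_; have [am bm cm dm] := quad_lt Q; have [ab ac ad [bc bd cd]] := quad_neq Q.
have [acb bda Eab Eac Ecb Ebd Eda] := Q.
have fS' := flip_at_facet fS Q.
have [_ _ Ecd' Ecb' Ebd' Eda' Eac'] := flip_at_quad Q.
have [_ tE] := (facetP S).1 fS; have [_ tE'] := (facetP _).1 fS'.
(* The edge from [quartet] separates a from b and c from d, so its entry is 1 or - 1; positivity
   leaves the split of ac against bd. *)
have {pos_} [x [y [xy sa sc sb sd_]]] : exists x y,
    [/\ adj x y, sd x y a = false, sd x y c = false, sd x y b & sd x y d].
  have [x [y [xy ix iy [h1 h2]]]] := quartet am bm cm dm acb bda.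
  have yx : adj y x by rewrite adj_sym.
  have [e ee] := edge_index xy ix iy.
  have := pos_ e; rewrite (crowE _ _ _ _ xy ee) => h.
  case: (boolP (sd x y b)) => sb; [exists x, y|exists y, x; rewrite !(sdC _ xy)];
    split=> //; move: h1 h2 h; rewrite ?sb ?(negbTE sb);
    by case: (sd x y a); case: (sd x y c); case: (sd x y d).
have yx : adj y x by rewrite adj_sym.
have sa' : sd y x a by rewrite (sdC _ xy) sa.
have sc' : sd y x c by rewrite (sdC _ xy) sc.
have ll i : i < m -> leaf (lf i) by exact: lf_leaf.
have ln := lf_neq.
have [u [w1 [w2 [w3 [u1 u2 u3 [n12 n13 n23] [ua uc sub]]]]]] :=
  median yx (ll _ am) (ll _ cm) (ln _ _ am cm ac) sa' sc'.
have ub : sd u w3 b := subsetP sub _ sb; have ud : sd u w3 d := subsetP sub _ sd_.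
have [v [z1 [z2 [z3 [v1 v2 v3 [k12 k13 k23] [vb vd sub']]]]]] :=
  median xy (ll _ bm) (ll _ dm) (ln _ _ bm dm bd) sb sd_.
have va : sd v z3 a := subsetP sub' _ sa'; have vc : sd v z3 c := subsetP sub' _ sc'.
have iu := two_nbrs u1 u2 n12; have iv := two_nbrs v1 v2 k12.
(* The cyclic order of three leaves in the three branches at t is the rotation of these branches. *)
have order t t1 t2 t3 i j k : ~~ leaf t -> adj t t1 -> adj t t2 -> adj t t3 -> t1 != t2 -> t1 != t3 ->
    t2 != t3 -> i < m -> j < m -> k < m -> sd t t1 i -> sd t t2 j -> sd t t3 k -> cyc i j k ->
    t2 = ccw t t1 /\ t3 = ccw t t2.
  move=> it a1 a2 a3 n1 n2 n3 im jm km s1 s2 s3 ijk.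
  case: (nbrE it a1 a2) => e2; first by rewrite e2 eqxx in n1.
    case: (nbrE it a1 a3) => e3; first by rewrite e3 eqxx in n2.
      by rewrite e2 e3 eqxx in n3.
    by rewrite e3 -e2.
  case: (nbrE it a1 a3) => e3; first by rewrite e3 eqxx in n2.
    rewrite e2 in s2; rewrite e3 in s3.
    have := sd_cyc a1 it im km jm s1 s3 s2; move: ijk; clear; rewrite /cyc; lia.
  by rewrite e2 e3 eqxx in n3.
have [e2 e3] := order u w1 w2 w3 a c b iu u1 u2 u3 n12 n13 n23 am cm bm ua uc ub acb.
have [f2 f3] := order v z1 z2 z3 b d a iv v1 v2 v3 k12 k13 k23 bm dm am vb vd va bda.
have e1 : ccw u w3 = w1 by rewrite e3 e2 ccw_third.
have f1 : ccw v z3 = z1 by rewrite f3 f2 ccw_third.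
have uv : u != v.
  apply: contraNneq k12 => euv; rewrite euv in u3 ub ud.
  rewrite (sd_side_uniq v1 u3 vb ub); apply/eqP/esym.
  exact: (sd_side_uniq v2 u3 vd ud).
exists u, v, (lface u w3), (lface v z3), (lface w3 u), (lface z3 v); split.
- by apply: contraNneq uv => -[->].
- split.
    rewrite (arc_ofC a b); apply: (@marked_triangle S b a c u w3) => //.
    + by rewrite (tri_sym tE).
    + by rewrite (tri_sym tE).
    + by rewrite e1.
    + by rewrite e1 -e2.
  apply: (@marked_triangle S a b d v z3) => //.
  + by rewrite (tri_sym tE).
  + by rewrite f1.
  + by rewrite f1 -f2.
- split.
    rewrite {1}e3 lface_rev //; apply: (@marked_triangle _ c d a u w2) => //.
    + by rewrite (tri_sym tE').
    + by rewrite -e3.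
    + by rewrite -e3 e1.
  rewrite {1}f3 lface_rev // (arc_ofC c d); apply: (@marked_triangle _ d c b v z2) => //.
  + by rewrite (tri_sym tE').
  + by rewrite (tri_sym tE').
  + by rewrite -f3.
  + by rewrite -f3 f1.
- by exists w3.
- by exists z3.
Qed.

End Orientation.

(** * The isomorphism *)

Section SeedUnique.
Implicit Types S : {set {set T}}.
Implicit Types R : quiver (N + N).

Lemma flip_inv S p A S' : flip S p A S' -> flip S' A p S.
Proof.
move=> fl; have [fS fS' nb _ _] := fl.
have [a [c [b [d [ep Q]]]]] := facet_quad fS nb; subst p.
have [-> ->] := flip_arc_unique Q fl.
have := flip_atP (flip_at_facet fS Q) (flip_at_quad Q).
by rewrite (flip_at_back fS Q) (arc_ofC b a).
Qed.

Lemma flip_unique_arc S p A S' B S'' : flip S p A S' -> flip S p B S'' -> A = B /\ S' = S''.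
Proof.
move=> fl fl'; have [fS _ nb _ _] := fl.
have [a [c [b [d [ep Q]]]]] := facet_quad fS nb; subst p.
have [-> ->] := flip_arc_unique Q fl.
by have [-> ->] := flip_arc_unique Q fl'.
Qed.

Lemma seed_flip S beta R k R' : facet S -> seed S beta R -> mutation k R R' ->
  exists A S', flip S (beta k) A S' /\ seed S' (exchange_arc beta k A) R'.
Proof.
move=> fS sS mu; have [a [c [b [d [ek Q]]]]] := seed_quad k fS sS.
exists (arc_of c d), (flip_at S a c b d); split.
  by rewrite ek; exact: flip_atP.
exact: (seed_mutation fS sS Q ek mu).
Qed.

(** The labelling is part of the conclusion because the induction step has to know which arc sits at
    k in order to flip back along it. *)
Lemma seed_unique R : mutation_equiv R0 R -> forall S beta S' beta',
  facet S -> facet S' -> seed S beta R -> seed S' beta' R -> S = S' /\ beta =1 beta'.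
Proof.
have ice0 := framed_ice.
elim=> [|k R1 R2 eq1 IH mu] S beta S' beta' fS fS' sS sS'.
  have [-> e] := seed_initial fS sS; have [-> e'] := seed_initial fS' sS'.
  by split=> // k; rewrite e e'.
have mu' := mutation_inv (mutation_equiv_ice ice0 eq1) mu.
have [A [S1 [fl s1]]] := seed_flip fS sS mu'.
have [A' [S1' [fl' s1']]] := seed_flip fS' sS' mu'.
have [_ fS1 _ _ _] := fl; have [_ fS1' _ _ _] := fl'.
have [eS eb] := IH _ _ _ _ fS1 fS1' s1 s1'; subst S1'.
have eA : A = A' by have := eb k; rewrite /exchange_arc eqxx.
subst A'; have [ek ->] := flip_unique_arc (flip_inv fl) (flip_inv fl').
split=> // j; have := eb j; rewrite /exchange_arc; case: eqP => [-> _|//].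
exact: ek.
Qed.

Lemma seed_eq S beta R R' : facet S -> seed S beta R -> seed S beta R' -> R = R'.
Proof.
move=> fS sR sR'; apply: ice_quiver_eq; [exact: (seed_ice sR)|exact: (seed_ice sR')|].
move=> i v; have [a [c [b [d [ek Q]]]]] := seed_quad i fS sR.
by rewrite (seed_row _ sR Q ek) (seed_row _ sR' Q ek).
Qed.

Lemma seed_perm S beta R R' (s : {perm N}) : seed S beta R ->
  (forall u v, R' (match u with inl i => inl (s i) | inr x => inr x end)
                 (match v with inl i => inl (s i) | inr x => inr x end) = R u v) ->
  seed S (fun k => beta (s^-1%g k)) R'.
Proof.
move=> sR eR.
have E i v : exchange_matrix R' i v =
    exchange_matrix R (s^-1%g i) (match v with inl j => inl (s^-1%g j) | inr x => inr x end).
  rewrite /exchange_matrix -!eR permKV; case: v => [j|x] //; by rewrite permKV.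
have E' u v : R' u v = R (match u with inl i => inl (s^-1%g i) | inr x => inr x end)
                 (match v with inl i => inl (s^-1%g i) | inr x => inr x end).
  by rewrite -eR; case: u => [i|x]; case: v => [j|y]; rewrite ?permKV.
have [h1 h2 h3] := seed_ice sR.
split.
- by split=> [u|u v|x y]; rewrite !E'.
- by move=> i j /(seed_inj sR)/perm_inj.
- move=> p; rewrite (seed_nb sR); split=> -[k ek].
    by exists (s k); rewrite permK.
  by exists (s^-1%g k).
- by move=> k a c b d Q ek j; rewrite E; exact: (seed_b sR Q ek).
- by move=> k a c b d Q ek e; rewrite E; exact: (seed_c sR Q ek).
Qed.

(** Vertices labelled by the same arc correspond. After this renaming both quivers have the same
    labelling, hence the same rows. *)
Lemma seed_frozen_iso S beta beta' R R' : facet S -> seed S beta R -> seed S beta' R' ->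
  frozen_iso R R'.
Proof.
move=> fS sR sR'.
have ex k : exists j, beta' j == beta k.
  have [j e] : exists j, beta' j = beta k by apply/(seed_nb sR'); apply/(seed_nb sR); exists k.
  by exists j; rewrite e.
pose f k := xchoose (ex k); have fE k : beta' (f k) = beta k by exact/eqP/(xchooseP (ex k)).
have finj : injective f by move=> i j e; apply: (seed_inj sR); rewrite -!fE e.
exists (perm finj) => /=.
have sR1 : seed S beta (fun u v =>
    R' (match u with inl i => inl (f i) | inr x => inr x end)
       (match v with inl i => inl (f i) | inr x => inr x end)).
  have sR2 := @seed_perm S beta' R' (fun u v =>
    R' (match u with inl i => inl ((perm finj) i) | inr x => inr x end)
       (match v with inl i => inl ((perm finj) i) | inr x => inr x end)) (perm finj)^-1%g sR'.
  have [|i1 i2 i3 i4 i5] := sR2.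
    by move=> [i|x] [j|y]; rewrite ?permKV.
  rewrite invgK in i2 i3 i4 i5.
  have bE i : beta' ((perm finj) i) = beta i by rewrite permE.
  have RE : (fun u v : N + N =>
    R' (match u with inl i => inl ((perm finj) i) | inr x => inr x end)
       (match v with inl i => inl ((perm finj) i) | inr x => inr x end)) = (fun u v =>
    R' (match u with inl i => inl (f i) | inr x => inr x end)
       (match v with inl i => inl (f i) | inr x => inr x end)).
    apply: functional_extensionality => u; apply: functional_extensionality => v.
    by case: u => [i|x]; case: v => [j|y]; rewrite ?permE.
  have betaE : (fun k => beta' ((perm finj) k)) = beta by apply: functional_extensionality.
  rewrite -RE -betaE; exact: Seed.
move=> u v; rewrite (seed_eq fS sR sR1).
by case: u => [i|x]; case: v => [j|y]; rewrite ?permE.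
Qed.

End SeedUnique.

Section Main.
Implicit Types S : {set {set T}}.
Implicit Types R : quiver (N + N).

Lemma sval_inj (A : Type) (P : A -> Prop) (x y : {a | P a}) : sval x = sval y -> x = y.
Proof.
case: x y => [x hx] [y hy] /= e; subst y; congr exist; exact: proof_irrelevance.
Qed.

Lemma facet_seed S : facet S -> exists beta R, mutation_equiv R0 R /\ seed S beta R.
Proof.
move=> fS; pose P S' := exists beta R, mutation_equiv R0 R /\ seed S' beta R.
apply: (facets_connected (P := P) _ initial_facet_facet fS); last first.
  exists initial_arc, R0; split; first exact: mutation_equiv_refl.
  exact: initial_seed.
move=> S' a c b d fS' Q [beta [R [eqR sR]]].
have [k ek] := (seed_nb sR _).1 (quad_nonboundary Q).
have [R' mu] := mutation_exists R k.
exists (exchange_arc beta k (arc_of c d)), R'; split; first exact: mutation_equiv_step mu.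
exact: (seed_mutation fS' sR Q ek mu).
Qed.

Lemma reachable_seed R : mutation_equiv R0 R -> exists S beta, facet S /\ seed S beta R.
Proof.
elim=> [|k R1 R2 _ [S [beta [fS sS]]] mu].
  exists initial_facet, initial_arc; split; first exact: initial_facet_facet.
  exact: initial_seed.
have [A [S' [[_ fS' _ _ _] sS']]] := seed_flip fS sS mu.
by exists S', (exchange_arc beta k A).
Qed.

(** All reachable quivers carrying a seed on [S] are taken, so no representative has to be chosen;
    [seed_frozen_iso] and [seed_perm] show that they form one isomorphism class. *)
Definition seed_class S : quiver (N + N) -> Prop :=
  fun R => mutation_equiv R0 R /\ exists beta, seed S beta R.

Lemma seed_classE S : facet S ->
  exists2 R, mutation_equiv R0 R & seed_class S = iso_class R0 R.
Proof.
move=> fS; have [beta [R [eqR sR]]] := facet_seed fS; exists R => //.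
apply: functional_extensionality => R'; apply: propositional_extensionality.
split=> -[eqR' h]; split=> //.
  by case: h => beta' sR'; exact: (seed_frozen_iso fS sR sR').
case: h => s es; exists (fun k => beta (s^-1%g k)).
exact: (seed_perm sR es).
Qed.

Definition phi (X : FG T) : EG R0 :=
  exist (fun C => exists2 R, mutation_equiv R0 R & C = iso_class R0 R)
    (seed_class (sval X)) (seed_classE (proj2_sig X)).

Lemma phi_inj (X Y : FG T) : phi X = phi Y -> X = Y.
Proof.
move=> /(congr1 sval) /= e; apply: sval_inj.
have [beta [R [eqR sR]]] := facet_seed (proj2_sig X).
have : seed_class (sval X) R by split=> //; exists beta.
rewrite e => -[_ [beta' sR']].
by have [] := seed_unique eqR (proj2_sig X) (proj2_sig Y) sR sR'.
Qed.

Lemma phi_surj (C : EG R0) : exists X, phi X = C.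
Proof.
case: C => C hC; have [R eqR eC] := hC.
have [S [beta [fS sS]]] := reachable_seed eqR.
exists (exist _ S fS); apply: sval_inj => /=; rewrite eC.
apply: functional_extensionality => R'; apply: propositional_extensionality.
split=> -[eqR' h]; split=> //.
  by case: h => beta' sR'; exact: (seed_frozen_iso fS sS sR').
case: h => s es; exists (fun k => beta (s^-1%g k)).
exact: (seed_perm sS es).
Qed.

Lemma flip_clockwiseE S beta R k A S' : facet S -> seed S beta R -> flip S (beta k) A S' ->
  clockwise_flip S (beta k) A S' <-> c_positive R k.
Proof.
move=> fS sR fl; have [a [c [b [d [ek Q]]]]] := seed_quad k fS sR.
rewrite ek in fl *; have [-> ->] := flip_arc_unique Q fl.
split=> [cw e|pos_].
  by rewrite /c_matrix (seed_c sR Q ek); exact: (clockwise_positive fS Q cw).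
apply: (positive_clockwise fS Q) => e.
by rewrite -(seed_c sR Q ek); exact: pos_.
Qed.

Lemma mutation_flip S beta R k R' S' beta' : facet S -> facet S' -> mutation_equiv R0 R ->
  seed S beta R -> mutation k R R' -> seed S' beta' R' -> exists A, flip S (beta k) A S'.
Proof.
move=> fS fS' eqR sR mu sR'.
have [A [S1 [fl s1]]] := seed_flip fS sR mu; exists A.
have [_ fS1 _ _ _] := fl.
have eqR' := mutation_equiv_step eqR mu.
by have [-> _] := seed_unique eqR' fS' fS1 sR' s1.
Qed.

Lemma flip_mutation S beta R k A S' : facet S -> mutation_equiv R0 R ->
  seed S beta R -> flip S (beta k) A S' ->
  exists2 R', mutation k R R' & seed_class S' R'.
Proof.
move=> fS eqR sR fl; have [R' mu] := mutation_exists R k; exists R' => //.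
have [A1 [S1 [fl1 s1]]] := seed_flip fS sR mu.
have [_ ->] := flip_unique_arc fl fl1.
split; first exact: mutation_equiv_step mu.
by exists (exchange_arc beta k A1).
Qed.

Lemma phi_arrow (X Y : FG T) : darrow X Y <-> darrow (phi X) (phi Y).
Proof.
have fX := proj2_sig X; have fY := proj2_sig Y; split.
  case=> p [A [fl cw]]; have [beta [R [eqR sR]]] := facet_seed fX.
  have [_ _ nb _ _] := fl; have [k ek] := (seed_nb sR p).1 nb; subst p.
  have [R' mu hR'] := flip_mutation fX eqR sR fl.
  exists k, R, R'; split=> //; first by split=> //; exists beta.
  exact/(flip_clockwiseE fX sR fl).
case=> k [R [R' [[eqR [beta sR]] [eqR' [beta' sR']] mu pos_]]].
have [A fl] := mutation_flip fX fY eqR sR mu sR'.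
by exists (beta k), A; split=> //; apply/(flip_clockwiseE fX sR fl).
Qed.

Lemma phi_commutes : commutes_with_flips_and_mutations phi.
Proof.
move=> S R [eqR [beta sR]]; have fS := proj2_sig S; exists beta; split.
- exact: (seed_inj sR).
- exact: (seed_nb sR).
move=> k S'; split=> [[A fl]|[R' mu [_ [beta' sR']]]].
  exact: (flip_mutation fS eqR sR fl).
exact: (mutation_flip fS (proj2_sig S') eqR sR mu sR').
Qed.

Lemma phi_iso : digraph_iso phi.
Proof.
split; last exact: phi_arrow.
(* [bijective] asks for an inverse function, extracted by choice from surjectivity. *)
pose g C := proj1_sig (constructive_indefinite_description _ (phi_surj C)).
have gK C : phi (g C) = C := proj2_sig (constructive_indefinite_description _ (phi_surj C)).
by exists g => // X; apply: phi_inj; rewrite gK.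
Qed.

End Main.

End Trees.

Theorem proposition7p8 (T : planeTree)
    (deg3 : forall v : T, ~~ leaf v -> degree v = 3) :
  exists phi : FG T -> EG (framed (@tree_quiver T)),
    digraph_iso phi /\ commutes_with_flips_and_mutations phi.
Proof.
(* Any leaf may serve as the origin of the numbering. *)
have [r lr] := ex_leaf deg3.
have /card_gt0P[q] : 0 < #|[set w | adj r w]| by rewrite -/(degree r) (eqP lr).
rewrite inE => rq; exists (phi deg3 lr rq); split; [exact: phi_iso|exact: phi_commutes].
Qed.
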